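(* Let $\mathcal{N}=(n_j)_{j\ge1}$ be a non-decreasing sequence of positive reals whose counting function satisfies $N(x)=Ax+O(x^\theta)$ for a constant $A$ and some $0\le\theta<1/2$, and let $\zeta(s)=\sum_j n_j^{-s}$ (so that $\zeta(s)-A/(s-1)$ extends analytically to $\operatorname{Re}s>\theta$). Then $\mathrm{LH}(\mathcal{N},Ax)$ holds if and only if $\zeta(1/2+\mathrm{i}\tau)\ll_\varepsilon|\tau|^\varepsilon$ (as $|\tau|\to\infty$) for every $\varepsilon>0$.
   Context: $N(x)=\#\{j:n_j\le x\}$. $\mathrm{LH}(\mathcal{N},Ax)$ means: for every $\varepsilon>0$ and $B>0$, $\sum_{n_j\le x}n_j^{-\mathrm{i} t}=\int_{n_1}^x Au^{-\mathrm{i} t}\,\mathrm{d}u+O_{\varepsilon,B}\bigl((Ax)^{1/2}|t|^\varepsilon\bigr)$ uniformly for real $t$ and $n_1\le x\le|t|^B$.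
   Formalization: The constant A is assumed positive: A < 0 is impossible, and for A = 0 (e.g. n_j = j^4) the error term (Ax)^{1/2} vanishes so LH fails at x = n_1 while ζ(1/2+iτ) is bounded, making the equivalence false. *)

(* Defs.v *)
From Stdlib Require Export Reals List ClassicalEpsilon.
From Coquelicot Require Export Coquelicot.
Open Scope R_scope.

(** The sequence [n_1 <= n_2 <= ...] is represented by [n : nat -> R] with
    [n_(j+1) = n j]; in particular [n_1] is [n 0%nat]. *)

Definition enumerates_le (n : nat -> R) (x : R) (l : list nat) : Prop :=
  NoDup l /\ forall j, In j l <-> n j <= x.

(** Meaningful only when [{j | n j <= x}] is finite; this finiteness is part of
    [counting_asymptotic] below. *)
Definition indices_le (n : nat -> R) (x : R) : list nat :=
  epsilon (inhabits nil) (enumerates_le n x).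

Definition counting (n : nat -> R) (x : R) : nat := length (indices_le n x).

Definition sum_le (n : nat -> R) (x : R) (f : R -> C) : C :=
  fold_right Cplus (RtoC 0) (map (fun j => f (n j)) (indices_le n x)).

Definition counting_asymptotic (n : nat -> R) (A theta : R) : Prop :=
  (forall x, exists l, enumerates_le n x l) /\
  exists K x0, 0 < x0 /\ forall x, x0 <= x ->
    Rabs (INR (counting n x) - A * x) <= K * Rpower x theta.

Definition Cexp (z : C) : C :=
  (RtoC (exp (Re z)) * (cos (Im z), sin (Im z)))%C.

(** [x ^ s] for a real base [x > 0]. *)
Definition Rcpow (x : R) (s : C) : C := Cexp (s * RtoC (ln x))%C.

(** The case [t = 0] is left out because [Rpower 0 B = 1]; with [0 ^ B = 0] the
    range [n_1 <= x <= |t| ^ B] is empty there, since [n_1 > 0]. *)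
Definition LH (n : nat -> R) (A : R) : Prop :=
  forall eps B, 0 < eps -> 0 < B ->
  exists K, forall t x, t <> 0 -> n 0%nat <= x <= Rpower (Rabs t) B ->
    Cmod (sum_le n x (fun u => Rcpow u (- (Ci * RtoC t))%C)
          - RInt (V := C_R_CompleteNormedModule)
              (fun u => (RtoC A * Rcpow u (- (Ci * RtoC t)))%C) (n 0%nat) x)%C
    <= K * (sqrt (A * x) * Rpower (Rabs t) eps).

Definition analytic_at (f : C -> C) (s : C) : Prop :=
  exists (a : nat -> C) (r : R), 0 < r /\
    forall z, Cmod (z - s)%C < r ->
      is_pseries (K := C_AbsRing) (V := C_NormedModule) a (z - s)%C (f z).

(** [zeta] is the Dirichlet series on [Re s > 1], continued to [Re s > theta],
    [s <> 1]. Values elsewhere are unconstrained. *)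
Definition is_zeta (n : nat -> R) (A theta : R) (zeta : C -> C) : Prop :=
  (forall s : C, 1 < Re s ->
     is_series (K := C_AbsRing) (V := C_NormedModule)
       (fun j => Rcpow (n j) (- s)%C) (zeta s)) /\
  exists G : C -> C,
    (forall s : C, theta < Re s -> analytic_at G s) /\
    (forall s : C, theta < Re s -> s <> RtoC 1 ->
       (zeta s - RtoC A / (s - RtoC 1))%C = G s).

Definition lindelof_bound (zeta : C -> C) : Prop :=
  forall eps, 0 < eps ->
  exists K T, 0 < T /\ forall tau, T <= Rabs tau ->
    Cmod (zeta (1 / 2, tau)) <= K * Rpower (Rabs tau) eps.

(* Main.v *)
Require Import Defs.
From Stdlib Require Import Lra Lia Permutation Compare_dec Factorial.

(** In the variable [u = ln x], let [E t u] be the error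
    [sum_(ln n_j <= u) n_j ^ (- i t) - A int_0^u exp ((1 - i t) r) dr].
    Abel summation against [N x - A x = O (x ^ theta)] shows that
    [zeta s - A / (s - 1)] is [s] times a Laplace integral, which converges for
    [Re s > theta] and is analytic there.  By the identity theorem every continuation
    agrees with it on the line [Re s = 1/2].

    If LH holds, [zeta (1/2 + i t)] is [int E t u exp (- u / 2) du / 2] up to [O(1)]: LH is used
    for [u <= B ln |t|], and the trivial bound [E t u = O (|t| exp (theta u))] beyond.

    Conversely no contour has to be moved: because [theta < 1/2], the function
    [g u = E t u exp (- u / 2)] is integrable, and its Fourier transform at [v] is
    [zeta (1/2 + i (t + v)) / (1/2 + i v)] up to the polar term.  Averaging against the Fejer
    kernel of height [V = |t| ^ (B + 1)] bounds [g * K_V] by [|t| ^ eps], and the weak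
    regularity [|g u - g y| = O (exp (y / 2) |u - y| + 1)], again a consequence of the
    asymptotics of [N], recovers [g y] itself. *)

(** * Real integrals *)

(** The obstacle is the sharp cutoff at [x]: recovering it from zeta on the critical line means
    inverting a Fourier transform that decays only like [1 / v]. A kernel of height [V] sees
    frequencies up to [|t| + V] and resolves [u] to scale [1 / V]. Near [y] the error moves by the
    new terms, about [A exp y |u - y|], plus [O (exp (theta y))]; after damping this is
    [exp (y / 2) |u - y| + O (1)], whose kernel average stays bounded once [V >= exp y]. So
    [x <= |t| ^ B] is what keeps [V] a power of [|t|], and the Lindelof bound at height [V] still
    costs only [|t| ^ eps]. The slow decay [1 / v] costs a factor [ln V], absorbed in the same way.
    The kernel is taken nonnegative so that the variation of [g] can be averaged in absolute value.
    All of this is done with real phases [cos (t u + phi)], a family closed under modulation: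
    multiplying by [cos ((y - u) v)] gives phases at the frequencies [t - v] and [t + v]. Integrals
    stop at a finite [Y], chosen after [t] and [y], on which the final constants do not depend. *)

Ltac eqR := match goal with |- @eq _ ?x ?y => change (@eq R x y) end.

Lemma lipschitz_continuous (f : R -> R) (L : R) :
  (forall x y, Rabs (f x - f y) <= L * Rabs (x - y)) -> forall x, continuous f x.
Proof.
  intros H x. apply continuity_pt_filterlim.
  assert (HL : 0 <= L).
  { specialize (H 1 0). replace (1 - 0) with 1 in H by ring.
    rewrite Rabs_R1 in H. pose proof (Rabs_pos (f 1 - f 0)). lra. }
  intros e He. exists (e / (L + 1)). split.
  - apply Rdiv_lt_0_compat; lra.
  - intros y [_ Hy]. simpl in *. unfold R_dist in *.
    apply Rle_lt_trans with (1 := H y x).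
    apply Rle_lt_trans with ((L + 1) * Rabs (y - x)).
    + pose proof (Rabs_pos (y - x)). nra.
    + apply Rmult_lt_reg_r with (/ (L + 1)). apply Rinv_0_lt_compat; lra.
      replace ((L + 1) * Rabs (y - x) * / (L + 1)) with (Rabs (y - x)) by (field; lra).
      exact Hy.
Qed.

Lemma Rabs_cos_le (x : R) : Rabs (cos x) <= 1.
Proof. pose proof (COS_bound x). apply Rabs_le; lra. Qed.

Lemma Rabs_sin_le (x : R) : Rabs (sin x) <= 1.
Proof. pose proof (SIN_bound x). apply Rabs_le; lra. Qed.

Lemma cos_lipschitz (x y : R) : Rabs (cos x - cos y) <= Rabs (x - y).
Proof.
  destruct (MVT_gen cos y x (fun z => - sin z)) as [c [_ Hc]].
  - intros z _. auto_derive; [easy | ring].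
  - intros z _. apply continuity_cos.
  - rewrite Hc, Rabs_mult, Rabs_Ropp.
    pose proof (Rabs_sin_le c). pose proof (Rabs_pos (x - y)). nra.
Qed.

Lemma ex_derive_continuous_everywhere (f df : R -> R) :
  (forall x, is_derive f x (df x)) -> forall x, continuous f x.
Proof. intros H x. apply (ex_derive_continuous (K := R_AbsRing) (V := R_NormedModule)). eexists; apply H. Qed.

Lemma ex_RInt_continuous_everywhere (f : R -> R) (a b : R) :
  (forall x, continuous f x) -> ex_RInt f a b.
Proof. intros H. apply (ex_RInt_continuous (V := R_CompleteNormedModule)). auto. Qed.

Lemma is_RInt_antiderivative (F f : R -> R) (a b : R) :
  (forall x, is_derive F x (f x)) -> (forall x, continuous f x) ->
  is_RInt f a b (F b - F a).
Proof.
  intros HF Hf. apply (is_RInt_derive (V := R_CompleteNormedModule) F f); auto.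
Qed.

Lemma RInt_antiderivative (F f : R -> R) (a b : R) :
  (forall x, is_derive F x (f x)) -> (forall x, continuous f x) ->
  RInt f a b = F b - F a.
Proof. intros; apply is_RInt_unique, is_RInt_antiderivative; auto. Qed.

Lemma is_derive_RInt_continuous (f : R -> R) (a x : R) :
  (forall y, continuous f y) -> is_derive (fun y => RInt f a y) x (f x).
Proof.
  intros H. apply (is_derive_RInt f (fun y => RInt f a y) a).
  - exists (mkposreal 1 Rlt_0_1). intros y _. apply (RInt_correct f).
    apply ex_RInt_continuous_everywhere, H.
  - apply H.
Qed.

Ltac smooth_continuous :=
  intros; apply (ex_derive_continuous (K := R_AbsRing) (V := R_NormedModule));
  auto_derive; auto.

Lemma RInt_Rmult (c : R) (f : R -> R) (a b : R) : ex_RInt f a b ->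
  RInt (fun u => c * f u) a b = c * RInt f a b.
Proof. exact (RInt_scal (V := R_CompleteNormedModule) f a b c). Qed.

Lemma RInt_Rplus (f g : R -> R) (a b : R) : ex_RInt f a b -> ex_RInt g a b ->
  RInt (fun u => f u + g u) a b = RInt f a b + RInt g a b.
Proof. exact (RInt_plus (V := R_CompleteNormedModule) f g a b). Qed.

Lemma RInt_Rminus (f g : R -> R) (a b : R) : ex_RInt f a b -> ex_RInt g a b ->
  RInt (fun u => f u - g u) a b = RInt f a b - RInt g a b.
Proof. exact (RInt_minus (V := R_CompleteNormedModule) f g a b). Qed.

Lemma ex_RInt_Rmult (c : R) (f : R -> R) (a b : R) : ex_RInt f a b ->
  ex_RInt (fun u => c * f u) a b.
Proof. exact (ex_RInt_scal (V := R_NormedModule) f a b c). Qed.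

Lemma ex_RInt_Rplus (f g : R -> R) (a b : R) : ex_RInt f a b -> ex_RInt g a b ->
  ex_RInt (fun u => f u + g u) a b.
Proof. exact (ex_RInt_plus (V := R_NormedModule) f g a b). Qed.

Lemma ex_RInt_Rminus (f g : R -> R) (a b : R) : ex_RInt f a b -> ex_RInt g a b ->
  ex_RInt (fun u => f u - g u) a b.
Proof. exact (ex_RInt_minus (V := R_NormedModule) f g a b). Qed.

Lemma continuous_Rmult (f g : R -> R) (x : R) : continuous f x -> continuous g x ->
  continuous (fun u => f u * g u) x.
Proof. exact (continuous_mult (K := R_AbsRing) f g x). Qed.

Lemma continuous_Rplus (f g : R -> R) (x : R) : continuous f x -> continuous g x ->
  continuous (fun u => f u + g u) x.
Proof. exact (continuous_plus (V := R_NormedModule) f g x). Qed.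

Lemma continuous_Rminus (f g : R -> R) (x : R) : continuous f x -> continuous g x ->
  continuous (fun u => f u - g u) x.
Proof. exact (continuous_minus (V := R_NormedModule) f g x). Qed.

Lemma is_derive_Rplus (f g : R -> R) (x l m : R) : is_derive f x l -> is_derive g x m ->
  is_derive (fun y => f y + g y) x (l + m).
Proof. exact (is_derive_plus (V := R_NormedModule) f g x l m). Qed.

Lemma is_derive_Rminus (f g : R -> R) (x l m : R) : is_derive f x l -> is_derive g x m ->
  is_derive (fun y => f y - g y) x (l - m).
Proof. exact (is_derive_minus (V := R_NormedModule) f g x l m). Qed.

Lemma is_derive_Rmult (c : R) (f : R -> R) (x l : R) : is_derive f x l ->
  is_derive (fun y => c * f y) x (c * l).
Proof. exact (is_derive_scal f x c l). Qed.

Lemma Rabs_RInt_le (f h : R -> R) (a b : R) :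
  a <= b -> ex_RInt f a b -> ex_RInt h a b ->
  (forall x, a <= x <= b -> Rabs (f x) <= h x) ->
  Rabs (RInt f a b) <= RInt h a b.
Proof.
  intros Hab Hf Hh H.
  apply (norm_RInt_le (V := R_NormedModule) f h a b); auto.
  - apply (RInt_correct f), Hf.
  - apply (RInt_correct h), Hh.
Qed.

Lemma exp_le_compat (x y : R) : x <= y -> exp x <= exp y.
Proof. intros [H | ->]; [left; apply exp_increasing; auto | right; auto]. Qed.

Lemma RInt_exp_decay (d a b : R) : d <> 0 ->
  RInt (fun u => exp (- d * u)) a b = (exp (- d * a) - exp (- d * b)) / d.
Proof.
  intros Hd.
  rewrite (RInt_antiderivative (fun u => - exp (- d * u) / d)).
  - eqR. field; auto.
  - intros x. auto_derive; [easy | field; auto].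
  - apply (ex_derive_continuous_everywhere _ (fun u => - d * exp (- d * u))).
    intros x. auto_derive; [easy | ring].
Qed.

Lemma ex_RInt_exp_decay (c d a b : R) : ex_RInt (fun u => c * exp (- d * u)) a b.
Proof.
  apply ex_RInt_continuous_everywhere.
  apply (ex_derive_continuous_everywhere _ (fun u => c * (- d * exp (- d * u)))).
  intros x. auto_derive; [easy | ring].
Qed.

Lemma Rabs_RInt_exp_decay_le (f : R -> R) (C d a b : R) :
  0 <= C -> 0 < d -> a <= b -> ex_RInt f a b ->
  (forall u, a <= u <= b -> Rabs (f u) <= C * exp (- d * u)) ->
  Rabs (RInt f a b) <= C / d * exp (- d * a).
Proof.
  intros HC Hd Hab Hf H.
  apply Rle_trans with (RInt (fun u => C * exp (- d * u)) a b).
  - apply Rabs_RInt_le; auto. apply ex_RInt_exp_decay.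
  - rewrite RInt_Rmult.
    2:{ generalize (ex_RInt_exp_decay 1 d a b). apply ex_RInt_ext. intros; eqR; ring. }
    rewrite RInt_exp_decay by lra.
    replace (C * ((exp (- d * a) - exp (- d * b)) / d))
      with (C / d * exp (- d * a) - C / d * exp (- d * b)) by (field; lra).
    assert (0 <= C / d) by (apply Rdiv_le_0_compat; lra).
    pose proof (exp_pos (- d * b)). nra.
Qed.

Lemma is_RInt_zero (a b : R) : is_RInt (fun _ : R => 0) a b 0.
Proof.
  assert (E := is_RInt_const (V := R_NormedModule) a b 0).
  change (scal (b - a) 0) with ((b - a) * 0) in E. now rewrite Rmult_0_r in E.
Qed.

(** A contribution switched on at [l]. As a function of [u], a sum over [lam j <= u] is a finite sum
    of such pieces, so it can be integrated term by term without a Stieltjes integral. *)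
Definition cut (l : R) (h : R -> R) (u : R) : R := if Rle_dec l u then h u else 0.

Lemma is_RInt_cut (l a b I : R) (h : R -> R) :
  a <= l <= b -> is_RInt h l b I -> is_RInt (cut l h) a b I.
Proof.
  intros Hl H. replace I with (0 + I) by ring.
  apply (is_RInt_Chasles (V := R_NormedModule) (cut l h) a l b 0 I).
  - apply is_RInt_ext with (fun _ => 0).
    + intros x Hx. rewrite Rmin_left, Rmax_right in Hx by lra.
      unfold cut. destruct Rle_dec; [lra | auto].
    + apply is_RInt_zero.
  - apply is_RInt_ext with h; auto.
    intros x Hx. rewrite Rmin_left, Rmax_right in Hx by lra.
    unfold cut. destruct Rle_dec; [auto | lra].
Qed.

(** * Finite real sums *)

Fixpoint rsum (f : nat -> R) (k : nat) : R :=
  match k with O => 0 | S k => rsum f k + f k end.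

Lemma rsum_ext (f g : nat -> R) (k : nat) :
  (forall j, (j < k)%nat -> f j = g j) -> rsum f k = rsum g k.
Proof.
  induction k; intros H; simpl; auto. rewrite IHk, H by auto; auto.
Qed.

Lemma rsum_plus (f g : nat -> R) (k : nat) :
  rsum (fun j => f j + g j) k = rsum f k + rsum g k.
Proof. induction k; simpl; try rewrite IHk; ring. Qed.

Lemma rsum_scal (c : R) (f : nat -> R) (k : nat) :
  rsum (fun j => c * f j) k = c * rsum f k.
Proof. induction k; simpl; try rewrite IHk; ring. Qed.

Lemma rsum_one (k : nat) : rsum (fun _ => 1) k = INR k.
Proof. induction k; simpl rsum; auto. rewrite IHk, S_INR. auto. Qed.

Lemma rsum_diff_le (f : nat -> R) (M : R) (m k : nat) : (m <= k)%nat ->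
  (forall j, (m <= j < k)%nat -> Rabs (f j) <= M) ->
  Rabs (rsum f k - rsum f m) <= M * (INR k - INR m).
Proof.
  intros Hmk. induction Hmk; intros H.
  - rewrite !Rminus_diag, Rabs_R0. lra.
  - simpl rsum. rewrite S_INR.
    replace (rsum f m0 + f m0 - rsum f m) with (rsum f m0 - rsum f m + f m0) by ring.
    eapply Rle_trans. apply Rabs_triang.
    assert (Rabs (rsum f m0 - rsum f m) <= M * (INR m0 - INR m))
      by (apply IHHmk; intros; apply H; lia).
    assert (Rabs (f m0) <= M) by (apply H; lia). lra.
Qed.

Lemma rsum_indicator (f : nat -> R) (m k : nat) : (m <= k)%nat ->
  rsum f m = rsum (fun j => if lt_dec j m then f j else 0) k.
Proof.
  intros Hmk. induction Hmk.
  - apply rsum_ext. intros j Hj. destruct lt_dec; [auto | lia].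
  - simpl. rewrite <- IHHmk. destruct lt_dec; [lia | ring].
Qed.

Lemma is_RInt_rsum (f : nat -> R -> R) (I : nat -> R) (a b : R) (k : nat) :
  (forall j, (j < k)%nat -> is_RInt (f j) a b (I j)) ->
  is_RInt (fun u => rsum (fun j => f j u) k) a b (rsum I k).
Proof.
  induction k; intros H; simpl.
  - apply is_RInt_zero.
  - apply (is_RInt_plus (V := R_NormedModule)); auto.
Qed.

(** * Exchange of two integrals, one of them against a discontinuous weight *)

Section FubiniLipschitz.

Variables (g : R -> R) (F Phi : R -> R -> R) (a b M L : R).
Hypothesis ab : a <= b.
Hypothesis g_bound : forall u, a <= u <= b -> Rabs (g u) <= M.
Hypothesis g_int : forall f : R -> R, (forall u, continuous f u) ->
  ex_RInt (fun u => g u * f u) a b.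
Hypothesis F_cont : forall v u, continuous (fun u => F u v) u.
Hypothesis Phi_cont : forall v u, continuous (fun u => Phi u v) u.
Hypothesis F_lip : forall u v w, a <= u <= b -> Rabs (F u v - F u w) <= L * Rabs (v - w).
Hypothesis Phi_derive : forall u v, is_derive (Phi u) v (F u v).

Let lipschitz_const_pos : 0 <= L.
Proof.
  specialize (F_lip a 1 0 ltac:(lra)). replace (1 - 0) with 1 in F_lip by ring.
  rewrite Rabs_R1 in F_lip. pose proof (Rabs_pos (F a 1 - F a 0)). lra.
Qed.

Let bound_pos : 0 <= M.
Proof. pose proof (g_bound a). pose proof (Rabs_pos (g a)). lra. Qed.

Lemma Rabs_RInt_mult_le (f : R -> R) (m : R) : (forall u, continuous f u) ->
  (forall u, a <= u <= b -> Rabs (f u) <= m) ->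
  Rabs (RInt (fun u => g u * f u) a b) <= (b - a) * (M * m).
Proof.
  intros Hf Hm. apply abs_RInt_le_const; auto.
  intros u Hu. rewrite Rabs_mult.
  apply Rmult_le_compat; auto using Rabs_pos.
Qed.

Lemma RInt_mult_lipschitz (v w : R) :
  Rabs (RInt (fun u => g u * F u v) a b - RInt (fun u => g u * F u w) a b)
  <= (b - a) * M * L * Rabs (v - w).
Proof.
  assert (E : RInt (fun u => g u * F u v) a b - RInt (fun u => g u * F u w) a b
    = RInt (fun u => g u * (F u v - F u w)) a b).
  { symmetry. rewrite <- RInt_Rminus by (apply g_int; auto).
    apply RInt_ext. intros. eqR. ring. }
  rewrite E.
  replace ((b - a) * M * L * Rabs (v - w)) with ((b - a) * (M * (L * Rabs (v - w)))) by ring.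
  apply Rabs_RInt_mult_le; auto.
  intros u. apply continuous_Rminus; auto.
Qed.

(** The difference quotient of [Phi u] is a value of [F u] at an intermediate point, so by the
    Lipschitz condition it differs from [F u v] by at most [L |h|], uniformly in [u]. Nothing is
    asked of [g] beyond boundedness and integrability against continuous functions, because it will
    be an error term with jumps. *)
Lemma is_derive_RInt_mult (v : R) :
  is_derive (fun v => RInt (fun u => g u * Phi u v) a b) v
    (RInt (fun u => g u * F u v) a b).
Proof.
  apply is_derive_Reals. intros e He.
  set (D := (b - a) * M * L + 1).
  assert (HD : 1 <= D).
  { unfold D. assert (0 <= (b - a) * M * L); [|lra].
    apply Rmult_le_pos; auto. apply Rmult_le_pos; auto. lra. }
  assert (Hd : 0 < e / D) by (apply Rdiv_lt_0_compat; lra).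
  exists (mkposreal _ Hd). intros h Hh0 Hh. simpl in Hh.
  assert (E : (RInt (fun u => g u * Phi u (v + h)) a b - RInt (fun u => g u * Phi u v) a b) / h
     - RInt (fun u => g u * F u v) a b =
    RInt (fun u => g u * ((Phi u (v + h) - Phi u v) / h - F u v)) a b).
  { symmetry. transitivity (RInt (fun u => / h * (g u * Phi u (v + h) - g u * Phi u v)
      - g u * F u v) a b).
    - apply RInt_ext. intros. eqR. field; auto.
    - rewrite RInt_Rminus, RInt_Rmult, RInt_Rminus;
        auto using ex_RInt_Rminus, ex_RInt_Rmult.
      eqR. field; auto. }
  rewrite E.
  apply Rle_lt_trans with ((b - a) * (M * (L * Rabs h))).
  - apply Rabs_RInt_mult_le.
    + intros u.
      apply continuous_Rminus; auto.
      apply (continuous_Rmult (fun u => Phi u (v + h) - Phi u v) (fun _ => / h)).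
      * apply continuous_Rminus; auto.
      * apply continuous_const.
    + intros u Hu.
      destruct (MVT_gen (Phi u) v (v + h) (F u)) as [c [Hc E2]].
      * intros; auto.
      * intros. apply continuity_pt_filterlim, (ex_derive_continuous (K := R_AbsRing) (V := R_NormedModule)). eexists; apply Phi_derive.
      * rewrite E2. replace (F u c * (v + h - v) / h) with (F u c) by (field; auto).
        eapply Rle_trans. apply F_lip; auto. apply Rmult_le_compat_l; auto.
        revert Hc. unfold Rmin, Rmax, Rabs. repeat destruct Rle_dec; repeat destruct Rcase_abs; lra.
  - apply Rle_lt_trans with (D * Rabs h).
    + unfold D. pose proof (Rabs_pos h). nra.
    + apply Rmult_lt_reg_r with (/ D). apply Rinv_0_lt_compat; lra.
      replace (D * Rabs h * / D) with (Rabs h) by (field; lra). exact Hh.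
Qed.

(** Fubini through the fundamental theorem: the right side, as a function of [w], has the inner
    integral on the left as its derivative and vanishes at [0]. *)
Lemma RInt_swap_lipschitz (w : R) : (forall u, Phi u 0 = 0) ->
  is_RInt (fun v => RInt (fun u => g u * F u v) a b) 0 w
    (RInt (fun u => g u * Phi u w) a b).
Proof.
  intros H0.
  replace (RInt (fun u => g u * Phi u w) a b) with
    (RInt (fun u => g u * Phi u w) a b - RInt (fun u => g u * Phi u 0) a b).
  - apply (is_RInt_antiderivative (fun v => RInt (fun u => g u * Phi u v) a b)).
    + apply is_derive_RInt_mult.
    + apply (lipschitz_continuous _ ((b - a) * M * L)), RInt_mult_lipschitz.
  - rewrite (RInt_ext (fun u => g u * Phi u 0) (fun _ => 0)).
    + rewrite RInt_const. unfold scal; simpl; unfold mult; simpl. ring.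
    + intros. rewrite H0. eqR. ring.
Qed.

End FubiniLipschitz.
(** * The Fejer kernel *)

Definition triangle (V v : R) : R := Rmax 0 (1 - Rabs v / V).

Lemma triangle_bounds (V v : R) : 0 < V -> 0 <= triangle V v <= 1.
Proof.
  intros HV. unfold triangle. split; [apply Rmax_l |].
  apply Rmax_lub; [lra |]. assert (0 <= Rabs v / V); [|lra].
  apply Rdiv_le_0_compat; auto using Rabs_pos.
Qed.

Lemma triangle_inside (V v : R) : 0 < V -> 0 <= v <= V -> triangle V v = 1 - v / V.
Proof.
  intros HV Hv. unfold triangle. rewrite Rabs_pos_eq by lra. apply Rmax_right.
  apply Rmult_le_reg_r with V; auto. field_simplify; lra.
Qed.

Lemma triangle_lipschitz (V v w : R) : 0 < V ->
  Rabs (triangle V v - triangle V w) <= / V * Rabs (v - w).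
Proof.
  intros HV. unfold triangle.
  apply Rle_trans with (Rabs (Rabs v / V - Rabs w / V)).
  - generalize (Rabs v / V) (Rabs w / V). intros x y. unfold Rmax.
    repeat destruct Rle_dec; unfold Rabs; repeat destruct Rcase_abs; lra.
  - replace (Rabs v / V - Rabs w / V) with (/ V * (Rabs v - Rabs w)) by (field; lra).
    pose proof (Rinv_0_lt_compat V HV).
    rewrite Rabs_mult, (Rabs_pos_eq (/ V)) by lra.
    apply Rmult_le_compat_l; [lra | apply Rabs_triang_inv2].
Qed.

(** At [w = V] this is the Fejer kernel [(1 - cos (z V)) / (V z ^ 2)]. The upper limit [w] is kept
    free so that [fejer V z] is a primitive, the form in which [RInt_swap_lipschitz] takes it. *)
Definition fejer (V z w : R) : R := RInt (fun v => triangle V v * cos (z * v)) 0 w.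

Lemma continuous_triangle_cos (V z : R) : 0 < V ->
  forall v, continuous (fun v => triangle V v * cos (z * v)) v.
Proof.
  intros HV v. apply continuous_Rmult.
  - apply (lipschitz_continuous _ (/ V)). intros; apply triangle_lipschitz; auto.
  - apply (lipschitz_continuous _ (Rabs z)). intros x y.
    eapply Rle_trans. apply cos_lipschitz.
    rewrite <- Rmult_minus_distr_l, Rabs_mult. lra.
Qed.

Lemma fejer_derive (V z w : R) : 0 < V ->
  is_derive (fejer V z) w (triangle V w * cos (z * w)).
Proof.
  intros HV.
  apply (is_derive_RInt_continuous (fun v => triangle V v * cos (z * v))).
  apply continuous_triangle_cos; auto.
Qed.

Lemma fejer_lipschitz (V z z' w : R) : 0 < V ->
  Rabs (fejer V z w - fejer V z' w) <= w * w * Rabs (z - z').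
Proof.
  intros HV. unfold fejer.
  assert (X := fun z x y => ex_RInt_continuous_everywhere _ x y (continuous_triangle_cos V z HV)).
  rewrite <- RInt_Rminus by auto.
  set (f := fun u => triangle V u * cos (z * u) - triangle V u * cos (z' * u)).
  assert (Xf : forall x y, ex_RInt f x y) by (intros; apply ex_RInt_Rminus; auto).
  assert (B : forall v, Rabs v <= Rabs w -> Rabs (f v) <= Rabs w * Rabs (z - z')).
  { intros v Hv. unfold f. rewrite <- Rmult_minus_distr_l, Rabs_mult.
    pose proof (triangle_bounds V v HV). rewrite (Rabs_pos_eq (triangle V v)) by lra.
    pose proof (cos_lipschitz (z * v) (z' * v)).
    rewrite <- Rmult_minus_distr_r, Rabs_mult in H0.
    pose proof (Rabs_pos (z - z')). pose proof (Rabs_pos (cos (z * v) - cos (z' * v))). nra. }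
  destruct (Rle_dec 0 w) as [Hw | Hw].
  - eapply Rle_trans. apply abs_RInt_le_const with (M := Rabs w * Rabs (z - z')); auto.
    + intros v Hv. apply B. rewrite !Rabs_pos_eq; lra.
    + rewrite (Rabs_pos_eq w); lra.
  - rewrite <- (opp_RInt_swap (V := R_CompleteNormedModule)) by auto.
    change (Rabs (- RInt f w 0) <= w * w * Rabs (z - z')). rewrite Rabs_Ropp.
    eapply Rle_trans. apply abs_RInt_le_const with (M := Rabs w * Rabs (z - z')); auto; try lra.
    + intros v Hv. apply B. rewrite !Rabs_left1; lra.
    + rewrite (Rabs_left1 w); lra.
Qed.

(** One integration by parts on [[0, V]], where the triangle is linear. The denominator is
    multiplied out, which covers [z = 0] as well. *)
Lemma fejer_closed_form (V z : R) : 0 < V -> V * (z * z) * fejer V z V = 1 - cos (z * V).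
Proof.
  intros HV. unfold fejer.
  rewrite <- RInt_Rmult
    by (apply ex_RInt_continuous_everywhere, continuous_triangle_cos; auto).
  rewrite (RInt_ext _ (fun v => V * (z * z) * ((1 - v / V) * cos (z * v)))).
  2:{ intros v Hv. rewrite Rmin_left, Rmax_right in Hv by lra.
      rewrite triangle_inside by lra. auto. }
  rewrite (RInt_antiderivative (fun v => V * z * (1 - v / V) * sin (z * v) - cos (z * v))).
  - rewrite !Rmult_0_r, sin_0, cos_0. field; lra.
  - intros v. auto_derive; auto. eqR. field; lra.
  - intros v. apply continuous_Rmult; [apply continuous_const|].
    apply (ex_derive_continuous (K := R_AbsRing) (V := R_NormedModule)).
    auto_derive; auto.
Qed.

(** For such [z] the cosine is at least [1 / 2] throughout [[0, V]], and the triangle has area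
    [V / 2]. *)
Lemma fejer_lower (V z : R) : 0 < V -> Rabs z <= / (2 * V) -> V / 4 <= fejer V z V.
Proof.
  intros HV Hz.
  replace (V / 4) with (RInt (fun v => / 2 * (1 - v / V)) 0 V).
  - apply RInt_le; try lra.
    + apply ex_RInt_continuous_everywhere. intros v.
      apply (ex_derive_continuous (K := R_AbsRing) (V := R_NormedModule)). auto_derive; auto.
    + apply ex_RInt_continuous_everywhere, continuous_triangle_cos; auto.
    + intros v Hv. rewrite triangle_inside by lra.
      assert (0 <= 1 - v / V).
      { apply Rmult_le_reg_r with V; auto. field_simplify; lra. }
      assert (/ 2 <= cos (z * v)); [|nra].
      pose proof (cos_lipschitz (z * v) 0) as E. rewrite cos_0, Rminus_0_r, Rabs_mult in E.
      rewrite (Rabs_pos_eq v) in E by lra.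
      assert (Rabs z * v <= / (2 * V) * V) by (apply Rmult_le_compat; auto using Rabs_pos; lra).
      replace (/ (2 * V) * V) with (/ 2) in H0 by (field; lra).
      apply Rabs_le_between in E. lra.
  - rewrite (RInt_antiderivative (fun v => / 2 * (v - v * v / (2 * V)))).
    + eqR. field; lra.
    + intros v. auto_derive; auto. eqR. field; lra.
    + intros v. apply (ex_derive_continuous (K := R_AbsRing) (V := R_NormedModule)). auto_derive; auto.
Qed.

(** Visible from the factor [1 - cos (z V)] of the closed form; only [z = 0] escapes it and is
    covered by the lower bound. *)
Lemma fejer_nonneg (V z : R) : 0 < V -> 0 <= fejer V z V.
Proof.
  intros HV. destruct (Req_dec z 0) as [-> | Hz].
  - apply Rle_trans with (V / 4); [lra |]. apply fejer_lower; auto.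
    rewrite Rabs_R0. left. apply Rinv_0_lt_compat. lra.
  - assert (E := fejer_closed_form V z HV). pose proof (COS_bound (z * V)).
    assert (0 < z * z) by nra. assert (0 < V * (z * z)) by nra. nra.
Qed.

Lemma fejer_decay (V z : R) : 0 < V -> z * z * fejer V z V <= 2 / V.
Proof.
  intros HV. assert (E := fejer_closed_form V z HV). pose proof (COS_bound (z * V)).
  apply Rmult_le_reg_l with V; auto. replace (V * (2 / V)) with 2 by (field; lra). lra.
Qed.

Lemma fejer_far (V z : R) : 0 < V -> 1 <= Rabs z -> fejer V z V <= 2 / V.
Proof.
  intros HV Hz. pose proof (fejer_decay V z HV). pose proof (fejer_nonneg V z HV).
  assert (1 <= z * z) by (rewrite <- (Rabs_pos_eq (z * z)), Rabs_mult by nra; nra). nra.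
Qed.

(** Up to distance [d] the factor [|z|] is replaced by [d]; beyond it the quadratic decay gives
    [|z| * fejer <= 2 / (V |z|)]. The free [d] balances the two parts. *)
Lemma Rabs_mult_fejer_le (V z d : R) : 0 < V -> 0 < d ->
  Rabs z * fejer V z V <= d * fejer V z V + 2 / (V * d).
Proof.
  intros HV Hd. pose proof (fejer_nonneg V z HV).
  assert (0 <= 2 / (V * d)) by (apply Rdiv_le_0_compat; nra).
  destruct (Rle_dec (Rabs z) d) as [H1 | H1]; [nra |].
  assert (Rabs z * fejer V z V <= 2 / (V * d)); [|nra].
  apply Rmult_le_reg_l with d; auto. replace (d * (2 / (V * d))) with (2 / V) by (field; lra).
  eapply Rle_trans; [|apply (fejer_decay V z HV)].
  assert (z * z = Rabs z * Rabs z) by (rewrite <- Rabs_mult, Rabs_pos_eq; nra).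
  rewrite H2. assert (0 <= Rabs z * fejer V z V) by (pose proof (Rabs_pos z); nra). nra.
Qed.

(** * The complex exponential *)

Lemma is_series_C_spec (f : nat -> C) (l : C) :
  is_series (K := C_AbsRing) (V := C_NormedModule) f l <->
  forall e, 0 < e -> exists N, forall M, (N <= M)%nat ->
    Cmod (sum_n (G := C_AbelianMonoid) f M - l)%C < e.
Proof.
  unfold is_series.
  split.
  - intros H e He.
    assert (F := proj1 (filterlim_locally_ball_norm (K := C_AbsRing) (U := C_NormedModule) _ _) H
      (mkposreal e He)).
    destruct F as [N HN]. exists N. intros M HM. exact (HN M HM).
  - intros H. apply (filterlim_locally_ball_norm (K := C_AbsRing) (U := C_NormedModule)).
    intros e. destruct (H e (cond_pos e)) as [N HN]. exists N. intros M HM. exact (HN M HM).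
Qed.

Lemma Cmod_le_Rabs (z : C) : Cmod z <= Rabs (Re z) + Rabs (Im z).
Proof.
  replace z with (RtoC (Re z) + Ci * RtoC (Im z))%C at 1.
  - eapply Rle_trans. apply Cmod_triangle. rewrite Cmod_mult, !Cmod_R, Cmod_Ci. lra.
  - apply injective_projections; unfold Re, Im; simpl; ring.
Qed.

Lemma Rabs_Re_le (z : C) : Rabs (Re z) <= Cmod z.
Proof. apply Rle_trans with (2 := Rmax_Cmod z). apply Rmax_l. Qed.

Lemma Rabs_Im_le (z : C) : Rabs (Im z) <= Cmod z.
Proof. apply Rle_trans with (2 := Rmax_Cmod z). apply Rmax_r. Qed.

Lemma Cexp_plus (z w : C) : Cexp (z + w)%C = (Cexp z * Cexp w)%C.
Proof.
  unfold Cexp. destruct z as [a b], w as [c d]. unfold Re, Im; simpl.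
  rewrite exp_plus, cos_plus, sin_plus.
  apply injective_projections; simpl; ring.
Qed.

Lemma Cmod_Cexp (z : C) : Cmod (Cexp z) = exp (Re z).
Proof.
  unfold Cexp. rewrite Cmod_mult, Cmod_R, Rabs_pos_eq by (left; apply exp_pos).
  unfold Cmod; simpl. pose proof (sin2_cos2 (Im z)) as H. unfold Rsqr in H.
  replace (cos (Im z) * (cos (Im z) * 1) + sin (Im z) * (sin (Im z) * 1)) with 1 by lra.
  rewrite sqrt_1. ring.
Qed.

Fixpoint Cexp_poly (M : nat) (w : C) : C :=
  match M with
  | O => RtoC 1
  | S M' => (Cexp_poly M' w + w ^ M * RtoC (/ INR (fact M)))%C
  end.

(** A comparison principle: the mean value theorem on [[0, x]] makes both [b - f] and [b + f]
    nonnegative at [x]. *)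
Lemma Rabs_le_of_derive_le (f df b db : R -> R) (x : R) : 0 <= x ->
  (forall y, is_derive f y (df y)) -> (forall y, is_derive b y (db y)) ->
  (forall y, 0 <= y <= x -> Rabs (df y) <= db y) -> f 0 = 0 -> 0 <= b 0 ->
  Rabs (f x) <= b x.
Proof.
  intros Hx Hf Hb H Hf0 Hb0.
  assert (X : forall s, (s = 1 \/ s = -1) -> 0 <= b x - s * f x).
  { intros s Hs.
    destruct (MVT_gen (fun y => b y - s * f y) 0 x (fun y => db y - s * df y)) as [c [Hc E]].
    - intros y _. apply is_derive_Rminus; auto using is_derive_Rmult.
    - intros y _. apply continuity_pt_filterlim.
      apply (continuous_Rminus b (fun y => s * f y));
        [|apply (continuous_Rmult (fun _ => s) f); [apply continuous_const |]].
      + apply (ex_derive_continuous_everywhere b db Hb).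
      + apply (ex_derive_continuous_everywhere f df Hf).
    - rewrite Rmin_left, Rmax_right in Hc by lra. rewrite Hf0 in E.
      specialize (H c Hc). apply Rabs_le_between in H.
      assert (0 <= db c - s * df c) by (destruct Hs; subst; lra).
      assert (0 <= (db c - s * df c) * (x - 0)) by (apply Rmult_le_pos; lra). lra. }
  assert (X1 := X 1 (or_introl eq_refl)). assert (X2 := X (-1) (or_intror eq_refl)).
  apply Rabs_le; lra.
Qed.

(** The Taylor remainder of the exponential, read along the ray [x w] with [x] real, so that
    one-variable real calculus suffices to bound it. *)
Definition exp_ray_remainder (M : nat) (w : C) (x : R) : C :=
  (Cexp (RtoC x * w) - Cexp_poly M (RtoC x * w))%C.

Definition is_Cderive (f : R -> C) (x : R) (l : C) : Prop :=
  is_derive (fun y => Re (f y)) x (Re l) /\ is_derive (fun y => Im (f y)) x (Im l).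

Lemma is_Cderive_plus (f g : R -> C) (x : R) (l m : C) :
  is_Cderive f x l -> is_Cderive g x m -> is_Cderive (fun y => f y + g y)%C x (l + m)%C.
Proof.
  intros [F1 F2] [G1 G2]. split.
  - apply (is_derive_Rplus (fun y => Re (f y)) (fun y => Re (g y))); auto.
  - apply (is_derive_Rplus (fun y => Im (f y)) (fun y => Im (g y))); auto.
Qed.

Lemma is_Cderive_scal (c : C) (f : R -> C) (x : R) (l : C) :
  is_Cderive f x l -> is_Cderive (fun y => c * f y)%C x (c * l)%C.
Proof.
  intros [F1 F2]. split.
  - apply (is_derive_Rminus (fun y => Re c * Re (f y)) (fun y => Im c * Im (f y)));
      apply is_derive_Rmult; auto.
  - apply (is_derive_Rplus (fun y => Re c * Im (f y)) (fun y => Im c * Re (f y)));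
      apply is_derive_Rmult; auto.
Qed.

Lemma is_Cderive_ext (f g : R -> C) (x : R) (l m : C) :
  (forall y, f y = g y) -> l = m -> is_Cderive f x l -> is_Cderive g x m.
Proof.
  intros H <- [F1 F2]. split; (eapply is_derive_ext; [|eassumption]);
    intros; simpl; rewrite H; auto.
Qed.

Lemma is_Cderive_Cexp_ray (w : C) (x : R) :
  is_Cderive (fun y => Cexp (RtoC y * w)%C) x (w * Cexp (RtoC x * w))%C.
Proof.
  destruct w as [a b]. unfold Cexp, is_Cderive, Re, Im; simpl. split.
  - auto_derive; auto. unfold Rminus. ring.
  - auto_derive; auto. unfold Rminus. ring.
Qed.

Lemma is_Cderive_Cpow_ray (w : C) (k : nat) (x : R) :
  is_Cderive (fun y => (RtoC y * w) ^ S k * RtoC (/ INR (fact (S k))))%C x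
    (w * ((RtoC x * w) ^ k * RtoC (/ INR (fact k))))%C.
Proof.
  assert (Hk : INR (fact k) <> 0) by apply INR_fact_neq_0.
  assert (Hk1 : INR (S k) <> 0) by (apply not_0_INR; lia).
  apply is_Cderive_ext with (f := fun y => (w ^ S k * RtoC (y ^ S k / INR (fact (S k))))%C)
    (l := (w ^ S k * RtoC (x ^ k / INR (fact k)))%C).
  - intros y. rewrite Cpow_mult_l, <- RtoC_pow. unfold Rdiv. rewrite RtoC_mult. ring.
  - rewrite Cpow_mult_l, <- RtoC_pow, Cpow_S. unfold Rdiv. rewrite RtoC_mult. ring.
  - apply is_Cderive_scal. split; unfold Re, Im; simpl fst; simpl snd.
    + replace (x ^ k / INR (fact k)) with (INR (S k) * 1 * x ^ k / INR (fact (S k))).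
      * apply (is_derive_ext (fun y => / INR (fact (S k)) * y ^ S k)).
        { intros y. unfold Rdiv. rewrite Rmult_comm. auto. }
        replace (INR (S k) * 1 * x ^ k / INR (fact (S k))) with
          (/ INR (fact (S k)) * (INR (S k) * 1 * x ^ k)) by (unfold Rdiv; ring).
        apply is_derive_Rmult.
        apply (is_derive_pow (fun y => y) (S k) x 1).
        apply (is_derive_id (K := R_AbsRing) x).
      * rewrite fact_simpl, mult_INR. field. auto.
    + apply (is_derive_const (V := R_NormedModule) 0).
Qed.

(** Differentiation along the ray lowers the order by one, which is what allows the remainder to be
    bounded by induction on [M]. *)
Lemma exp_ray_remainder_derive (M : nat) (w : C) (x : R) :
  is_Cderive (exp_ray_remainder (S M) w) x (w * exp_ray_remainder M w x)%C.
Proof.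
  unfold exp_ray_remainder.
  assert (P : forall M, is_Cderive (fun y => Cexp_poly (S M) (RtoC y * w)) x
     (w * Cexp_poly M (RtoC x * w))%C).
  { clear M. induction M.
    - apply is_Cderive_ext with (f := fun y => (RtoC 1 + (RtoC y * w) ^ 1 * RtoC (/ INR (fact 1)))%C)
        (l := (RtoC 0 + w * ((RtoC x * w) ^ 0 * RtoC (/ INR (fact 0))))%C).
      + auto.
      + simpl. rewrite Rinv_1. ring.
      + apply is_Cderive_plus; [|apply is_Cderive_Cpow_ray].
        split; apply (is_derive_const (V := R_NormedModule)).
    - apply is_Cderive_ext with (f := fun y => (Cexp_poly (S M) (RtoC y * w)
          + (RtoC y * w) ^ S (S M) * RtoC (/ INR (fact (S (S M)))))%C)
        (l := (w * Cexp_poly M (RtoC x * w)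
          + w * ((RtoC x * w) ^ S M * RtoC (/ INR (fact (S M)))))%C).
      + auto.
      + cbn [Cexp_poly]. ring.
      + apply is_Cderive_plus; auto. apply is_Cderive_Cpow_ray. }
  apply is_Cderive_ext with (f := fun y => (Cexp (RtoC y * w) + (- RtoC 1) * Cexp_poly (S M) (RtoC y * w))%C)
    (l := (w * Cexp (RtoC x * w) + (- RtoC 1) * (w * Cexp_poly M (RtoC x * w)))%C).
  - intros. ring.
  - ring.
  - apply is_Cderive_plus; [apply is_Cderive_Cexp_ray | apply is_Cderive_scal, P].
Qed.

Lemma exp_ray_remainder_zero (M : nat) (w : C) : exp_ray_remainder M w 0 = RtoC 0.
Proof.
  unfold exp_ray_remainder. replace (RtoC 0 * w)%C with (RtoC 0) by ring.
  replace (Cexp_poly M (RtoC 0)) with (RtoC 1).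
  - unfold Cexp. simpl. rewrite exp_0, cos_0, sin_0.
    apply injective_projections; simpl; ring.
  - induction M; auto. cbn [Cexp_poly]. rewrite <- IHM, Cpow_S. ring.
Qed.

(** The constant [2] only serves to estimate real and imaginary parts separately. *)
Lemma exp_ray_remainder_le (M : nat) (w : C) (x : R) : 0 <= x ->
  Rabs (Re (exp_ray_remainder M w x)) <=
    (2 * Cmod w * x) ^ S M / INR (fact (S M)) * exp (Cmod w * x) /\
  Rabs (Im (exp_ray_remainder M w x)) <=
    (2 * Cmod w * x) ^ S M / INR (fact (S M)) * exp (Cmod w * x).
Proof.
  set (r := Cmod w). assert (Hr : 0 <= r) by apply Cmod_ge_0.
  set (b := fun (M : nat) x => (2 * r * x) ^ M / INR (fact M) * exp (r * x)).
  assert (Hb : forall M y, is_derive (b (S M)) y (2 * r * b M y + r * b (S M) y)).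
  { intros k y. unfold b.
    assert (Hk : INR (fact k) <> 0) by apply INR_fact_neq_0.
    assert (Hk1 : INR (S k) <> 0) by (apply not_0_INR; lia).
    auto_derive; auto. cbn [Init.Nat.pred].
    change (match k with 0%nat => 1 | S _ => INR k + 1 end) with (INR (S k)).
    change (fact k + k * fact k)%nat with (fact (S k)).
    rewrite fact_simpl, mult_INR, <- tech_pow_Rmult. field. auto. }
  assert (Hbp : forall M y, 0 <= y -> 0 <= b M y).
  { intros k y Hy. unfold b. apply Rmult_le_pos; [|left; apply exp_pos].
    apply Rdiv_le_0_compat; [|apply INR_fact_lt_0]. apply pow_le. nra. }
  assert (Hb0 : forall M, 0 <= b M 0) by (intros; apply Hbp; lra).
  (* One integration from order [k] to [k + 1]: the derivative [w f] has modulus at most [2 r b k],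
     dominated by the derivative [2 r b k + r b (k + 1)] of [b (k + 1)]. The [2] lost in passing
     from the two components to the modulus reappears as the factor [2 r x] inside [b]. *)
  assert (Step : forall M (f : R -> C), (forall y, 0 <= y -> Cmod (f y) <= 2 * b M y) ->
     forall g, (forall y, is_Cderive g y (w * f y)%C) -> g 0 = RtoC 0 ->
     forall y, 0 <= y -> Rabs (Re (g y)) <= b (S M) y /\ Rabs (Im (g y)) <= b (S M) y).
  { intros k f Hf g Hg Hg0 y Hy.
    assert (Z : forall z, 0 <= z <= y -> Cmod (w * f z) <= 2 * r * b k z + r * b (S k) z).
    { intros z Hz. rewrite Cmod_mult. fold r. specialize (Hf z ltac:(lra)).
      pose proof (Hbp (S k) z ltac:(lra)). nra. }
    split.
    - apply (Rabs_le_of_derive_le (fun y => Re (g y)) (fun y => Re (w * f y)%C) (b (S k))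
        (fun y => 2 * r * b k y + r * b (S k) y)); auto.
      + intros z. apply Hg.
      + intros z Hz. eapply Rle_trans. apply Rabs_Re_le. auto.
      + rewrite Hg0. auto.
    - apply (Rabs_le_of_derive_le (fun y => Im (g y)) (fun y => Im (w * f y)%C) (b (S k))
        (fun y => 2 * r * b k y + r * b (S k) y)); auto.
      + intros z. apply Hg.
      + intros z Hz. eapply Rle_trans. apply Rabs_Im_le. auto.
      + rewrite Hg0. auto. }
  revert x. change (forall x, 0 <= x -> Rabs (Re (exp_ray_remainder M w x)) <= b (S M) x /\
    Rabs (Im (exp_ray_remainder M w x)) <= b (S M) x).
  induction M.
  - apply (Step O (fun y => Cexp (RtoC y * w))).
    + intros y Hy. rewrite Cmod_Cexp. unfold b. simpl pow. simpl fact.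
      assert (exp (Re (RtoC y * w)) <= exp (r * y)).
      { apply exp_le_compat. pose proof (Rabs_Re_le w) as H. fold r in H.
        apply Rabs_le_between in H. unfold Re, RtoC in *; simpl in *. nra. }
      simpl INR. pose proof (exp_pos (r * y)). lra.
    + intros y. unfold exp_ray_remainder.
      apply is_Cderive_ext with (f := fun y => (Cexp (RtoC y * w) + (- RtoC 1))%C)
        (l := (w * Cexp (RtoC y * w) + RtoC 0)%C).
      * intros. simpl. ring.
      * ring.
      * apply is_Cderive_plus; [apply is_Cderive_Cexp_ray |].
        split; apply (is_derive_const (V := R_NormedModule)).
    + apply exp_ray_remainder_zero.
  - apply (Step (S M) (exp_ray_remainder M w)).
    + intros y Hy. eapply Rle_trans. apply Cmod_le_Rabs. destruct (IHM y Hy). lra.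
    + intros y. apply exp_ray_remainder_derive.
    + apply exp_ray_remainder_zero.
Qed.

Lemma pow_fact_le_exp (x : R) (k : nat) : 0 <= x -> x ^ k / INR (fact k) <= exp x.
Proof.
  intros Hx. eapply Rle_trans; [|apply (exp_ge_taylor x k Hx)].
  destruct k; [apply Rle_refl |]. rewrite tech5.
  match goal with |- ?x <= ?s + ?x => assert (0 <= s); [|lra] end.
  apply cond_pos_sum. intros j. apply Rdiv_le_0_compat; [apply pow_le; auto | apply INR_fact_lt_0].
Qed.

(** Since [2 |w| <= q / 2], the remainder splits off [(1 / 2) ^ (M + 1)], and
    [q ^ (M + 1) / (M + 1)!] is at most [exp q]. The bound is geometric in [M] at the price of an
    exponential in [q], which can later be integrated. *)
Lemma Cexp_poly_error (M : nat) (w : C) (q : R) : 4 * Cmod w <= q ->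
  Cmod (Cexp w - Cexp_poly M w)%C <= (1 / 2) ^ M * exp (q + Cmod w).
Proof.
  intros Hq.
  assert (Hw : 0 <= Cmod w) by apply Cmod_ge_0.
  destruct (exp_ray_remainder_le M w 1 ltac:(lra)) as [H1 H2].
  unfold exp_ray_remainder in *. replace (RtoC 1 * w)%C with w in * by ring.
  rewrite !Rmult_1_r in *. eapply Rle_trans. apply Cmod_le_Rabs.
  assert (E : (2 * Cmod w) ^ S M / INR (fact (S M)) * exp (Cmod w) <=
    (1 / 2) ^ S M * exp (q + Cmod w)).
  { rewrite exp_plus, <- Rmult_assoc. apply Rmult_le_compat_r; [left; apply exp_pos |].
    apply Rle_trans with ((1 / 2 * q) ^ S M / INR (fact (S M))).
    - apply Rmult_le_compat_r; [left; apply Rinv_0_lt_compat, INR_fact_lt_0 |].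
      apply pow_incr. lra.
    - rewrite Rpow_mult_distr. unfold Rdiv. rewrite Rmult_assoc.
      apply Rmult_le_compat_l; [apply pow_le; lra |]. apply pow_fact_le_exp. lra. }
  replace ((1 / 2) ^ M) with (2 * (1 / 2) ^ S M) by (simpl; field). lra.
Qed.

Definition Ccontinuous (f : R -> C) : Prop :=
  (forall u, continuous (fun u => Re (f u)) u) /\ (forall u, continuous (fun u => Im (f u)) u).

Lemma Ccontinuous_const (c : C) : Ccontinuous (fun _ => c).
Proof. split; intros; apply continuous_const. Qed.

Lemma Ccontinuous_ext (f g : R -> C) : (forall u, f u = g u) -> Ccontinuous f -> Ccontinuous g.
Proof.
  intros H [F1 F2]. split; intros u.
  - apply (continuous_ext (fun u => Re (f u))); auto. intros; rewrite H; auto.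
  - apply (continuous_ext (fun u => Im (f u))); auto. intros; rewrite H; auto.
Qed.

Lemma Ccontinuous_RtoC (f : R -> R) : (forall u, continuous f u) -> Ccontinuous (fun u => RtoC (f u)).
Proof. intros H; split; intros; auto. apply continuous_const. Qed.

Lemma Ccontinuous_plus (f g : R -> C) : Ccontinuous f -> Ccontinuous g ->
  Ccontinuous (fun u => f u + g u)%C.
Proof.
  intros [F1 F2] [G1 G2]. split; intros u.
  - apply (continuous_Rplus (fun u => Re (f u)) (fun u => Re (g u))); auto.
  - apply (continuous_Rplus (fun u => Im (f u)) (fun u => Im (g u))); auto.
Qed.

Lemma Ccontinuous_mult (f g : R -> C) : Ccontinuous f -> Ccontinuous g ->
  Ccontinuous (fun u => f u * g u)%C.
Proof.
  intros [F1 F2] [G1 G2]. split; intros u.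
  - apply (continuous_Rminus (fun u => Re (f u) * Re (g u)) (fun u => Im (f u) * Im (g u)));
      apply continuous_Rmult; auto.
  - apply (continuous_Rplus (fun u => Re (f u) * Im (g u)) (fun u => Im (f u) * Re (g u)));
      apply continuous_Rmult; auto.
Qed.

Lemma Ccontinuous_pow (f : R -> C) (k : nat) : Ccontinuous f -> Ccontinuous (fun u => f u ^ k)%C.
Proof.
  intros H. induction k; simpl; [apply Ccontinuous_const | apply Ccontinuous_mult; auto].
Qed.

(** [exp (- s u)], that is [x ^ (- s)] at [x = exp u]. *)
Definition Cexp_ray (s : C) (u : R) : C := Cexp (RtoC u * - s)%C.

Lemma Ccontinuous_Cexp_ray (s : C) : Ccontinuous (Cexp_ray s).
Proof.
  split; intros u; apply (ex_derive_continuous (K := R_AbsRing) (V := R_NormedModule));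
    destruct (is_Cderive_Cexp_ray (- s)%C u) as [H1 H2]; eexists; eassumption.
Qed.

Lemma Cmod_Cexp_ray (s : C) (u : R) : Cmod (Cexp_ray s u) = exp (- Re s * u).
Proof.
  unfold Cexp_ray. rewrite Cmod_Cexp. f_equal. unfold Re, RtoC; simpl. ring.
Qed.

Lemma Cexp_ray_plus (s z : C) (u : R) :
  Cexp_ray (s + z)%C u = (Cexp_ray s u * Cexp (RtoC (- u) * z))%C.
Proof.
  unfold Cexp_ray. rewrite <- Cexp_plus. f_equal. rewrite RtoC_opp. ring.
Qed.

(** * Sums over the sequence, in the logarithmic variable *)

Section WeightedSums.

(** Here [lam j] stands for [ln n_j] and [cnt u] for [N (exp u)]. The left end [a] lies at least [1]
    below every [lam j], so errors vanish at [a] and a window of radius [1] around any [y >= a + 1]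
    stays in range. The main term is [A int_1^x dw] for [x >= 1] and [0] below, hence
    [exp (Rmax u 0) - 1]. *)
Variables (lam : nat -> R) (cnt : R -> nat) (A K theta a : R).
Hypothesis cnt_spec : forall j u, (j < cnt u)%nat <-> lam j <= u.
Hypothesis A_pos : 0 < A.
Hypothesis K_pos : 0 <= K.
Hypothesis theta_nonneg : 0 <= theta.
Hypothesis a_neg : a <= -1.
Hypothesis a_lam : forall j, a + 1 <= lam j.
Hypothesis cnt_asym : forall u, a <= u ->
  Rabs (INR (cnt u) - A * (exp (Rmax u 0) - 1)) <= K * exp (theta * u).

(** [int_1^x c (ln w) dw] at [x = exp u], after the substitution [w = exp r]. *)
Definition wint (c : R -> R) (u : R) : R := RInt (fun r => exp r * c r) 0 u.

(** The integral of [c] over [(-oo, u]] against [d (cnt r) - A exp r dr], the second part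
    being restricted to [r >= 0]. *)
Definition werror (c : R -> R) (u : R) : R :=
  rsum (fun j => c (lam j)) (cnt u) - A * wint c (Rmax u 0).

Lemma cnt_le (u v : R) : u <= v -> (cnt u <= cnt v)%nat.
Proof.
  intros Huv. destruct (Nat.le_gt_cases (cnt u) (cnt v)) as [|H]; auto.
  assert (E := proj1 (cnt_spec (cnt v) u) H).
  assert (F : (cnt v < cnt v)%nat) by (apply cnt_spec; lra). lia.
Qed.

Lemma rsum_cnt (f : nat -> R) (u Y : R) : u <= Y ->
  rsum f (cnt u) = rsum (fun j => cut (lam j) (fun _ => f j) u) (cnt Y).
Proof.
  intros H. rewrite (rsum_indicator f _ _ (cnt_le _ _ H)).
  apply rsum_ext. intros j _. unfold cut. pose proof (cnt_spec j u).
  destruct lt_dec, Rle_dec; auto; tauto.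
Qed.

Lemma continuous_exp_mult (c : R -> R) : (forall u, continuous c u) ->
  forall u, continuous (fun r => exp r * c r) u.
Proof.
  intros Hc u. apply continuous_Rmult; auto.
  apply continuity_pt_filterlim, derivable_continuous, derivable_exp.
Qed.

Lemma wint_derive (c : R -> R) (u : R) : (forall u, continuous c u) ->
  is_derive (wint c) u (exp u * c u).
Proof.
  intros Hc. apply (is_derive_RInt_continuous (fun r => exp r * c r)).
  apply continuous_exp_mult; auto.
Qed.

Lemma wint_zero (c : R -> R) : wint c 0 = 0.
Proof. exact (RInt_point (V := R_CompleteNormedModule) 0 (fun r => exp r * c r)). Qed.

Lemma werror_cut (c : R -> R) (u Y : R) : u <= Y ->
  werror c u = rsum (fun j => cut (lam j) (fun _ => c (lam j)) u) (cnt Y)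
           - A * cut 0 (wint c) u.
Proof.
  intros H. unfold werror. rewrite (rsum_cnt _ u Y H).
  f_equal. f_equal. unfold cut, Rmax.
  destruct (Rle_dec u 0), (Rle_dec 0 u); auto; try lra.
  - replace u with 0 by lra. auto.
  - apply wint_zero.
Qed.

(** Abel summation, the identity on which both directions rest. A jump at [lam j] contributes
    [c (lam j)] times the integral of [p] from [lam j] to [Y], that is [P Y - P (lam j)]; the
    continuous part is the product rule for [wint c * P]. It lets the weight be changed: [c = 1]
    brings in the counting asymptotics, [c] a phase brings in LH. *)
Lemma werror_abel (c P p : R -> R) (Y : R) : 0 <= Y ->
  (forall u, continuous c u) -> (forall u, continuous p u) ->
  (forall u, is_derive P u (p u)) ->
  is_RInt (fun u => werror c u * p u) a Y (P Y * werror c Y - werror (fun u => c u * P u) Y).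
Proof.
  intros HY Hc Hp HP.
  assert (HPc : forall u, continuous P u) by (apply (ex_derive_continuous_everywhere P p HP)).
  set (f := fun u => rsum (fun j => cut (lam j) (fun u => c (lam j) * p u) u) (cnt Y)
                     - A * cut 0 (fun u => wint c u * p u) u).
  apply is_RInt_ext with f.
  { intros u Hu. rewrite Rmin_left, Rmax_right in Hu by lra. unfold f.
    rewrite (werror_cut c u Y) by lra.
    rewrite Rmult_minus_distr_r. rewrite (Rmult_comm (rsum _ _)), <- rsum_scal. f_equal.
    - apply rsum_ext. intros j _. unfold cut. destruct Rle_dec; ring.
    - unfold cut. destruct Rle_dec; ring. }
  replace (P Y * werror c Y - werror (fun u => c u * P u) Y) with
    (rsum (fun j => c (lam j) * (P Y - P (lam j))) (cnt Y)
     - A * (wint c Y * P Y - wint (fun u => c u * P u) Y)).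
  2:{ unfold werror. rewrite Rmax_left by lra.
      replace (rsum (fun j => c (lam j) * (P Y - P (lam j))) (cnt Y))
        with (P Y * rsum (fun j => c (lam j)) (cnt Y)
              - rsum (fun j => c (lam j) * P (lam j)) (cnt Y)).
      - ring.
      - induction (cnt Y); simpl; [ring | rewrite <- IHn; ring]. }
  apply (is_RInt_minus (V := R_NormedModule)).
  - apply is_RInt_rsum. intros j Hj. apply cnt_spec in Hj.
    apply is_RInt_cut. { specialize (a_lam j); lra. }
    apply (is_RInt_scal (V := R_NormedModule) p).
    apply is_RInt_antiderivative; auto.
  - apply (is_RInt_scal (V := R_NormedModule)). apply is_RInt_cut. lra.
    replace (wint c Y * P Y - wint (fun u => c u * P u) Y) with
      ((wint c Y * P Y - wint (fun u => c u * P u) Y)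
       - (wint c 0 * P 0 - wint (fun u => c u * P u) 0)) by (rewrite !wint_zero; ring).
    apply (is_RInt_antiderivative (fun u => wint c u * P u - wint (fun u => c u * P u) u)).
    + intros u.
      replace (wint c u * p u) with
        ((exp u * c u) * P u + wint c u * p u - exp u * (c u * P u)) by ring.
      apply (is_derive_minus (V := R_NormedModule)).
      * apply (is_derive_mult (K := R_AbsRing) (wint c) P).
        -- apply wint_derive; auto.
        -- apply HP.
        -- intros; apply Rmult_comm.
      * apply (wint_derive (fun u => c u * P u)). intros; apply continuous_Rmult; auto.
    + intros u. apply continuous_Rmult; auto.
      apply (ex_derive_continuous_everywhere _ (fun u => exp u * c u)).
      intros; apply wint_derive; auto.
Qed.

(** Integrability also comes out of Abel summation, applied to a primitive of [f] on a longer
    interval and then restricted. *)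
Lemma ex_RInt_werror (c f : R -> R) (x y : R) :
  (forall u, continuous c u) -> (forall u, continuous f u) -> a <= x <= y ->
  ex_RInt (fun u => werror c u * f u) x y.
Proof.
  intros Hc Hf Hxy.
  assert (E : ex_RInt (fun u => werror c u * f u) a (Rmax y 0)).
  { eexists. apply werror_abel with (P := fun u => RInt f 0 u); auto.
    - apply Rmax_r.
    - intros. apply is_derive_RInt_continuous; auto. }
  apply (ex_RInt_Chasles_1 (V := R_CompleteNormedModule)) with (Rmax y 0).
  { split; [lra | apply Rmax_l]. }
  apply (ex_RInt_Chasles_2 (V := R_CompleteNormedModule)) with a; auto.
  split; [lra |]. apply Rle_trans with y; [lra | apply Rmax_l].
Qed.

Lemma werror_linear (k1 k2 : R) (c1 c2 : R -> R) (u : R) :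
  (forall u, continuous c1 u) -> (forall u, continuous c2 u) ->
  werror (fun u => k1 * c1 u + k2 * c2 u) u = k1 * werror c1 u + k2 * werror c2 u.
Proof.
  intros H1 H2. unfold werror. rewrite rsum_plus, !rsum_scal.
  replace (wint (fun u => k1 * c1 u + k2 * c2 u) (Rmax u 0)) with
    (k1 * wint c1 (Rmax u 0) + k2 * wint c2 (Rmax u 0)). { ring. }
  unfold wint.
  assert (X1 := continuous_exp_mult _ H1). assert (X2 := continuous_exp_mult _ H2).
  rewrite <- !RInt_Rmult, <- RInt_Rplus;
    auto using ex_RInt_continuous_everywhere, ex_RInt_Rmult.
  apply RInt_ext. intros; eqR; ring.
Qed.

Lemma werror_ext (c1 c2 : R -> R) (u : R) : (forall u, c1 u = c2 u) -> werror c1 u = werror c2 u.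
Proof.
  intros H. unfold werror, wint. f_equal; [apply rsum_ext; auto | f_equal].
  apply RInt_ext. intros; rewrite H; auto.
Qed.

Lemma wint_one (u : R) : wint (fun _ => 1) u = exp u - 1.
Proof.
  replace (exp u - 1) with (exp u - exp 0) by (rewrite exp_0; auto).
  apply (RInt_antiderivative exp).
  - intros. auto_derive; [auto | ring].
  - apply continuous_exp_mult. intros; apply continuous_const.
Qed.

Lemma werror_one (u : R) : werror (fun _ => 1) u = INR (cnt u) - A * (exp (Rmax u 0) - 1).
Proof. unfold werror. rewrite wint_one, rsum_one; auto. Qed.

Lemma werror_one_le (u : R) : a <= u -> Rabs (werror (fun _ => 1) u) <= K * exp (theta * u).
Proof. rewrite werror_one. auto. Qed.

(** * Integrals of the counting error over a half-line *)

Definition trunc_int (f : R -> R) (Y : R) : R := RInt (fun u => werror (fun _ => 1) u * f u) a Y.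

(** A total function, the limit being taken along integer upper ends. It is the convergent integral
    over [[a, +oo)] when [f] decays faster than [exp (- theta u)], by [full_int_lim] and
    [full_int_tail]. *)
Definition full_int (f : R -> R) : R :=
  real (Lim_seq (fun k => trunc_int f (INR k))).

(** The counting error grows at most like [K exp (theta u)], so the integrand is at most
    [K C exp (- d u)]. *)
Lemma trunc_int_diff (f : R -> R) (C d Y Z : R) :
  (forall u, continuous f u) -> 0 <= C -> 0 < d ->
  (forall u, a <= u -> Rabs (f u) <= C * exp (- (theta + d) * u)) ->
  a <= Y <= Z -> Rabs (trunc_int f Z - trunc_int f Y) <= K * C / d * exp (- d * Y).
Proof.
  intros Hf HC Hd H HYZ. unfold trunc_int.
  assert (H1 : forall u, continuous (fun _ : R => 1) u) by (intros; apply continuous_const).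
  assert (E := RInt_Chasles (V := R_CompleteNormedModule)
    (fun u => werror (fun _ => 1) u * f u) a Y Z
    (ex_RInt_werror _ f a Y H1 Hf ltac:(lra)) (ex_RInt_werror _ f Y Z H1 Hf HYZ)).
  unfold plus in E; simpl in E. rewrite <- E.
  rewrite Rplus_minus_l.
  apply Rabs_RInt_exp_decay_le; auto; try lra.
  - apply Rmult_le_pos; auto.
  - apply ex_RInt_werror; auto.
  - intros u Hu. rewrite Rabs_mult.
    replace (K * C * exp (- d * u)) with
      ((K * exp (theta * u)) * (C * exp (- (theta + d) * u))).
    + apply Rmult_le_compat; auto using Rabs_pos.
      * apply werror_one_le; lra.
      * apply H; lra.
    + transitivity (K * C * (exp (theta * u) * exp (- (theta + d) * u))). ring.
      rewrite <- exp_plus. f_equal. f_equal. ring.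
Qed.

Lemma exp_decay_lt (C d e : R) : 0 < d -> 0 < e ->
  exists Y0, 0 <= Y0 /\ forall Y, Y0 <= Y -> C * exp (- d * Y) < e.
Proof.
  intros Hd He. exists (Rabs C / e / d). split.
  { apply Rdiv_le_0_compat; auto. apply Rdiv_le_0_compat; auto. apply Rabs_pos. }
  intros Y HY.
  assert (H : Rabs C / e <= d * Y).
  { apply Rmult_le_compat_l with (r := d) in HY; [|lra].
    replace (d * (Rabs C / e / d)) with (Rabs C / e) in HY by (field; lra). auto. }
  assert (H2 : Rabs C / e < exp (d * Y)).
  { pose proof (exp_ineq1_le (d * Y)). lra. }
  replace (- d * Y) with (- (d * Y)) by ring. rewrite exp_Ropp.
  pose proof (exp_pos (d * Y)). pose proof (Rle_abs C).
  apply Rmult_lt_reg_r with (exp (d * Y)); auto.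
  replace (C * / exp (d * Y) * exp (d * Y)) with C by (field; lra).
  apply Rmult_lt_compat_r with (r := e) in H2; auto.
  replace (Rabs C / e * e) with (Rabs C) in H2 by (field; lra). lra.
Qed.

Lemma full_int_lim (f : R -> R) (C d : R) :
  (forall u, continuous f u) -> 0 <= C -> 0 < d ->
  (forall u, a <= u -> Rabs (f u) <= C * exp (- (theta + d) * u)) ->
  is_lim_seq (fun k => trunc_int f (INR k)) (full_int f).
Proof.
  intros Hf HC Hd H. apply Lim_seq_correct', ex_lim_seq_cauchy_corr.
  intros e. destruct (exp_decay_lt (K * C / d) d e Hd (cond_pos e)) as [Y0 [HY0 HY]].
  destruct (nfloor_ex Y0 HY0) as [N HN].
  assert (X : forall i j, (S N <= i)%nat -> (i <= j)%nat ->
     Rabs (trunc_int f (INR j) - trunc_int f (INR i)) < e).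
  { intros i j Hi Hj. eapply Rle_lt_trans.
    - apply (trunc_int_diff f C d); auto. split.
      + pose proof (pos_INR i). lra.
      + apply le_INR; auto.
    - apply HY. apply le_INR in Hi. rewrite S_INR in Hi. lra. }
  exists (S N). intros i j Hi Hj.
  destruct (Nat.le_ge_cases i j).
  - rewrite Rabs_minus_sym. apply X; auto.
  - apply X; auto.
Qed.

Lemma full_int_tail (f : R -> R) (C d Y : R) :
  (forall u, continuous f u) -> 0 <= C -> 0 < d ->
  (forall u, a <= u -> Rabs (f u) <= C * exp (- (theta + d) * u)) ->
  a <= Y -> Rabs (full_int f - trunc_int f Y) <= K * C / d * exp (- d * Y).
Proof.
  intros Hf HC Hd H HY.
  assert (L := full_int_lim f C d Hf HC Hd H).
  assert (L2 : is_lim_seq (fun k => Rabs (trunc_int f (INR k) - trunc_int f Y))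
                 (Rabs (full_int f - trunc_int f Y))).
  { apply (is_lim_seq_abs _ (Finite (full_int f - trunc_int f Y))).
    apply is_lim_seq_minus'; auto. apply is_lim_seq_const. }
  destruct (nfloor_ex (Rmax Y 0) (Rmax_r _ _)) as [N HN].
  apply (is_lim_seq_le_loc _ (fun _ => K * C / d * exp (- d * Y)) _ _) with (2 := L2)
    (3 := is_lim_seq_const _).
  exists (S N). intros k Hk. apply (trunc_int_diff f C d); auto. split; auto.
  apply le_INR in Hk. rewrite S_INR in Hk. pose proof (Rmax_l Y 0). lra.
Qed.

Lemma full_int_le (f : R -> R) (C d : R) :
  (forall u, continuous f u) -> 0 <= C -> 0 < d ->
  (forall u, a <= u -> Rabs (f u) <= C * exp (- (theta + d) * u)) ->
  Rabs (full_int f) <= C * (K / d * exp (- d * a)).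
Proof.
  intros Hf HC Hd H. assert (E := full_int_tail f C d a Hf HC Hd H (Rle_refl a)).
  unfold trunc_int in E. rewrite RInt_point in E. unfold zero in E; simpl in E.
  rewrite Rminus_0_r in E. replace (C * (K / d * exp (- d * a)))
    with (K * C / d * exp (- d * a)) by (unfold Rdiv; ring). auto.
Qed.

(** Decay that beats the growth [exp (theta u)] of the counting error by the margin [d]. *)
Definition admissible (d : R) (f : R -> R) : Prop :=
  (forall u, continuous f u) /\
  exists C, 0 <= C /\ forall u, a <= u -> Rabs (f u) <= C * exp (- (theta + d) * u).

Lemma admissible_linear (d k1 k2 : R) (f1 f2 : R -> R) :
  admissible d f1 -> admissible d f2 -> admissible d (fun u => k1 * f1 u + k2 * f2 u).
Proof.
  intros [H1 [C1 [P1 B1]]] [H2 [C2 [P2 B2]]]. split.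
  - intros u. apply continuous_Rplus; apply continuous_Rmult; auto; apply continuous_const.
  - exists (Rabs k1 * C1 + Rabs k2 * C2). split.
    + pose proof (Rabs_pos k1). pose proof (Rabs_pos k2). nra.
    + intros u Hu. eapply Rle_trans. apply Rabs_triang. rewrite !Rabs_mult.
      specialize (B1 u Hu). specialize (B2 u Hu).
      pose proof (Rabs_pos k1). pose proof (Rabs_pos k2). nra.
Qed.

Lemma full_int_linear (d k1 k2 : R) (f1 f2 : R -> R) : 0 < d ->
  admissible d f1 -> admissible d f2 ->
  full_int (fun u => k1 * f1 u + k2 * f2 u) = k1 * full_int f1 + k2 * full_int f2.
Proof.
  intros Hd A1 A2.
  assert (L : forall f, admissible d f -> is_lim_seq (fun k => trunc_int f (INR k)) (full_int f)).
  { intros f [H [C [P B]]]. apply (full_int_lim f C d); auto. }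
  assert (E : Finite (full_int (fun u => k1 * f1 u + k2 * f2 u))
              = Finite (k1 * full_int f1 + k2 * full_int f2)).
  2:{ injection E; auto. }
  rewrite <- (is_lim_seq_unique _ _ (L _ (admissible_linear d k1 k2 _ _ A1 A2))).
  apply is_lim_seq_unique.
  apply is_lim_seq_ext with (fun k => k1 * trunc_int f1 (INR k) + k2 * trunc_int f2 (INR k)).
  - intros k. unfold trunc_int.
    assert (H1 : forall u, continuous (fun _ : R => 1) u) by (intros; apply continuous_const).
    assert (Hk : a <= a <= INR k) by (pose proof (pos_INR k); lra).
    assert (X1 := ex_RInt_werror _ f1 a (INR k) H1 (proj1 A1) Hk).
    assert (X2 := ex_RInt_werror _ f2 a (INR k) H1 (proj1 A2) Hk).
    rewrite <- !RInt_Rmult, <- RInt_Rplus; auto using ex_RInt_Rmult.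
    apply RInt_ext. intros; eqR; ring.
  - apply is_lim_seq_plus'.
    + apply (is_lim_seq_scal_l _ k1 (Finite (full_int f1))); auto.
    + apply (is_lim_seq_scal_l _ k2 (Finite (full_int f2))); auto.
Qed.

(** * Local regularity of the damped error *)

Lemma Rmax_exp_le (u : R) : a <= u -> exp (Rmax u 0) <= exp (- a) * exp u.
Proof.
  intros Hu. rewrite <- exp_plus. unfold Rmax. destruct Rle_dec; apply exp_le_compat; lra.
Qed.

Lemma exp_theta_le (u : R) : theta < 1 / 2 -> a <= u ->
  exp (theta * u) <= exp (- a) * exp (u / 2).
Proof.
  intros Ht Hu. rewrite <- exp_plus. apply exp_le_compat. destruct (Rle_dec 0 u); nra.
Qed.

Lemma exp_Rmax_diff (u v : R) : u <= v ->
  exp (Rmax v 0) - exp (Rmax u 0) <= exp (Rmax v 0) * (v - u).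
Proof.
  intros Huv. set (x := Rmax v 0). set (y := Rmax u 0).
  assert (H : y <= x) by (unfold x, y, Rmax; repeat destruct Rle_dec; lra).
  assert (H' : x - y <= v - u) by (unfold x, y, Rmax; repeat destruct Rle_dec; lra).
  replace (exp y) with (exp x * exp (y - x)) by (rewrite <- exp_plus; f_equal; ring).
  pose proof (exp_ineq1_le (y - x)). pose proof (exp_pos x). nra.
Qed.

Lemma wint_diff (c : R -> R) (u v : R) : (forall u, continuous c u) ->
  (forall u, Rabs (c u) <= 1) -> u <= v ->
  Rabs (wint c v - wint c u) <= exp v - exp u.
Proof.
  intros Hc Hb Huv. unfold wint.
  assert (X := fun x y => ex_RInt_continuous_everywhere _ x y (continuous_exp_mult c Hc)).
  assert (E := RInt_Chasles (V := R_CompleteNormedModule) _ 0 u v (X 0 u) (X u v)).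
  unfold plus in E; simpl in E. rewrite <- E, Rplus_minus_l.
  replace (exp v - exp u) with (RInt exp u v).
  - apply Rabs_RInt_le; auto.
    + apply ex_RInt_continuous_everywhere. smooth_continuous.
    + intros x _. rewrite Rabs_mult, (Rabs_pos_eq (exp x)) by (left; apply exp_pos).
      pose proof (Hb x). pose proof (exp_pos x). nra.
  - apply RInt_antiderivative; [|smooth_continuous].
    intros. auto_derive; auto. ring.
Qed.

(** With weights at most [1], the sum changes by at most the number of new terms, [A] times the
    growth of the main term plus two counting errors. The subtracted integral changes by at most the
    same main term, whence [2 * A]. *)
Lemma werror_diff (c : R -> R) (u v : R) : (forall u, continuous c u) ->
  (forall u, Rabs (c u) <= 1) -> a <= u <= v ->
  Rabs (werror c v - werror c u) <=
    2 * A * (exp (Rmax v 0) - exp (Rmax u 0)) + 2 * K * exp (theta * v).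
Proof.
  intros Hc Hb Huv. unfold werror.
  assert (Hm : Rmax u 0 <= Rmax v 0) by (apply Rle_max_compat_r; lra).
  assert (H1 := wint_diff c _ _ Hc Hb Hm).
  assert (H2 := rsum_diff_le (fun j => c (lam j)) 1 _ _ (cnt_le u v ltac:(lra))
    (fun j _ => Hb (lam j))).
  assert (H3 := cnt_asym u ltac:(lra)). assert (H4 := cnt_asym v ltac:(lra)).
  assert (H5 : exp (theta * u) <= exp (theta * v)) by (apply exp_le_compat; nra).
  apply Rabs_le_between in H1, H2, H3, H4. apply Rabs_le_between.
  set (w1 := wint c (Rmax u 0)) in *. set (w2 := wint c (Rmax v 0)) in *.
  set (e1 := exp (Rmax u 0)) in *. set (e2 := exp (Rmax v 0)) in *.
  assert (K * exp (theta * u) <= K * exp (theta * v)) by (apply Rmult_le_compat_l; auto).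
  assert (A * (w2 - w1) <= A * (e2 - e1)) by (apply Rmult_le_compat_l; lra).
  assert (A * - (e2 - e1) <= A * (w2 - w1)) by (apply Rmult_le_compat_l; lra).
  lra.
Qed.

Lemma werror_left_end (c : R -> R) : werror c a = 0.
Proof.
  unfold werror. replace (cnt a) with O.
  - rewrite Rmax_right by lra. rewrite wint_zero. simpl. ring.
  - destruct (cnt a) eqn:E; auto.
    assert (lam 0%nat <= a) by (apply cnt_spec; lia). specialize (a_lam 0%nat). lra.
Qed.

Lemma werror_trivial (c : R -> R) (u : R) : theta < 1 / 2 -> (forall u, continuous c u) ->
  (forall u, Rabs (c u) <= 1) -> a <= u ->
  Rabs (werror c u) <= exp (- a) * (2 * A * exp u + 2 * K * exp (u / 2)).
Proof.
  intros Ht Hc Hb Hu.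
  assert (E := werror_diff c a u Hc Hb ltac:(lra)). rewrite werror_left_end, Rminus_0_r in E.
  pose proof (Rmax_exp_le u Hu). pose proof (exp_theta_le u Ht Hu).
  pose proof (exp_pos (Rmax a 0)).
  assert (A * exp (Rmax u 0) <= A * (exp (- a) * exp u)) by (apply Rmult_le_compat_l; lra).
  assert (K * exp (theta * u) <= K * (exp (- a) * exp (u / 2))) by (apply Rmult_le_compat_l; lra).
  assert (0 < A * exp (Rmax a 0)) by (apply Rmult_lt_0_compat; lra). nra.
Qed.

Definition damped (c : R -> R) (u : R) : R := werror c u * exp (- u / 2).

Lemma damped_local_aux (c : R -> R) (u y : R) : theta < 1 / 2 -> (forall u, continuous c u) ->
  (forall u, Rabs (c u) <= 1) -> a + 1 <= y -> Rabs (u - y) <= 1 ->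
  Rabs (werror c u - werror c y) <=
    exp (- a) * (2 * A * exp (y + 1) * Rabs (u - y) + 2 * K * exp ((y + 1) / 2)).
Proof.
  intros Ht Hc Hb Hy Huy. apply Rabs_le_between in Huy.
  assert (X : forall x z, a <= x <= z -> z <= y + 1 -> Rabs (werror c z - werror c x) <=
     exp (- a) * (2 * A * exp (y + 1) * (z - x) + 2 * K * exp ((y + 1) / 2))).
  { intros x z Hx Hz. assert (E := werror_diff c x z Hc Hb Hx).
    assert (E2 := exp_Rmax_diff x z ltac:(lra)).
    assert (E3 := Rmax_exp_le z ltac:(lra)). assert (E4 := exp_theta_le z Ht ltac:(lra)).
    assert (E5 : exp z <= exp (y + 1)) by (apply exp_le_compat; lra).
    assert (E6 : exp (z / 2) <= exp ((y + 1) / 2)) by (apply exp_le_compat; lra).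
    pose proof (exp_pos (- a)).
    assert (E7 : exp (Rmax z 0) <= exp (- a) * exp (y + 1)) by nra.
    assert (E8 : exp (theta * z) <= exp (- a) * exp ((y + 1) / 2)) by nra.
    assert (E9 : exp (Rmax z 0) - exp (Rmax x 0) <= exp (- a) * exp (y + 1) * (z - x)) by nra.
    assert (A * (exp (Rmax z 0) - exp (Rmax x 0)) <= A * (exp (- a) * exp (y + 1) * (z - x)))
      by (apply Rmult_le_compat_l; lra).
    assert (K * exp (theta * z) <= K * (exp (- a) * exp ((y + 1) / 2)))
      by (apply Rmult_le_compat_l; lra).
    lra. }
  destruct (Rle_dec u y).
  - rewrite Rabs_minus_sym, (Rabs_minus_sym u y), (Rabs_pos_eq (y - u)) by lra.
    apply X; lra.
  - rewrite (Rabs_pos_eq (u - y)) by lra. apply X; lra.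
Qed.

Lemma exp_half_diff (u y : R) : Rabs (u - y) <= 1 ->
  Rabs (exp (- u / 2) - exp (- y / 2)) <= exp (- y / 2) * exp (1 / 2) * Rabs (u - y).
Proof.
  intros Huy. apply Rabs_le_between in Huy.
  assert (Y : exp (- u / 2) <= exp (- y / 2) * exp (1 / 2))
    by (rewrite <- exp_plus; apply exp_le_compat; lra).
  assert (Y' : exp (- y / 2) <= exp (- y / 2) * exp (1 / 2))
    by (rewrite <- exp_plus; apply exp_le_compat; lra).
  assert (X : forall x z, x <= z -> 0 <= exp (- x / 2) - exp (- z / 2) <= exp (- x / 2) * (z - x)).
  { intros x z Hxz. replace (exp (- z / 2)) with (exp (- x / 2) * exp ((x - z) / 2))
      by (rewrite <- exp_plus; f_equal; field).
    pose proof (exp_ineq1_le ((x - z) / 2)). pose proof (exp_pos (- x / 2)).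
    assert (exp ((x - z) / 2) <= 1) by (rewrite <- exp_0; apply exp_le_compat; lra). nra. }
  destruct (Rle_dec u y).
  - rewrite (Rabs_minus_sym u y), (Rabs_pos_eq (y - u)) by lra.
    specialize (X u y ltac:(lra)). rewrite Rabs_pos_eq by lra. nra.
  - rewrite (Rabs_pos_eq (u - y)) by lra. specialize (X y u ltac:(lra)).
    rewrite Rabs_minus_sym, Rabs_pos_eq by lra. nra.
Qed.

(** Moving [u] by at most [1] costs [exp 1] on [exp y] and [exp (1 / 2)] on the damping, together
    [exp (3 / 2)]. The factor [exp (- a)] pays for replacing [exp (Rmax u 0)] by [exp u] and
    [exp (theta u)] by [exp (u / 2)] at negative [u]. The coefficients [4] add up two contributions
    of [2], from the increment of the error and from that of the damping. *)
Definition local_const : R := exp (- a) * exp (3 / 2) * (4 * A + 4 * K).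

(** The variation splits into the increment of the error and the increment of the damping factor.
    After division by about [exp (y / 2)], the term [A exp y |u - y|] leaves [exp (y / 2) |u - y|],
    and the counting error [exp (theta y)] leaves a constant because [theta < 1 / 2]. *)
Lemma damped_local (c : R -> R) (u y : R) : theta < 1 / 2 -> (forall u, continuous c u) ->
  (forall u, Rabs (c u) <= 1) -> a + 1 <= y -> Rabs (u - y) <= 1 ->
  Rabs (damped c u - damped c y) <= local_const * (exp (y / 2) * Rabs (u - y) + 1).
Proof.
  intros Ht Hc Hb Hy Huy.
  assert (E1 := damped_local_aux c u y Ht Hc Hb Hy Huy).
  assert (E2 := exp_half_diff u y Huy).
  assert (E3 := werror_trivial c y Ht Hc Hb ltac:(lra)).
  unfold damped.
  replace (werror c u * exp (- u / 2) - werror c y * exp (- y / 2)) with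
    ((werror c u - werror c y) * exp (- u / 2) + werror c y * (exp (- u / 2) - exp (- y / 2))) by ring.
  eapply Rle_trans. apply Rabs_triang. rewrite !Rabs_mult.
  rewrite (Rabs_pos_eq (exp (- u / 2))) by (left; apply exp_pos).
  assert (E4 : exp (- u / 2) <= exp (- y / 2) * exp (1 / 2)).
  { apply Rabs_le_between in Huy. rewrite <- exp_plus; apply exp_le_compat; lra. }
  set (q := exp (1 / 2)). set (h := exp (y / 2)). set (d := Rabs (u - y)) in *.
  assert (Hq : 1 <= q) by (unfold q; pose proof (exp_ineq1_le (1 / 2)); lra).
  assert (Hh : 0 < h) by apply exp_pos.
  assert (Hd : 0 <= d) by apply Rabs_pos.
  assert (R1 : exp (y + 1) = h * h * (q * q)) by (unfold h, q; rewrite <- !exp_plus; f_equal; field).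
  assert (R2 : exp ((y + 1) / 2) = h * q) by (unfold h, q; rewrite <- !exp_plus; f_equal; field).
  assert (R3 : exp y = h * h) by (unfold h; rewrite <- !exp_plus; f_equal; field).
  assert (R4 : exp (- y / 2) = / h)
    by (unfold h; rewrite <- exp_Ropp; f_equal; field).
  assert (R5 : exp (3 / 2) = q * q * q) by (unfold q; rewrite <- !exp_plus; f_equal; field).
  unfold local_const. rewrite R5. rewrite R1, R2 in E1. rewrite R3, R4 in *.
  set (m := exp (- a)) in *. assert (Hm : 0 < m) by apply exp_pos.
  fold h in E3. fold q in E2, E4.
  assert (B1 : Rabs (werror c u - werror c y) * exp (- u / 2) <=
     m * (2 * A * (h * h * (q * q)) * d + 2 * K * (h * q)) * (/ h * q)).
  { apply Rmult_le_compat; auto using Rabs_pos. left; apply exp_pos. }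
  assert (B2 : Rabs (werror c y) * Rabs (exp (- u / 2) - / h) <=
     m * (2 * A * (h * h) + 2 * K * h) * (/ h * q * d)).
  { apply Rmult_le_compat; auto using Rabs_pos. }
  replace (m * (2 * A * (h * h * (q * q)) * d + 2 * K * (h * q)) * (/ h * q))
    with (m * (2 * A * (q * q * q) * (h * d) + 2 * K * (q * q))) in B1 by (field; lra).
  replace (m * (2 * A * (h * h) + 2 * K * h) * (/ h * q * d))
    with (m * (2 * A * q * (h * d) + 2 * K * q * d)) in B2 by (field; lra).
  eapply Rle_trans. apply Rplus_le_compat; [apply B1 | apply B2].
  rewrite <- Rmult_plus_distr_l, !Rmult_assoc. apply Rmult_le_compat_l; [lra |].
  assert (0 <= h * d) by nra. set (z := h * d) in *.
  assert (Q2 : q <= q * q) by nra. assert (Q3 : q * q <= q * (q * q)) by nra.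
  assert (Q4 : 0 <= A * z) by nra.
  assert (Q5 : K * (q * d) <= K * (q * (q * q))) by (apply Rmult_le_compat_l; nra).
  assert (Q6 : K * (q * q) <= K * (q * (q * q))) by (apply Rmult_le_compat_l; nra).
  assert (Q7 : A * z * q <= A * z * (q * (q * q))) by (apply Rmult_le_compat_l; nra).
  assert (Q8 : 0 <= q * (q * q) * A) by (apply Rmult_le_pos; nra).
  assert (Q9 : 0 <= q * (q * q) * (K * z)) by (apply Rmult_le_pos; nra).
  nra.
Qed.

(** * Real phases, their growth and their Fourier integrals *)

Definition phase (t phi u : R) : R := cos (t * u + phi).
(** At [phi = 0] and [phi = PI / 2], [phase] is the real and the imaginary part of [exp (- i t u)],
    and [damped_phase] those of [exp (- (1/2 + i t) u)]. The other [phi] arise from modulation by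
    [cos ((y - u) * v)]. *)
Definition damped_phase (t phi u : R) : R := exp (- u / 2) * cos (t * u + phi).

Lemma continuous_phase (t phi u : R) : continuous (phase t phi) u.
Proof. unfold phase. smooth_continuous. Qed.

Lemma continuous_damped_phase (t phi u : R) : continuous (damped_phase t phi) u.
Proof. unfold damped_phase. smooth_continuous. Qed.

Lemma Rabs_phase_le (t phi u : R) : Rabs (phase t phi u) <= 1.
Proof. apply Rabs_cos_le. Qed.

(** Abel summation from the weight [1] to the phase: the boundary term gives [K exp (theta u)], and
    the derivative of the phase, at most [|t|], is integrated against [K exp (theta r)]. That
    integral brings the divisor [theta], hence the positivity of [theta] here. *)
Lemma werror_phase_growth (t phi u : R) : 0 < theta -> a <= u ->
  Rabs (werror (phase t phi) u) <= K * (2 + Rabs t / theta) * exp (theta * u).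
Proof.
  intros Ht Hu. pose proof (exp_pos (theta * u)).
  assert (0 <= Rabs t / theta) by (apply Rdiv_le_0_compat; auto using Rabs_pos).
  assert (0 <= K * (Rabs t / theta)) by (apply Rmult_le_pos; auto).
  assert (0 <= K * exp (theta * u)) by (apply Rmult_le_pos; lra).
  assert (0 <= K * (Rabs t / theta) * exp (theta * u)) by (apply Rmult_le_pos; lra).
  destruct (Rle_dec 0 u) as [Hu0 | Hu0].
  - set (p := fun r => - (t * sin (t * r + phi))).
    assert (E := werror_abel (fun _ => 1) (phase t phi) p u Hu0).
    assert (Hone : forall r : R, continuous (fun _ : R => 1) r)
      by (intros; apply continuous_const).
    assert (Hp : forall r, continuous p r) by (unfold p; smooth_continuous).
    assert (E1 := is_RInt_unique (V := R_CompleteNormedModule) _ _ _ _ (E Hone Hp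
      ltac:(intros; unfold phase, p; auto_derive; auto; ring))).
    rewrite (werror_ext (fun r => 1 * phase t phi r) (phase t phi)) in E1 by (intros; ring).
    assert (E2 : Rabs (RInt (fun r => werror (fun _ => 1) r * p r) a u) <=
      RInt (fun r => K * Rabs t * exp (- (- theta) * r)) a u).
    { apply Rabs_RInt_le; auto.
      - apply ex_RInt_werror; auto; lra.
      - apply ex_RInt_exp_decay.
      - intros r Hr. rewrite Rabs_mult.
        replace (K * Rabs t * exp (- - theta * r)) with ((K * exp (theta * r)) * Rabs t)
          by (rewrite Ropp_involutive; ring).
        apply Rmult_le_compat; auto using Rabs_pos.
        + apply werror_one_le; lra.
        + unfold p. rewrite Rabs_Ropp, Rabs_mult. pose proof (Rabs_sin_le (t * r + phi)).
          pose proof (Rabs_pos t). nra. }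
    rewrite RInt_Rmult, RInt_exp_decay in E2 by (try lra;
      generalize (ex_RInt_exp_decay 1 (- theta) a u); apply ex_RInt_ext; intros; eqR; ring).
    rewrite Ropp_involutive in E2.
    replace (K * Rabs t * ((exp (theta * a) - exp (theta * u)) / - theta)) with
      (K * (Rabs t / theta) * exp (theta * u) - K * (Rabs t / theta) * exp (theta * a))
      in E2 by (field; lra).
    assert (0 <= K * (Rabs t / theta) * exp (theta * a))
      by (apply Rmult_le_pos; auto; left; apply exp_pos).
    rewrite E1 in E2.
    assert (E3 : Rabs (phase t phi u * werror (fun _ => 1) u) <= K * exp (theta * u)).
    { rewrite Rabs_mult. pose proof (werror_one_le u Hu). pose proof (Rabs_phase_le t phi u).
      pose proof (Rabs_pos (werror (fun _ => 1) u)). nra. }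
    apply Rabs_le_between in E2, E3. apply Rabs_le_between. lra.
  (* For negative [u] the main term has not started, so comparison with the left end [a] leaves
     counting errors alone. *)
  - assert (E := werror_diff (phase t phi) a u (continuous_phase t phi) (Rabs_phase_le t phi)
      ltac:(lra)).
    rewrite werror_left_end, Rminus_0_r, !Rmax_right in E by lra. lra.
Qed.

(** This is [(1 / 2 + v) ^ 2 <= 2 (1 / 4 + v ^ 2)]. It trades [|1/2 + i v| ^ 2] for a denominator
    whose reciprocal has a logarithm as primitive. *)
Lemma Rinv_half_plus_sq_le (v : R) : 0 <= v -> (1 / 2 + v) / (1 / 4 + v * v) <= 2 / (1 / 2 + v).
Proof.
  intros Hv. apply Rmult_le_reg_r with ((1 / 4 + v * v) * (1 / 2 + v)). nra.
  replace ((1 / 2 + v) / (1 / 4 + v * v) * ((1 / 4 + v * v) * (1 / 2 + v)))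
    with ((1 / 2 + v) * (1 / 2 + v)) by (field; nra).
  replace (2 / (1 / 2 + v) * ((1 / 4 + v * v) * (1 / 2 + v)))
    with (2 * (1 / 4 + v * v)) by (field; nra).
  pose proof (Rle_0_sqr (v - 1 / 2)) as H. unfold Rsqr in H. lra.
Qed.

(** The Fourier integral of the damped error is, up to a boundary term, a combination of
    values of the Dirichlet polynomial at [1/2 + i (t - v)] and [1/2 + i (t + v)], divided
    by [1/2 + i v]. *)
Lemma damped_fourier_le (t phi y v Y B : R) : 0 <= v -> 0 <= Y ->
  (forall psi, Rabs (werror (damped_phase (t - v) psi) Y) <= B) ->
  (forall psi, Rabs (werror (damped_phase (t + v) psi) Y) <= B) ->
  exp (- Y / 2) * Rabs (werror (phase t phi) Y) <= B ->
  Rabs (RInt (fun u => damped (phase t phi) u * cos ((y - u) * v)) a Y) <= 4 * B / (1 / 2 + v).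
Proof.
  intros Hv HY B1 B2 B3.
  set (c := phase t phi) in *.
  set (q := 1 / 4 + v * v). assert (Hq : 0 < q) by (unfold q; nra).
  (* The real form of the primitive [exp (- (1/2 + i v) u) / (- (1/2 + i v))], up to a constant
     phase; [q] is [|1/2 + i v| ^ 2]. *)
  set (P := fun u => exp (- u / 2) * (- / 2 * cos ((y - u) * v) - v * sin ((y - u) * v)) / q).
  set (p := fun u => exp (- u / 2) * cos ((y - u) * v)).
  assert (HP : forall u, is_derive P u (p u)).
  { intros u. unfold P, p. auto_derive; auto.
    change (y + - u) with (y - u). change (- u * / 2) with (- u / 2).
    generalize (exp (- u / 2)) (cos ((y - u) * v)) (sin ((y - u) * v)). intros e co si.
    unfold q. field. nra. }
  assert (Hp : forall u, continuous p u) by (unfold p; smooth_continuous).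
  assert (E := is_RInt_unique (V := R_CompleteNormedModule) _ _ _ _
    (werror_abel c P p Y HY (continuous_phase t phi) Hp HP)).
  rewrite (RInt_ext _ (fun u => werror c u * p u)).
  2:{ intros u _. unfold damped, p. eqR. ring. }
  rewrite E.
  (* Product-to-sum formulas halve the coefficients [- 1 / 2] and [- v] of [P]. Sines are written as
     cosines with phase shifted by [- PI / 2]. *)
  set (k1 := - (1 / 4) / q). set (k2 := - (v / 2) / q).
  assert (E2 : werror (fun u => c u * P u) Y =
    1 * (k1 * werror (damped_phase (t - v) (phi + y * v)) Y
         + k2 * werror (damped_phase (t - v) (phi + y * v - PI / 2)) Y)
    + 1 * (k1 * werror (damped_phase (t + v) (phi - y * v)) Y
         + - k2 * werror (damped_phase (t + v) (phi - y * v - PI / 2)) Y)).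
  { rewrite <- !werror_linear; auto using continuous_damped_phase.
    2, 3: intros; apply continuous_Rplus; apply continuous_Rmult;
      auto using continuous_damped_phase; apply continuous_const.
    apply werror_ext. intros u. unfold c, P, phase, damped_phase.
    assert (S : forall x, cos (x - PI / 2) = sin x)
      by (intros; rewrite cos_minus, cos_PI2, sin_PI2; ring).
    replace ((t - v) * u + (phi + y * v - PI / 2))
      with ((t * u + phi) + (y - u) * v - PI / 2) by ring.
    replace ((t + v) * u + (phi - y * v - PI / 2))
      with ((t * u + phi) - (y - u) * v - PI / 2) by ring.
    replace ((t - v) * u + (phi + y * v)) with ((t * u + phi) + (y - u) * v) by ring.
    replace ((t + v) * u + (phi - y * v)) with ((t * u + phi) - (y - u) * v) by ring.
    rewrite !S. generalize (t * u + phi) ((y - u) * v). intros al be.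
    rewrite cos_plus, cos_minus, sin_plus, sin_minus.
    unfold k1, k2. field. lra. }
  rewrite E2.
  assert (Hk1 : Rabs k1 = 1 / 4 / q).
  { unfold k1. replace (- (1 / 4) / q) with (- (1 / 4 / q)) by (field; lra).
    rewrite Rabs_Ropp, Rabs_pos_eq; auto. apply Rdiv_le_0_compat; lra. }
  assert (Hk2 : Rabs k2 = v / 2 / q).
  { unfold k2. replace (- (v / 2) / q) with (- (v / 2 / q)) by (field; lra).
    rewrite Rabs_Ropp, Rabs_pos_eq; auto. apply Rdiv_le_0_compat; lra. }
  assert (HPY : Rabs (P Y * werror c Y) <= (1 / 2 + v) / q * B).
  { rewrite Rabs_mult.
    assert (Rabs (P Y) <= exp (- Y / 2) * ((1 / 2 + v) / q)).
    { unfold P. replace (exp (- Y / 2) * (- / 2 * cos ((y - Y) * v) - v * sin ((y - Y) * v)) / q)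
        with (exp (- Y / 2) * / q * (- / 2 * cos ((y - Y) * v) - v * sin ((y - Y) * v)))
        by (field; lra).
      assert (0 < / q) by (apply Rinv_0_lt_compat; auto).
      pose proof (exp_pos (- Y / 2)).
      rewrite Rabs_mult, (Rabs_pos_eq (exp (- Y / 2) * / q)) by nra.
      replace (exp (- Y / 2) * ((1 / 2 + v) / q)) with (exp (- Y / 2) * / q * (1 / 2 + v))
        by (field; lra).
      apply Rmult_le_compat_l; [nra |].
      pose proof (COS_bound ((y - Y) * v)). pose proof (SIN_bound ((y - Y) * v)).
      apply Rabs_le; nra. }
    assert (0 <= (1 / 2 + v) / q) by (apply Rdiv_le_0_compat; lra).
    pose proof (Rabs_pos (werror c Y)). nra. }
  assert (HL : forall k w, Rabs w <= B -> Rabs (k * w) <= Rabs k * B).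
  { intros k w Hw. rewrite Rabs_mult. apply Rmult_le_compat_l; auto using Rabs_pos. }
  assert (L1 := HL k1 _ (B1 (phi + y * v))).
  assert (L2 := HL k2 _ (B1 (phi + y * v - PI / 2))).
  assert (L3 := HL k1 _ (B2 (phi - y * v))).
  assert (L4 := HL (- k2) _ (B2 (phi - y * v - PI / 2))).
  rewrite Rabs_Ropp in L4. rewrite Hk1, Hk2 in *.
  assert (T := Rinv_half_plus_sq_le v Hv). fold q in T.
  assert (0 <= B) by (pose proof (B1 0); pose proof (Rabs_pos (werror (damped_phase (t - v) 0) Y)); lra).
  replace (4 * B / (1 / 2 + v)) with (2 * (B * (2 / (1 / 2 + v)))) by (field; lra).
  apply Rle_trans with (2 * (B * ((1 / 2 + v) / q))).
  - replace ((1 / 2 + v) / q) with (1 / 4 / q + 1 / 4 / q + v / 2 / q + v / 2 / q) in *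
      by (field; lra).
    apply Rabs_le_between in L1, L2, L3, L4, HPY. apply Rabs_le_between. nra.
  - apply Rmult_le_compat_l; [lra |]. apply Rmult_le_compat_l; auto.
Qed.

(** The integral of [K exp (- (1/2 - theta) u)] over [[a, +oo)]: times [2 + |t| / theta], it bounds
    the total mass of the damped error. *)
Definition tail_const : R := K / (1 / 2 - theta) * exp (- (1 / 2 - theta) * a).

Lemma damped_decay (t phi u : R) : 0 < theta -> a <= u ->
  Rabs (damped (phase t phi) u) <= K * (2 + Rabs t / theta) * exp (- (1 / 2 - theta) * u).
Proof.
  intros Ht Hu. unfold damped. rewrite Rabs_mult, (Rabs_pos_eq (exp _)) by (left; apply exp_pos).
  replace (exp (- (1 / 2 - theta) * u)) with (exp (theta * u) * exp (- u / 2))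
    by (rewrite <- exp_plus; f_equal; field).
  rewrite <- Rmult_assoc. apply Rmult_le_compat_r; [left; apply exp_pos |].
  apply werror_phase_growth; auto.
Qed.

Lemma ex_RInt_damped (t phi x z : R) (f : R -> R) : (forall u, continuous f u) -> a <= x <= z ->
  ex_RInt (fun u => damped (phase t phi) u * f u) x z.
Proof.
  intros Hf Hxz.
  apply ex_RInt_ext with (fun u => werror (phase t phi) u * (exp (- u / 2) * f u)).
  - intros. unfold damped. eqR. ring.
  - apply ex_RInt_werror; auto.
    + apply continuous_phase.
    + intros u. apply continuous_Rmult; auto. smooth_continuous.
Qed.

(** * Averaging the damped error against the Fejer kernel *)

Lemma continuous_fejer_shift (V y w u : R) : 0 < V -> continuous (fun u => fejer V (y - u) w) u.
Proof.
  intros HV. apply (lipschitz_continuous (fun u => fejer V (y - u) w) (w * w)). intros x z.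
  eapply Rle_trans. apply fejer_lipschitz; auto.
  replace (y - x - (y - z)) with (- (x - z)) by ring. rewrite Rabs_Ropp. lra.
Qed.

Lemma damped_fejer_fourier (t phi y V Y : R) : 0 < theta < 1 / 2 -> 0 < V -> a <= y <= Y ->
  is_RInt (fun v => RInt (fun u => damped (phase t phi) u * (triangle V v * cos ((y - u) * v))) a Y)
    0 V (RInt (fun u => damped (phase t phi) u * fejer V (y - u) V) a Y).
Proof.
  intros Ht HV Hy.
  (* The Lipschitz constant in [v] is [/ V] from the triangle plus [|y - u| <= Y - a] from the
     cosine; it is finite because the integral is truncated at [Y]. *)
  apply (RInt_swap_lipschitz (damped (phase t phi)) (fun u v => triangle V v * cos ((y - u) * v))
    (fun u v => fejer V (y - u) v) a Y
    (K * (2 + Rabs t / theta) * exp (- (1 / 2 - theta) * a)) (/ V + (Y - a))).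
  - lra.
  - intros u Hu. eapply Rle_trans. apply damped_decay; lra.
    apply Rmult_le_compat_l.
    + apply Rmult_le_pos; auto.
      assert (0 <= Rabs t / theta) by (apply Rdiv_le_0_compat; [apply Rabs_pos | lra]). lra.
    + apply exp_le_compat. nra.
  - intros f Hf. apply ex_RInt_damped; auto. lra.
  - intros v u. apply continuous_Rmult; [apply continuous_const |]. smooth_continuous.
  - intros v u. apply continuous_fejer_shift; auto.
  - intros u v w Hu.
    replace (triangle V v * cos ((y - u) * v) - triangle V w * cos ((y - u) * w)) with
      ((triangle V v - triangle V w) * cos ((y - u) * v)
       + triangle V w * (cos ((y - u) * v) - cos ((y - u) * w))) by ring.
    eapply Rle_trans. apply Rabs_triang. rewrite !Rabs_mult.
    pose proof (triangle_lipschitz V v w HV). pose proof (triangle_bounds V w HV).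
    rewrite (Rabs_pos_eq (triangle V w)) by lra.
    pose proof (Rabs_cos_le ((y - u) * v)). pose proof (Rabs_pos (cos ((y - u) * v))).
    pose proof (cos_lipschitz ((y - u) * v) ((y - u) * w)) as H3.
    rewrite <- Rmult_minus_distr_l, Rabs_mult in H3.
    assert (Rabs (y - u) <= Y - a) by (apply Rabs_le; lra).
    pose proof (Rabs_pos (v - w)). pose proof (Rabs_pos (triangle V v - triangle V w)).
    pose proof (Rabs_pos (cos ((y - u) * v) - cos ((y - u) * w))).
    rewrite Rmult_plus_distr_r. apply Rplus_le_compat; nra.
  - intros u v. apply fejer_derive; auto.
  - intros u. exact (RInt_point (V := R_CompleteNormedModule) 0 _).
Qed.

(** The kernel is a superposition of [cos ((y - u) v)] with [v <= V], so only frequencies within [V]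
    of [t] and [- t] occur. Integrating [1 / (1 / 2 + v)] over [[0, V]] gives the logarithm. *)
Lemma damped_fejer_le (t phi y V Y B : R) : 0 < theta < 1 / 2 -> 0 < V -> a <= y <= Y -> 0 <= Y ->
  (forall tau psi, Rabs tau <= Rabs t + V -> Rabs (werror (damped_phase tau psi) Y) <= B) ->
  exp (- Y / 2) * Rabs (werror (phase t phi) Y) <= B ->
  Rabs (RInt (fun u => damped (phase t phi) u * fejer V (y - u) V) a Y) <= 4 * B * ln (1 + 2 * V).
Proof.
  intros Ht HV Hy HY HB HE.
  assert (HB0 : 0 <= B).
  { specialize (HB 0 0). rewrite Rabs_R0 in HB.
    pose proof (Rabs_pos (werror (damped_phase 0 0) Y)). pose proof (Rabs_pos t). lra. }
  apply (norm_RInt_le (V := R_NormedModule)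
    (fun v => RInt (fun u => damped (phase t phi) u * (triangle V v * cos ((y - u) * v))) a Y)
    (fun v => 4 * B / (1 / 2 + v)) 0 V).
  - lra.
  - intros v Hv. change norm with Rabs. 
    rewrite (RInt_ext _ (fun u => triangle V v * (damped (phase t phi) u * cos ((y - u) * v))))
      by (intros; eqR; ring).
    rewrite RInt_Rmult by (apply ex_RInt_damped; [smooth_continuous | lra]).
    rewrite Rabs_mult. pose proof (triangle_bounds V v HV).
    rewrite (Rabs_pos_eq (triangle V v)) by lra.
    assert (E : Rabs (RInt (fun u => damped (phase t phi) u * cos ((y - u) * v)) a Y)
      <= 4 * B / (1 / 2 + v)).
    { apply damped_fourier_le; auto; try lra; intros psi; apply HB.
      - eapply Rle_trans. apply Rabs_triang. rewrite Rabs_Ropp, (Rabs_pos_eq v); lra.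
      - eapply Rle_trans. apply Rabs_triang. rewrite (Rabs_pos_eq v); lra. }
    match goal with |- _ * Rabs ?x <= _ => pose proof (Rabs_pos x) end. nra.
  - apply damped_fejer_fourier; auto.
  - replace (4 * B * ln (1 + 2 * V)) with (4 * B * ln (1 / 2 + V) - 4 * B * ln (1 / 2 + 0)).
    + apply (is_RInt_derive (V := R_CompleteNormedModule) (fun v => 4 * B * ln (1 / 2 + v))
        (fun v => 4 * B / (1 / 2 + v))).
      * intros v Hv. rewrite Rmin_left, Rmax_right in Hv by lra. auto_derive. lra. field. lra.
      * intros v Hv. rewrite Rmin_left, Rmax_right in Hv by lra.
        apply (ex_derive_continuous (K := R_AbsRing) (V := R_NormedModule)). auto_derive. lra.
    + rewrite Rplus_0_r. replace (1 + 2 * V) with ((1 / 2 + V) * / (1 / 2)) by field.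
      rewrite ln_mult, ln_Rinv by lra. ring.
Qed.

(** Only a lower bound for the mass of the kernel near [0] is used, never its normalisation.
    The term [exp (y / 2) |u - y|] of [damped_local] is absorbed by [Rabs_mult_fejer_le] with
    [d = exp (- y / 2)]. *)
Lemma damped_pointwise (t phi y V Y B : R) :
  0 < theta < 1 / 2 -> 1 <= V -> exp y <= V -> a + 1 <= y -> y + 1 <= Y -> 0 <= Y ->
  (forall tau psi, Rabs tau <= Rabs t + V -> Rabs (werror (damped_phase tau psi) Y) <= B) ->
  exp (- Y / 2) * Rabs (werror (phase t phi) Y) <= B ->
  Rabs (damped (phase t phi) y) <=
    32 * B * ln (1 + 2 * V) + 32 / V * (tail_const * (2 + Rabs t / theta)) + 34 * local_const.
Proof.
  intros Ht HV HyV Hay HyY HY HB HE.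
  assert (HV0 : 0 < V) by lra.
  set (c := phase t phi) in *. set (g := damped c).
  set (kern := fun u => fejer V (y - u) V).
  assert (Hk : forall u, continuous kern u) by (intros; apply continuous_fejer_shift; auto).
  assert (Hk0 : forall u, 0 <= kern u) by (intros; apply fejer_nonneg; auto).
  assert (HI : forall x z, a <= x <= z -> ex_RInt (fun u => g u * kern u) x z)
    by (intros; apply ex_RInt_damped; auto).
  assert (E0 := damped_fejer_le t phi y V Y B Ht HV0 ltac:(lra) HY HB HE).
  fold c g in E0. change (Rabs (RInt (fun u => g u * kern u) a Y) <= 4 * B * ln (1 + 2 * V)) in E0.
  (* At distance at least [1] from [y] the kernel is at most [2 / V], and the damped error is
     integrable. *)
  assert (Hfar : forall x z, a <= x <= z -> (forall u, x <= u <= z -> 1 <= Rabs (y - u)) ->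
    Rabs (RInt (fun u => g u * kern u) x z) <= 2 / V * (tail_const * (2 + Rabs t / theta))).
  { intros x z Hx Hz.
    assert (0 <= Rabs t / theta) by (apply Rdiv_le_0_compat; [apply Rabs_pos | lra]).
    set (C := 2 / V * (K * (2 + Rabs t / theta))).
    assert (HC : 0 <= C).
    { apply Rmult_le_pos; [apply Rdiv_le_0_compat; lra | apply Rmult_le_pos; lra]. }
    apply Rle_trans with (C / (1 / 2 - theta) * exp (- (1 / 2 - theta) * x)).
    - apply Rabs_RInt_exp_decay_le; auto; try lra.
      intros u Hu. rewrite Rabs_mult, (Rabs_pos_eq (kern u)) by auto.
      pose proof (damped_decay t phi u ltac:(lra) ltac:(lra)) as H1. fold c g in H1.
      pose proof (fejer_far V (y - u) HV0 (Hz u Hu)) as H2. fold (kern u) in H2.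
      unfold C. rewrite (Rmult_comm (Rabs (g u))), Rmult_assoc.
      apply Rmult_le_compat; auto using Rabs_pos.
    - unfold tail_const.
      replace (2 / V * (K / (1 / 2 - theta) * exp (- (1 / 2 - theta) * a) * (2 + Rabs t / theta)))
        with (C / (1 / 2 - theta) * exp (- (1 / 2 - theta) * a)) by (unfold C; field; lra).
      apply Rmult_le_compat_l.
      + apply Rdiv_le_0_compat; lra.
      + apply exp_le_compat. nra. }
  assert (F1 : Rabs (RInt (fun u => g u * kern u) a (y - 1)) <=
    2 / V * (tail_const * (2 + Rabs t / theta))).
  { apply Hfar; [lra |]. intros u Hu. rewrite Rabs_pos_eq; lra. }
  assert (F3 : Rabs (RInt (fun u => g u * kern u) (y + 1) Y) <=
    2 / V * (tail_const * (2 + Rabs t / theta))).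
  { apply Hfar; [lra |]. intros u Hu. rewrite Rabs_left1; lra. }
  set (m := RInt kern (y - 1) (y + 1)).
  assert (Xk : forall x z, ex_RInt kern x z) by (intros; apply ex_RInt_continuous_everywhere; auto).
  (* A one-sided interval of length [1 / (2 V)] on which the kernel is at least [V / 4] already has
     mass [1 / 8]. *)
  assert (Hm : 1 / 8 <= m).
  { assert (Hv : 0 < / (2 * V)) by (apply Rinv_0_lt_compat; lra).
    assert (Hv2 : / (2 * V) <= 1).
    { rewrite <- Rinv_1. apply Rinv_le_contravar; lra. }
    assert (M : forall x z, x <= z -> 0 <= RInt kern x z) by (intros; apply RInt_ge_0; auto).
    assert (C1 := RInt_Chasles (V := R_CompleteNormedModule) kern (y - 1) y (y + 1) (Xk _ _) (Xk _ _)).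
    assert (C2 := RInt_Chasles (V := R_CompleteNormedModule) kern y (y + / (2 * V)) (y + 1)
       (Xk _ _) (Xk _ _)).
    unfold plus in C1, C2; simpl in C1, C2.
    pose proof (M (y - 1) y ltac:(lra)). pose proof (M (y + / (2 * V)) (y + 1) ltac:(lra)).
    assert (1 / 8 <= RInt kern y (y + / (2 * V))).
    { replace (1 / 8) with (RInt (fun _ => V / 4) y (y + / (2 * V))).
      - apply RInt_le; auto. lra. apply ex_RInt_const.
        intros u Hu. apply fejer_lower; auto. rewrite Rabs_left1; lra.
      - rewrite RInt_const. change ((y + / (2 * V) - y) * (V / 4) = 1 / 8). field. lra. }
    fold m in C1. lra. }
  assert (L0 : 0 <= local_const).
  { unfold local_const. apply Rmult_le_pos; [|lra].
    apply Rmult_le_pos; left; apply exp_pos. }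
  assert (F2 : Rabs (RInt (fun u => g u * kern u) (y - 1) (y + 1) - g y * m)
    <= local_const * (2 * m + 4)).
  { unfold m. rewrite <- RInt_Rmult, <- RInt_Rminus; auto using ex_RInt_Rmult.
    2:{ apply HI. lra. }
    apply Rle_trans with (RInt (fun u => local_const * (2 * kern u + 2)) (y - 1) (y + 1)).
    - apply Rabs_RInt_le; try lra.
      + apply ex_RInt_Rminus; auto using ex_RInt_Rmult. apply HI. lra.
      + apply ex_RInt_Rmult, ex_RInt_Rplus; auto using ex_RInt_Rmult. apply ex_RInt_const.
      + intros u Hu. rewrite <- Rmult_minus_distr_r, Rabs_mult, (Rabs_pos_eq (kern u)) by auto.
        assert (Huy : Rabs (u - y) <= 1) by (apply Rabs_le; lra).
        assert (D := damped_local c u y ltac:(lra) (continuous_phase t phi)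
          (Rabs_phase_le t phi) Hay Huy). fold g in D.
        assert (Z := Rabs_mult_fejer_le V (y - u) (exp (- y / 2)) HV0 (exp_pos _)).
        fold (kern u) in Z. rewrite (Rabs_minus_sym y u) in Z.
        apply Rle_trans with (local_const * (exp (y / 2) * Rabs (u - y) + 1) * kern u).
        { apply Rmult_le_compat_r; auto. }
        rewrite Rmult_assoc. apply Rmult_le_compat_l; auto.
        assert (R1 : exp (y / 2) * exp (- y / 2) = 1)
          by (rewrite <- exp_plus, <- exp_0; f_equal; field).
        (* Here [exp y <= V] enters: with [d = exp (- y / 2)] the far part of the first-moment
           bound, multiplied by [exp (y / 2)], is [2 exp y / V]. *)
        assert (R2 : exp (y / 2) * (2 / (V * exp (- y / 2))) <= 2).
        { replace (exp (y / 2) * (2 / (V * exp (- y / 2)))) with (2 * (exp y / V)).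
          - assert (exp y / V <= 1); [|lra]. apply Rmult_le_reg_r with V; auto. field_simplify; lra.
          - replace (exp y) with (exp (y / 2) * exp (y / 2)) by (rewrite <- exp_plus; f_equal; field).
            pose proof (exp_pos (- y / 2)). apply Rmult_eq_reg_r with (V * exp (- y / 2)); [|nra].
            transitivity (2 * exp (y / 2) * (exp (y / 2) * exp (- y / 2))). field; lra.
            rewrite R1. field; lra. }
        pose proof (exp_pos (y / 2)).
        assert (exp (y / 2) * (Rabs (u - y) * kern u) <=
          exp (y / 2) * (exp (- y / 2) * kern u + 2 / (V * exp (- y / 2))))
          by (apply Rmult_le_compat_l; lra).
        assert (exp (y / 2) * (exp (- y / 2) * kern u) = kern u)
          by (rewrite <- Rmult_assoc, R1; ring).
        lra.
    - right. rewrite RInt_Rmult, RInt_Rplus, RInt_Rmult, RInt_const;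
        auto using ex_RInt_Rmult, ex_RInt_const.
      2:{ apply ex_RInt_Rplus; auto using ex_RInt_Rmult. apply ex_RInt_const. }
      unfold scal; simpl; unfold mult; simpl. ring. }
  assert (C1 := RInt_Chasles (V := R_CompleteNormedModule) (fun u => g u * kern u) a (y - 1) (y + 1)
    (HI a (y - 1) ltac:(lra)) (HI (y - 1) (y + 1) ltac:(lra))).
  assert (C2 := RInt_Chasles (V := R_CompleteNormedModule) (fun u => g u * kern u) a (y + 1) Y
    (HI a (y + 1) ltac:(lra)) (HI (y + 1) Y ltac:(lra))).
  unfold plus in C1, C2; simpl in C1, C2.
  set (X := 4 * B * ln (1 + 2 * V) + 4 / V * (tail_const * (2 + Rabs t / theta))).
  assert (Q : Rabs (g y * m) <= X + local_const * (2 * m + 4)).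
  { unfold X. apply Rabs_le_between in E0, F1, F2, F3. apply Rabs_le_between.
    replace (4 / V * (tail_const * (2 + Rabs t / theta))) with
      (2 / V * (tail_const * (2 + Rabs t / theta)) + 2 / V * (tail_const * (2 + Rabs t / theta)))
      by (field; lra).
    rewrite <- C2, <- C1 in E0. lra. }
  rewrite Rabs_mult, (Rabs_pos_eq m) in Q by lra.
  replace (32 * B * ln (1 + 2 * V) + 32 / V * (tail_const * (2 + Rabs t / theta)) + 34 * local_const)
    with (8 * X + 34 * local_const) by (unfold X; field; lra).
  assert (HX : 0 <= X).
  { pose proof (Rabs_pos (RInt (fun u => g u * kern u) a Y)).
    pose proof (Rabs_pos (RInt (fun u => g u * kern u) a (y - 1))).
    unfold X. replace (4 / V * (tail_const * (2 + Rabs t / theta))) with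
      (2 * (2 / V * (tail_const * (2 + Rabs t / theta)))) by (field; lra). lra. }
  (* The mass [m] is bounded only from below, so [Q] is divided by [m] using [1 / m <= 8]: this
     gives [8 X + 2 L + 8 * 4 L] with [L = local_const], the origin of [34]. *)
  destruct (Rle_dec (Rabs (g y)) (8 * X + 34 * local_const)) as [|N]; auto. exfalso.
  assert ((8 * X + 32 * local_const) * (1 / 8) <= (8 * X + 32 * local_const) * m)
    by (apply Rmult_le_compat_l; lra).
  assert ((8 * X + 34 * local_const) * m < Rabs (g y) * m) by (apply Rmult_lt_compat_r; lra).
  nra.
Qed.

(** * Complex Laplace integrals and their analyticity *)

Lemma full_int_ext (f g : R -> R) : (forall u, f u = g u) -> full_int f = full_int g.
Proof.
  intros H. unfold full_int. f_equal. apply Lim_seq_ext. intros k. unfold trunc_int.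
  apply RInt_ext. intros; rewrite H; auto.
Qed.

Definition cint (f : R -> C) : C :=
  (full_int (fun u => Re (f u)), full_int (fun u => Im (f u))).

Definition cadmissible (d : R) (f : R -> C) : Prop :=
  admissible d (fun u => Re (f u)) /\ admissible d (fun u => Im (f u)).

Lemma cint_ext (f g : R -> C) : (forall u, f u = g u) -> cint f = cint g.
Proof.
  intros H. unfold cint. f_equal; apply full_int_ext; intros; rewrite H; auto.
Qed.

Lemma admissible_ext (d : R) (f g : R -> R) : (forall u, f u = g u) ->
  admissible d f -> admissible d g.
Proof.
  intros H [Hc [C [HC HB]]]. split.
  - intros u. apply (continuous_ext f); auto.
  - exists C. split; auto. intros; rewrite <- H; auto.
Qed.

Lemma cadmissible_ext (d : R) (f g : R -> C) : (forall u, f u = g u) ->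
  cadmissible d f -> cadmissible d g.
Proof.
  intros H [F1 F2].
  split; [apply (admissible_ext d (fun u => Re (f u))) | apply (admissible_ext d (fun u => Im (f u)))];
    auto; intros; rewrite H; auto.
Qed.

Lemma cadmissible_bound (d m : R) (f : R -> C) : 0 <= m -> Ccontinuous f ->
  (forall u, a <= u -> Cmod (f u) <= m * exp (- (theta + d) * u)) -> cadmissible d f.
Proof.
  intros HC [H1 H2] H. split; (split; [auto |]); exists m; (split; [auto |]); intros u Hu;
    (eapply Rle_trans; [| apply (H u Hu)]).
  - apply Rabs_Re_le.
  - apply Rabs_Im_le.
Qed.

Lemma cadmissible_plus (d : R) (f g : R -> C) : cadmissible d f -> cadmissible d g ->
  cadmissible d (fun u => f u + g u)%C.
Proof.
  intros [F1 F2] [G1 G2]. split.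
  - apply (admissible_ext d (fun u => 1 * Re (f u) + 1 * Re (g u))).
    + intros. unfold Re; simpl. ring.
    + apply admissible_linear; auto.
  - apply (admissible_ext d (fun u => 1 * Im (f u) + 1 * Im (g u))).
    + intros. unfold Im; simpl. ring.
    + apply admissible_linear; auto.
Qed.

Lemma cint_plus (d : R) (f g : R -> C) : 0 < d -> cadmissible d f -> cadmissible d g ->
  cint (fun u => f u + g u)%C = (cint f + cint g)%C.
Proof.
  intros Hd [F1 F2] [G1 G2]. unfold cint, Cplus; simpl. f_equal.
  - rewrite <- (Rmult_1_l (full_int (fun u => Re (f u)))), <- (Rmult_1_l (full_int (fun u => Re (g u)))).
    rewrite <- (full_int_linear d) by auto. apply full_int_ext. intros; unfold Re; simpl; ring.
  - rewrite <- (Rmult_1_l (full_int (fun u => Im (f u)))), <- (Rmult_1_l (full_int (fun u => Im (g u)))).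
    rewrite <- (full_int_linear d) by auto. apply full_int_ext. intros; unfold Im; simpl; ring.
Qed.

Lemma cint_scal (d : R) (c : C) (f : R -> C) : 0 < d -> cadmissible d f ->
  cadmissible d (fun u => c * f u)%C /\ cint (fun u => c * f u)%C = (c * cint f)%C.
Proof.
  intros Hd [F1 F2]. destruct c as [x y].
  assert (E1 : forall u, x * Re (f u) + - y * Im (f u) = Re ((x, y) * f u)%C)
    by (intros; unfold Re, Im; simpl; ring).
  assert (E2 : forall u, x * Im (f u) + y * Re (f u) = Im ((x, y) * f u)%C)
    by (intros; unfold Re, Im; simpl; ring).
  split.
  - split; (eapply admissible_ext; [first [apply E1 | apply E2] |]); apply admissible_linear; auto.
  - unfold cint. rewrite <- (full_int_ext _ _ E1), <- (full_int_ext _ _ E2).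
    rewrite !(full_int_linear d) by auto.
    apply injective_projections; simpl; ring.
Qed.

Lemma cint_le (d m : R) (f : R -> C) : 0 < d -> 0 <= m -> Ccontinuous f ->
  (forall u, a <= u -> Cmod (f u) <= m * exp (- (theta + d) * u)) ->
  Cmod (cint f) <= m * (2 * (K / d * exp (- d * a))).
Proof.
  intros Hd HC [H1 H2] H.
  assert (E1 : Rabs (full_int (fun u => Re (f u))) <= m * (K / d * exp (- d * a))).
  { apply full_int_le; auto. intros u Hu. eapply Rle_trans; [apply Rabs_Re_le | auto]. }
  assert (E2 : Rabs (full_int (fun u => Im (f u))) <= m * (K / d * exp (- d * a))).
  { apply full_int_le; auto. intros u Hu. eapply Rle_trans; [apply Rabs_Im_le | auto]. }
  eapply Rle_trans. apply Cmod_le_Rabs. unfold cint, Re at 1, Im at 1; simpl. lra.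
Qed.

(** The range of integration reaches down to the negative [a], where [|u|] differs from [u]; there
    [|u| <= u - 2 a], and the constant factor records the shift. *)
Lemma exp_abs_le (sig r u : R) : 0 <= r -> a <= u ->
  exp (- sig * u) * exp (2 * r * Rabs u) <= exp (- (4 * r * a)) * exp (- (sig - 2 * r) * u).
Proof.
  intros Hr Hu. rewrite <- !exp_plus. apply exp_le_compat.
  assert (Rabs u <= u - 2 * a) by (unfold Rabs; destruct Rcase_abs; lra). nra.
Qed.

(** The Taylor coefficient of order [k] at [s] of the Laplace transform of the counting error,
    obtained by expanding [exp (- u z)] under the integral. *)
Definition laplace_coef (s : C) (k : nat) : C :=
  cint (fun u => Cexp_ray s u * (RtoC (- u) ^ k * RtoC (/ INR (fact k))))%C.

Section LaplaceDisc.

(** Of the distance [4 r] from [Re s] to [theta], [2 r] is spent on the factor [exp (2 r |u|)] that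
    bounds the expansion in [z], and [2 r] remains as decay margin. *)
Variables (s z : C) (r : R).
Hypothesis r_pos : 0 < r.
Hypothesis r_eq : Re s = theta + 4 * r.
Hypothesis z_small : 4 * Cmod z <= r.

Let bound_admissible (m : R) (f : R -> C) : 0 <= m -> Ccontinuous f ->
  (forall u, Cmod (f u) <= m * (exp (- Re s * u) * exp (2 * r * Rabs u))) ->
  forall u, a <= u -> Cmod (f u) <= m * exp (- (4 * r * a)) * exp (- (theta + 2 * r) * u).
Proof.
  intros HC Hf H u Hu. eapply Rle_trans. apply H.
  rewrite (Rmult_assoc m). apply Rmult_le_compat_l; auto.
  replace (theta + 2 * r) with (Re s - 2 * r) by lra. apply exp_abs_le; lra.
Qed.

(** Since [(r |u|) ^ k / k! <= exp (r |u|)], a power of [u] costs a constant and part of the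
    available exponential. *)
Lemma laplace_term_admissible (k : nat) :
  cadmissible (2 * r) (fun u => Cexp_ray s u * (RtoC (- u) ^ k * RtoC (/ INR (fact k))))%C.
Proof.
  assert (Hrk : 0 < / r ^ k) by (apply Rinv_0_lt_compat, pow_lt; auto).
  assert (Hc : Ccontinuous (fun u => Cexp_ray s u * (RtoC (- u) ^ k * RtoC (/ INR (fact k))))%C).
  { apply Ccontinuous_mult; [apply Ccontinuous_Cexp_ray |].
    apply Ccontinuous_mult; [|apply Ccontinuous_const].
    apply Ccontinuous_pow, Ccontinuous_RtoC. smooth_continuous. }
  eapply cadmissible_bound with (m := / r ^ k * exp (- (4 * r * a))); auto.
  - apply Rmult_le_pos; [lra | left; apply exp_pos].
  - apply bound_admissible; auto. lra.
    intros u. rewrite !Cmod_mult, Cmod_Cexp_ray, Cmod_pow, !Cmod_R, Rabs_Ropp.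
    rewrite (Rabs_pos_eq (/ INR (fact k))) by (left; apply Rinv_0_lt_compat, INR_fact_lt_0).
    rewrite <- Rmult_assoc, (Rmult_comm (/ r ^ k)), !Rmult_assoc.
    apply Rmult_le_compat_l; [left; apply exp_pos |].
    apply Rmult_le_reg_l with (r ^ k). apply pow_lt; auto.
    replace (r ^ k * (exp (2 * (r * Rabs u)) * / r ^ k)) with (exp (2 * (r * Rabs u)))
      by (field; apply pow_nonzero; lra).
    rewrite <- Rmult_assoc, <- Rpow_mult_distr.
    pose proof (Rabs_pos u). assert (0 <= r * Rabs u) by nra.
    eapply Rle_trans. apply (pow_fact_le_exp (r * Rabs u) k); auto.
    apply exp_le_compat. lra.
Qed.

Lemma laplace_partial_sum (M : nat) :
  cadmissible (2 * r) (fun u => Cexp_ray s u * Cexp_poly M (RtoC (- u) * z))%C /\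
  cint (fun u => Cexp_ray s u * Cexp_poly M (RtoC (- u) * z))%C =
  sum_n (G := C_AbelianMonoid)
    (fun k => scal (V := C_NormedModule) (pow_n (K := C_Ring) z k) (laplace_coef s k)) M.
Proof.
  assert (Hd : 0 < 2 * r) by lra.
  induction M as [|M [IH1 IH2]].
  - assert (E : forall u, (Cexp_ray s u * (RtoC (- u) ^ 0 * RtoC (/ INR (fact 0))))%C
       = (Cexp_ray s u * Cexp_poly 0 (RtoC (- u) * z))%C).
    { intros u. simpl. rewrite Rinv_1. ring. }
    split.
    + apply (cadmissible_ext _ _ _ E), laplace_term_admissible.
    + rewrite sum_O, <- (cint_ext _ _ E). unfold laplace_coef.
      simpl. symmetry. apply Cmult_1_l.
  - assert (E : forall u, (Cexp_ray s u * Cexp_poly M (RtoC (- u) * z)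
        + z ^ S M * (Cexp_ray s u * (RtoC (- u) ^ S M * RtoC (/ INR (fact (S M))))))%C
       = (Cexp_ray s u * Cexp_poly (S M) (RtoC (- u) * z))%C).
    { intros u. cbn [Cexp_poly]. rewrite Cpow_mult_l. ring. }
    destruct (cint_scal (2 * r) (z ^ S M)%C _ Hd (laplace_term_admissible (S M))) as [S1 S2].
    split.
    + apply (cadmissible_ext _ _ _ E), cadmissible_plus; auto.
    + rewrite sum_Sn, <- IH2, <- (cint_ext _ _ E), (cint_plus (2 * r)) by auto.
      rewrite S2. reflexivity.
Qed.

(** Expanding to order [M] under the integral leaves an error at most [(1 / 2) ^ M exp (2 r |u|)]
    pointwise, still integrable against [exp (- s u)]. The partial sums therefore converge
    geometrically. *)
Lemma laplace_power_series :
  is_pseries (K := C_AbsRing) (V := C_NormedModule) (laplace_coef s) z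
    (cint (Cexp_ray (s + z)%C)).
Proof.
  assert (Hd : 0 < 2 * r) by lra.
  set (c0 := exp (- (4 * r * a)) * (2 * (K / (2 * r) * exp (- (2 * r) * a)))).
  assert (HE : forall M, Cmod (sum_n (G := C_AbelianMonoid)
    (fun k => scal (V := C_NormedModule) (pow_n (K := C_Ring) z k) (laplace_coef s k)) M
     - cint (Cexp_ray (s + z)%C))%C <= (1 / 2) ^ M * c0).
  { intros M. destruct (laplace_partial_sum M) as [A1 <-].
    assert (B : forall u, Cmod (Cexp (RtoC (- u) * z) - Cexp_poly M (RtoC (- u) * z))%C
       <= (1 / 2) ^ M * exp (2 * r * Rabs u)).
    { intros u. assert (Hw : Cmod (RtoC (- u) * z)%C = Rabs u * Cmod z)
        by (rewrite Cmod_mult, Cmod_R, Rabs_Ropp; auto).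
      pose proof (Rabs_pos u). pose proof (Cmod_ge_0 z).
      (* With [q = r |u|], [4 |z| <= r] gives [4 |u z| <= q], and [q + |u z|] stays below
         [2 r |u|]. *)
      eapply Rle_trans. apply (Cexp_poly_error M _ (r * Rabs u)).
      - rewrite Hw. nra.
      - apply Rmult_le_compat_l; [apply pow_le; lra |]. apply exp_le_compat. rewrite Hw. nra. }
    set (f := fun u => (Cexp_ray s u * (Cexp_poly M (RtoC (- u) * z) - Cexp (RtoC (- u) * z)))%C).
    assert (Hf : Ccontinuous f).
    { apply Ccontinuous_mult; [apply Ccontinuous_Cexp_ray |].
      apply Ccontinuous_plus.
      - clear. induction M; cbn [Cexp_poly]; [apply Ccontinuous_const |].
        apply Ccontinuous_plus; auto. apply Ccontinuous_mult; [|apply Ccontinuous_const].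
        apply Ccontinuous_pow, Ccontinuous_mult; [|apply Ccontinuous_const].
        apply Ccontinuous_RtoC. smooth_continuous.
      - apply (Ccontinuous_ext (fun u => - RtoC 1 * Cexp_ray z u)%C).
        + intros u. unfold Cexp_ray. rewrite RtoC_opp.
          replace (RtoC u * - z)%C with (- RtoC u * z)%C by ring. ring.
        + apply Ccontinuous_mult; [apply Ccontinuous_const | apply Ccontinuous_Cexp_ray]. }
    assert (Bf : forall u, Cmod (f u) <= (1 / 2) ^ M * (exp (- Re s * u) * exp (2 * r * Rabs u))).
    { intros u. unfold f. rewrite Cmod_mult, Cmod_Cexp_ray.
      replace (Cexp_poly M (RtoC (- u) * z) - Cexp (RtoC (- u) * z))%C with
        (- (Cexp (RtoC (- u) * z) - Cexp_poly M (RtoC (- u) * z)))%C by ring.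
      rewrite Cmod_opp. specialize (B u). pose proof (exp_pos (- Re s * u)). nra. }
    assert (Hp : 0 <= (1 / 2) ^ M) by (apply pow_le; lra).
    assert (Bf2 := bound_admissible _ f Hp Hf Bf).
    assert (HC : 0 <= (1 / 2) ^ M * exp (- (4 * r * a)))
      by (apply Rmult_le_pos; auto; left; apply exp_pos).
    assert (Af : cadmissible (2 * r) f) by (eapply cadmissible_bound; eauto).
    destruct (cint_scal (2 * r) (- RtoC 1)%C f Hd Af) as [Af' Ef].
    rewrite (cint_ext (Cexp_ray (s + z)%C)
      (fun u => Cexp_ray s u * Cexp_poly M (RtoC (- u) * z) + - RtoC 1 * f u)%C).
    2:{ intros u. rewrite Cexp_ray_plus. unfold f. ring. }
    rewrite (cint_plus (2 * r)) by auto. rewrite Ef.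
    match goal with |- Cmod ?x <= _ => replace x with (cint f) by ring end.
    unfold c0. rewrite <- Rmult_assoc. apply cint_le; auto. }
  apply is_series_C_spec. intros e He.
  assert (HC : 0 <= c0).
  { specialize (HE O). simpl pow in HE. eapply Rle_trans in HE; [|apply Cmod_ge_0]. lra. }
  destruct (pow_lt_1_zero (1 / 2) ltac:(rewrite Rabs_pos_eq; lra) (e / (c0 + 1))) as [N HN].
  { apply Rdiv_lt_0_compat; lra. }
  exists N. intros M HM. eapply Rle_lt_trans. apply HE.
  specialize (HN M HM). rewrite Rabs_pos_eq in HN by (apply pow_le; lra).
  apply Rle_lt_trans with ((1 / 2) ^ M * (c0 + 1)).
  - apply Rmult_le_compat_l; [apply pow_le; lra | lra].
  - apply Rmult_lt_compat_r with (r := c0 + 1) in HN; [|lra].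
    replace (e / (c0 + 1) * (c0 + 1)) with e in HN by (field; lra). auto.
Qed.

End LaplaceDisc.

Definition regular_part (s : C) : C := (s * cint (Cexp_ray s))%C.

Lemma regular_part_analytic (s : C) : theta < Re s -> analytic_at regular_part s.
Proof.
  intros Hs. set (r := (Re s - theta) / 4). assert (Hr : 0 < r) by (unfold r; lra).
  (* The factor [w] in front of the integral is [s + (w - s)]: a scaling by [s] plus a shift of the
     coefficients by one. *)
  exists (PS_plus (PS_scal s (laplace_coef s)) (PS_incr_1 (laplace_coef s))), (r / 4).
  split; [lra |]. intros w Hw.
  assert (L := laplace_power_series s (w - s)%C r Hr ltac:(unfold r; lra) ltac:(lra)).
  replace (s + (w - s))%C with w in L by ring.
  unfold regular_part. set (l := cint (Cexp_ray w)) in *.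
  replace (w * l)%C with (plus (scal s l) (scal (w - s)%C l) : C_NormedModule).
  - apply (is_pseries_plus (K := C_AbsRing) (V := C_NormedModule)).
    + apply (is_pseries_scal (K := C_AbsRing) (V := C_NormedModule)); auto. apply Cmult_comm.
    + apply (is_pseries_incr_1 (K := C_AbsRing) (V := C_NormedModule)); auto.
  - change (s * l + (w - s) * l = w * l)%C. ring.
Qed.

(** Abel summation from the weight [1] to [exp (- s u)]: the full integral of the derivative
    [- s exp (- s u)] is minus the regular part. The boundary term at [Y] and the tail beyond [Y]
    are the two pieces of [e]. *)
Lemma werror_regular_part (s : C) (Y : R) : theta < Re s -> 0 <= Y ->
  let e := K * (1 + Cmod s / (Re s - theta)) * exp (- (Re s - theta) * Y) in
  Rabs (werror (fun u => Re (Cexp_ray s u)) Y - Re (regular_part s)) <= e /\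
  Rabs (werror (fun u => Im (Cexp_ray s u)) Y - Im (regular_part s)) <= e.
Proof.
  intros Hs HY e. set (d := Re s - theta) in *. assert (Hd : 0 < d) by (unfold d; lra).
  destruct (Ccontinuous_Cexp_ray s) as [C1 C2].
  assert (Ad : cadmissible d (Cexp_ray s)).
  { apply (cadmissible_bound d 1); [lra | apply Ccontinuous_Cexp_ray |].
    intros u _. rewrite Cmod_Cexp_ray. unfold d. right.
    replace (theta + (Re s - theta)) with (Re s) by ring. ring. }
  destruct Ad as [A1 A2].
  assert (X : forall P p : R -> R, (forall u, is_derive P u (p u)) -> (forall u, continuous p u) ->
    (forall u, Rabs (P u) <= exp (- Re s * u)) -> (forall u, Rabs (p u) <= Cmod s * exp (- Re s * u)) ->
    Rabs (werror P Y - - full_int p) <= e).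
  { intros P p HP Hp BP Bp.
    assert (Hone : forall r : R, continuous (fun _ : R => 1) r)
      by (intros; apply continuous_const).
    assert (E1 := is_RInt_unique (V := R_CompleteNormedModule) _ _ _ _
      (werror_abel (fun _ => 1) P p Y HY Hone Hp HP)).
    fold (trunc_int p Y) in E1.
    rewrite (werror_ext (fun r => 1 * P r) P) in E1 by (intros; ring).
    assert (E2 := full_int_tail p (Cmod s) d Y Hp (Cmod_ge_0 s) Hd).
    assert (E3 : Rabs (full_int p - trunc_int p Y) <= K * Cmod s / d * exp (- d * Y)).
    { apply E2; [|lra]. intros u _. replace (theta + d) with (Re s) by (unfold d; ring). auto. }
    assert (E4 : Rabs (P Y * werror (fun _ => 1) Y) <= K * exp (- d * Y)).
    { rewrite Rabs_mult.
      replace (K * exp (- d * Y)) with (exp (- Re s * Y) * (K * exp (theta * Y))).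
      - apply Rmult_le_compat; auto using Rabs_pos. apply werror_one_le. lra.
      - rewrite (Rmult_comm K), <- Rmult_assoc, <- exp_plus, Rmult_comm. f_equal. f_equal.
        unfold d. ring. }
    unfold e. replace (K * (1 + Cmod s / d) * exp (- d * Y)) with
      (K * exp (- d * Y) + K * Cmod s / d * exp (- d * Y)) by (field; lra).
    change (trunc_int p Y = P Y * werror (fun _ : R => 1) Y - werror P Y) in E1.
    apply Rabs_le_between in E3, E4. apply Rabs_le_between. lra. }
  assert (D : forall u, is_Cderive (Cexp_ray s) u (- s * Cexp_ray s u)%C)
    by (intros; apply is_Cderive_Cexp_ray).
  assert (Hm : forall u, Cmod (- s * Cexp_ray s u)%C = Cmod s * exp (- Re s * u))
    by (intros; rewrite Cmod_mult, Cmod_opp, Cmod_Cexp_ray; auto).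
  destruct (Ccontinuous_mult _ _ (Ccontinuous_const (- s)%C) (Ccontinuous_Cexp_ray s)) as [Q1 Q2].
  destruct s as [x y]. unfold regular_part, cint.
  split.
  - assert (E := X (fun u => Re (Cexp_ray (x, y) u)) (fun u => Re (- (x, y) * Cexp_ray (x, y) u)%C)
      (fun u => proj1 (D u)) Q1).
    replace (Re _) with (- full_int (fun u => Re (- (x, y) * Cexp_ray (x, y) u)%C)).
    + apply E.
      * intros u. rewrite <- Cmod_Cexp_ray. apply Rabs_Re_le.
      * intros u. rewrite <- Hm. apply Rabs_Re_le.
    + rewrite (full_int_ext _ (fun u => - x * Re (Cexp_ray (x, y) u) + y * Im (Cexp_ray (x, y) u))).
      * rewrite (full_int_linear d) by auto. unfold Re at 3; simpl. ring.
      * intros; unfold Re, Im; simpl; ring.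
  - assert (E := X (fun u => Im (Cexp_ray (x, y) u)) (fun u => Im (- (x, y) * Cexp_ray (x, y) u)%C)
      (fun u => proj2 (D u)) Q2).
    replace (Im (_ * _)%C) with (- full_int (fun u => Im (- (x, y) * Cexp_ray (x, y) u)%C)).
    + apply E.
      * intros u. rewrite <- Cmod_Cexp_ray. apply Rabs_Im_le.
      * intros u. rewrite <- Hm. apply Rabs_Im_le.
    + rewrite (full_int_ext _ (fun u => - x * Im (Cexp_ray (x, y) u) + - y * Re (Cexp_ray (x, y) u))).
      * rewrite (full_int_linear d) by auto. unfold Im at 3; simpl. ring.
      * intros; unfold Re, Im; simpl; ring.
Qed.

(** * Partial sums and the regular part of zeta on the critical line *)

Lemma ln_le_Rpower (x d : R) : 1 <= x -> 0 < d -> ln x <= Rpower x d / d.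
Proof.
  intros Hx Hd. unfold Rpower. pose proof (exp_ineq1_le (d * ln x)).
  apply Rmult_le_reg_r with d; auto.
  replace (exp (d * ln x) / d * d) with (exp (d * ln x)) by (field; lra). lra.
Qed.

Lemma Rpower_ge_1 (x d : R) : 1 <= x -> 0 <= d -> 1 <= Rpower x d.
Proof.
  intros Hx Hd. unfold Rpower. rewrite <- exp_0. apply exp_le_compat.
  assert (0 <= ln x); [|nra]. rewrite <- ln_1. apply ln_le; lra.
Qed.

(** The addition formula for [cos (t u + phi)]. It reduces a bound uniform in [phi] to the real and
    imaginary parts at [1/2 + i t]. *)
Lemma damped_phase_split (t phi Y : R) :
  werror (damped_phase t phi) Y =
  cos phi * werror (fun u => Re (Cexp_ray (1 / 2, t) u)) Y
  + sin phi * werror (fun u => Im (Cexp_ray (1 / 2, t) u)) Y.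
Proof.
  destruct (Ccontinuous_Cexp_ray (1 / 2, t)) as [C1 C2].
  rewrite <- werror_linear by auto. apply werror_ext. intros u.
  unfold damped_phase, Cexp_ray, Cexp, Re, Im; simpl.
  rewrite cos_plus.
  replace (u * - (1 / 2) - 0 * - t) with (- u / 2) by field.
  replace (u * - t + 0 * - (1 / 2)) with (- (t * u)) by ring.
  rewrite cos_neg, sin_neg. ring.
Qed.

(** Absolute convergence of the Laplace integral, the factor [|s|] giving linear growth. It covers
    bounded heights, where a Lindelof bound says nothing. *)
Lemma Cmod_regular_part_le (t : R) : theta < 1 / 2 ->
  Cmod (regular_part (1 / 2, t)) <=
    (1 / 2 + Rabs t) * (2 * (K / (1 / 2 - theta) * exp (- (1 / 2 - theta) * a))).
Proof.
  intros Ht. unfold regular_part. rewrite Cmod_mult. apply Rmult_le_compat.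
  - apply Cmod_ge_0.
  - apply Cmod_ge_0.
  - eapply Rle_trans. apply Cmod_le_Rabs. unfold Re, Im; simpl.
    rewrite (Rabs_pos_eq (1 / 2)); lra.
  - rewrite <- (Rmult_1_l (2 * _)). apply cint_le; try lra. apply Ccontinuous_Cexp_ray.
    intros u _. rewrite Cmod_Cexp_ray. unfold Re; simpl. right.
    replace (theta + (1 / 2 - theta)) with (1 / 2) by ring. ring.
Qed.

Lemma werror_critical_line (t Y : R) : theta < 1 / 2 -> 0 <= Y ->
  let e := K * (1 + (1 / 2 + Rabs t) / (1 / 2 - theta)) * exp (- (1 / 2 - theta) * Y) in
  Rabs (werror (fun u => Re (Cexp_ray (1 / 2, t) u)) Y - Re (regular_part (1 / 2, t))) <= e /\
  Rabs (werror (fun u => Im (Cexp_ray (1 / 2, t) u)) Y - Im (regular_part (1 / 2, t))) <= e.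
Proof.
  intros Ht HY e.
  destruct (werror_regular_part (1 / 2, t) Y ltac:(unfold Re; simpl; lra) HY) as [E1 E2].
  change (Re (1 / 2, t)) with (1 / 2) in E1, E2.
  assert (He : K * (1 + Cmod (1 / 2, t) / (1 / 2 - theta)) * exp (- (1 / 2 - theta) * Y) <= e).
  { apply Rmult_le_compat_r; [left; apply exp_pos |]. apply Rmult_le_compat_l; auto.
    apply Rplus_le_compat_l. apply Rmult_le_compat_r; [left; apply Rinv_0_lt_compat; lra |].
    eapply Rle_trans. apply Cmod_le_Rabs. unfold Re, Im; simpl.
    rewrite (Rabs_pos_eq (1 / 2)); lra. }
  split; lra.
Qed.

Lemma werror_damped_phase_le (t phi Y : R) : theta < 1 / 2 -> 0 <= Y ->
  Rabs (werror (damped_phase t phi) Y) <= 2 * Cmod (regular_part (1 / 2, t))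
    + 2 * (K * (1 + (1 / 2 + Rabs t) / (1 / 2 - theta)) * exp (- (1 / 2 - theta) * Y)).
Proof.
  intros Ht HY. rewrite damped_phase_split.
  destruct (werror_critical_line t Y Ht HY) as [E1 E2].
  set (er := K * (1 + (1 / 2 + Rabs t) / (1 / 2 - theta)) * exp (- (1 / 2 - theta) * Y)) in *.
  pose proof (Rabs_Re_le (regular_part (1 / 2, t))) as G1.
  pose proof (Rabs_Im_le (regular_part (1 / 2, t))) as G2.
  set (x := werror (fun u => Re (Cexp_ray (1 / 2, t) u)) Y) in *.
  set (y := werror (fun u => Im (Cexp_ray (1 / 2, t) u)) Y) in *.
  set (g := Cmod (regular_part (1 / 2, t))) in *.
  assert (X : Rabs x <= g + er).
  { apply Rabs_le_between in E1, G1. apply Rabs_le_between. lra. }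
  assert (Y' : Rabs y <= g + er).
  { apply Rabs_le_between in E2, G2. apply Rabs_le_between. lra. }
  eapply Rle_trans. apply Rabs_triang. rewrite !Rabs_mult.
  pose proof (Rabs_cos_le phi). pose proof (Rabs_sin_le phi).
  pose proof (Rabs_pos x). pose proof (Rabs_pos y). nra.
Qed.

Lemma Cmod_regular_part_werror_le (t Y : R) : theta < 1 / 2 -> 0 <= Y ->
  Cmod (regular_part (1 / 2, t)) <=
    Rabs (werror (damped_phase t 0) Y) + Rabs (werror (damped_phase t (PI / 2)) Y)
    + 2 * (K * (1 + (1 / 2 + Rabs t) / (1 / 2 - theta)) * exp (- (1 / 2 - theta) * Y)).
Proof.
  intros Ht HY. rewrite !damped_phase_split, cos_0, sin_0, cos_PI2, sin_PI2.
  destruct (werror_critical_line t Y Ht HY) as [E1 E2].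
  set (er := K * (1 + (1 / 2 + Rabs t) / (1 / 2 - theta)) * exp (- (1 / 2 - theta) * Y)) in *.
  rewrite !Rmult_0_l, !Rmult_1_l, Rplus_0_r, Rplus_0_l.
  eapply Rle_trans. apply Cmod_le_Rabs.
  pose proof (Rle_abs (werror (fun u => Re (Cexp_ray (1 / 2, t) u)) Y)).
  pose proof (Rle_abs (- werror (fun u => Re (Cexp_ray (1 / 2, t) u)) Y)) as H1.
  pose proof (Rle_abs (werror (fun u => Im (Cexp_ray (1 / 2, t) u)) Y)).
  pose proof (Rle_abs (- werror (fun u => Im (Cexp_ray (1 / 2, t) u)) Y)) as H2.
  rewrite Rabs_Ropp in H1, H2.
  apply Rabs_le_between in E1, E2.
  assert (Rabs (Re (regular_part (1 / 2, t))) <=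
    Rabs (werror (fun u => Re (Cexp_ray (1 / 2, t) u)) Y) + er) by (apply Rabs_le; lra).
  assert (Rabs (Im (regular_part (1 / 2, t))) <=
    Rabs (werror (fun u => Im (Cexp_ray (1 / 2, t) u)) Y) + er) by (apply Rabs_le; lra).
  lra.
Qed.

(** Abel summation with [P u = exp (- u / 2)]. Square-root size is borderline: the integrand is only
    bounded by [M / 2], so the length [Y - a] of the interval is lost. *)
Lemma werror_damped_phase_abel (t phi Y M : R) : 0 <= Y ->
  (forall u, a <= u <= Y -> Rabs (werror (phase t phi) u) <= M * exp (u / 2)) ->
  Rabs (werror (damped_phase t phi) Y) <= M * (1 + (Y - a) / 2).
Proof.
  intros HY HM.
  set (P := fun u => exp (- u / 2)). set (p := fun u => - (1 / 2) * exp (- u / 2)).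
  assert (Hp : forall u, continuous p u) by (unfold p; smooth_continuous).
  assert (HP : forall u, is_derive P u (p u))
    by (intros; unfold P, p; auto_derive; auto; unfold Rdiv; ring).
  assert (E := is_RInt_unique (V := R_CompleteNormedModule) _ _ _ _
    (werror_abel (phase t phi) P p Y HY (continuous_phase t phi) Hp HP)).
  assert (R1 : forall u, exp (u / 2) * exp (- u / 2) = 1)
    by (intros; rewrite <- exp_plus, <- exp_0; f_equal; field).
  assert (B : Rabs (RInt (fun u => werror (phase t phi) u * p u) a Y) <= (Y - a) * (M / 2)).
  { apply abs_RInt_le_const; [lra | apply ex_RInt_werror; auto using continuous_phase; lra |].
    intros u Hu. unfold p. rewrite !Rabs_mult, Rabs_Ropp, (Rabs_pos_eq (1 / 2)) by lra.
    rewrite (Rabs_pos_eq (exp _)) by (left; apply exp_pos).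
    apply Rle_trans with (M * exp (u / 2) * (1 / 2 * exp (- u / 2))).
    - apply Rmult_le_compat_r; auto. pose proof (exp_pos (- u / 2)). lra.
    - right. transitivity (M / 2 * (exp (u / 2) * exp (- u / 2))); [field | rewrite R1; ring]. }
  rewrite E in B.
  rewrite (werror_ext (fun u => phase t phi u * P u) (damped_phase t phi)) in B
    by (intros; unfold phase, P, damped_phase; ring).
  assert (B2 : Rabs (P Y * werror (phase t phi) Y) <= M).
  { rewrite Rabs_mult. unfold P. rewrite (Rabs_pos_eq (exp _)) by (left; apply exp_pos).
    apply Rle_trans with (exp (- Y / 2) * (M * exp (Y / 2))).
    - apply Rmult_le_compat_l; [left; apply exp_pos | apply HM; lra].
    - right. transitivity (M * (exp (Y / 2) * exp (- Y / 2))); [ring | rewrite R1; ring]. }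
  apply Rabs_le_between in B, B2. apply Rabs_le_between. lra.
Qed.

(** The hypothesis is LH for the real and imaginary parts in the logarithmic variable, extended down
    to [u = a]. Half of [eps] is spent on it and half on the length of the interval of summation, a
    multiple of [ln |t|]. *)
Lemma regular_part_lindelof : theta < 1 / 2 ->
  (forall eps B, 0 < eps -> 0 < B -> exists C0, forall t phi u, 1 <= Rabs t ->
     phi = 0 \/ phi = PI / 2 -> a <= u <= B * ln (Rabs t) ->
     Rabs (werror (phase t phi) u) <= C0 * Rpower (Rabs t) eps * exp (u / 2)) ->
  forall eps, 0 < eps -> exists C0, forall t, 1 <= Rabs t ->
    Cmod (regular_part (1 / 2, t)) <= C0 * Rpower (Rabs t) eps.
Proof.
  intros Ht H eps Heps. set (d := 1 / 2 - theta). assert (Hd : 0 < d) by (unfold d; lra).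
  assert (HB : 0 < / d) by (apply Rinv_0_lt_compat; auto).
  (* The sum is taken up to [Y = ln |t| / d], so the exponent needed is [B = / d]; there
     [exp (- d * Y) = / |t|] cancels the factor [|t|] of the tail. *)
  destruct (H (eps / 2) (/ d) ltac:(lra) HB) as [C0 HC].
  set (C1 := Rmax C0 0).
  exists (2 * (C1 * (1 + (/ d * (2 / eps) - a) / 2)) + 2 * (K * (1 + 2 / d))).
  intros t Ht1. set (T := Rabs t) in *. set (Y := / d * ln T).
  assert (Hln : 0 <= ln T) by (rewrite <- ln_1; apply ln_le; lra).
  assert (HY : 0 <= Y) by (apply Rmult_le_pos; lra).
  assert (C1pos : 0 <= C1) by apply Rmax_r.
  assert (HP : 1 <= Rpower T (eps / 2)) by (apply Rpower_ge_1; lra).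
  assert (X : forall phi, phi = 0 \/ phi = PI / 2 -> Rabs (werror (damped_phase t phi) Y) <=
     C1 * Rpower T (eps / 2) * (1 + (Y - a) / 2)).
  { intros phi Hphi. apply werror_damped_phase_abel; auto. intros u Hu.
    eapply Rle_trans. apply (HC t phi u Ht1 Hphi Hu).
    apply Rmult_le_compat_r; [left; apply exp_pos |].
    apply Rmult_le_compat_r; [lra | apply Rmax_l]. }
  assert (HYb : 1 + (Y - a) / 2 <= (1 + (/ d * (2 / eps) - a) / 2) * Rpower T (eps / 2)).
  { assert (L := ln_le_Rpower T (eps / 2) Ht1 ltac:(lra)).
    replace (Rpower T (eps / 2) / (eps / 2)) with (2 / eps * Rpower T (eps / 2)) in L by (field; lra).
    unfold Y. assert (/ d * ln T <= / d * (2 / eps * Rpower T (eps / 2)))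
      by (apply Rmult_le_compat_l; lra). nra. }
  assert (R2 : Rpower T eps = Rpower T (eps / 2) * Rpower T (eps / 2))
    by (rewrite <- Rpower_plus; f_equal; field).
  assert (X2 : forall phi, phi = 0 \/ phi = PI / 2 -> Rabs (werror (damped_phase t phi) Y) <=
     C1 * (1 + (/ d * (2 / eps) - a) / 2) * Rpower T eps).
  { intros phi Hphi. eapply Rle_trans. apply X; auto. rewrite R2.
    assert (0 <= C1 * Rpower T (eps / 2)) by (apply Rmult_le_pos; lra).
    assert (Q := Rmult_le_compat_l _ _ _ H0 HYb). lra. }
  eapply Rle_trans. apply (Cmod_regular_part_werror_le t Y Ht HY). fold d T.
  assert (Z : K * (1 + (1 / 2 + T) / d) * exp (- d * Y) <= K * (1 + 2 / d)).
  { replace (exp (- d * Y)) with (/ T).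
    - rewrite Rmult_assoc. apply Rmult_le_compat_l; auto.
      apply Rmult_le_reg_r with (T * d). nra.
      replace ((1 + (1 / 2 + T) / d) * / T * (T * d)) with (d + (1 / 2 + T)) by (field; lra).
      replace ((1 + 2 / d) * (T * d)) with (T * d + 2 * T) by (field; lra). nra.
    - unfold Y. replace (- d * (/ d * ln T)) with (- ln T) by (field; lra).
      rewrite exp_Ropp, exp_ln; lra. }
  assert (1 <= Rpower T eps) by (apply Rpower_ge_1; lra).
  assert (0 <= K * (1 + 2 / d)).
  { apply Rmult_le_pos; auto. assert (0 <= 2 / d) by (apply Rdiv_le_0_compat; lra). lra. }
  pose proof (X2 0 (or_introl eq_refl)). pose proof (X2 (PI / 2) (or_intror eq_refl)).
  nra.
Qed.

(** With [T = 2 + |t|], the kernel is used at height [V = T ^ (B + 1)], which exceeds both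
    [exp y] and [|t|]. *)
Lemma werror_phase_lindelof : 0 < theta < 1 / 2 ->
  (forall eps, 0 < eps -> exists C0, forall tau,
     Cmod (regular_part (1 / 2, tau)) <= C0 * Rpower (1 + Rabs tau) eps) ->
  forall eps B, 0 < eps -> 0 < B -> exists C0, forall t phi y,
    a + 1 <= y -> exp y <= Rpower (2 + Rabs t) B ->
    Rabs (werror (phase t phi) y) <= C0 * Rpower (2 + Rabs t) eps * exp (y / 2).
Proof.
  intros Ht H eps B Heps HB.
  (* Frequencies up to [|t| + V] satisfy [1 + |tau| <= T ^ (m + 1)], so exponent [e1] costs
     [T ^ (eps / 2)]. The other [eps / 2] pays for [ln (1 + 2 * V)]. *)
  set (m := B + 1). set (e1 := eps / 2 / (m + 1)).
  assert (He1 : 0 < e1) by (unfold e1, m; apply Rdiv_lt_0_compat; lra).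
  destruct (H e1 He1) as [C0 HC]. set (C1 := Rmax C0 0).
  assert (C1pos : 0 <= C1) by apply Rmax_r.
  exists (32 * (2 * C1 + 2) * ((m + 2) * (2 / eps)) + 32 * (tail_const * (2 + / theta))
          + 34 * local_const).
  intros t phi y Hy HyB. set (T := 2 + Rabs t) in *.
  assert (HT : 2 <= T) by (unfold T; pose proof (Rabs_pos t); lra).
  set (V := Rpower T m).
  assert (TV : T <= V).
  { unfold V. rewrite <- (Rpower_1 T) at 1 by lra. apply Rle_Rpower; unfold m; lra. }
  assert (HyV : exp y <= V).
  { eapply Rle_trans. apply HyB. apply Rle_Rpower; unfold m; lra. }
  assert (Hd : 0 < 1 / 2 - theta) by lra.
  (* The truncation [Y] is taken so large, depending on [t] and [V], that both truncation errors are
     at most [1]. *)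
  destruct (exp_decay_lt (2 * (K * (1 + (1 / 2 + (Rabs t + V)) / (1 / 2 - theta))))
    (1 / 2 - theta) 1 Hd Rlt_0_1) as [Y1 [HY1 HY1']].
  destruct (exp_decay_lt (K * (2 + Rabs t / theta)) (1 / 2 - theta) 1 Hd Rlt_0_1) as [Y2 [HY2 HY2']].
  set (Y := Rmax (y + 1) (Y1 + Y2)).
  assert (YA : y + 1 <= Y) by apply Rmax_l.
  assert (YB : Y1 + Y2 <= Y) by apply Rmax_r.
  set (b := 2 * (C1 * Rpower T (eps / 2)) + 2).
  assert (HP : 1 <= Rpower T (eps / 2)) by (apply Rpower_ge_1; lra).
  assert (Hb1 : 1 <= b) by (unfold b; nra).
  assert (Main : Rabs (damped (phase t phi) y) <=
    32 * b * ln (1 + 2 * V) + 32 / V * (tail_const * (2 + Rabs t / theta)) + 34 * local_const).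
  { apply (damped_pointwise t phi y V Y b); auto; try lra.
    - intros tau psi Htau. eapply Rle_trans. apply werror_damped_phase_le; lra.
      assert (G : Cmod (regular_part (1 / 2, tau)) <= C1 * Rpower T (eps / 2)).
      { eapply Rle_trans. apply HC.
        apply Rle_trans with (C1 * Rpower (1 + Rabs tau) e1).
        - apply Rmult_le_compat_r; [left; apply exp_pos | apply Rmax_l].
        - apply Rmult_le_compat_l; auto.
          apply Rle_trans with (Rpower (Rpower T (m + 1)) e1).
          + pose proof (Rabs_pos tau). apply Rle_Rpower_l; [lra |]. split; [lra |].
            rewrite Rpower_plus, Rpower_1 by lra. fold V. unfold T in *. nra.
          + rewrite Rpower_mult. right. f_equal. unfold e1. field. unfold m. lra. }
      assert (E : 2 * (K * (1 + (1 / 2 + Rabs tau) / (1 / 2 - theta)) * exp (- (1 / 2 - theta) * Y)) <= 1).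
      { apply Rle_trans with (2 * (K * (1 + (1 / 2 + (Rabs t + V)) / (1 / 2 - theta)))
          * exp (- (1 / 2 - theta) * Y)).
        - rewrite <- Rmult_assoc. apply Rmult_le_compat_r; [left; apply exp_pos |].
          apply Rmult_le_compat_l; [lra |]. apply Rmult_le_compat_l; auto.
          apply Rplus_le_compat_l. apply Rmult_le_compat_r; [left; apply Rinv_0_lt_compat; lra | lra].
        - left. apply HY1'. lra. }
      unfold b. lra.
    - apply Rle_trans with 1; auto.
      apply Rle_trans with (K * (2 + Rabs t / theta) * exp (- (1 / 2 - theta) * Y)).
      + replace (exp (- Y / 2) * Rabs (werror (phase t phi) Y)) with (Rabs (damped (phase t phi) Y)).
        * apply damped_decay; lra.
        * unfold damped. rewrite Rabs_mult, (Rabs_pos_eq (exp _)) by (left; apply exp_pos). ring.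
      + left. apply HY2'. lra. }
  assert (R2 : Rpower T eps = Rpower T (eps / 2) * Rpower T (eps / 2))
    by (rewrite <- Rpower_plus; f_equal; field).
  assert (HPe : 1 <= Rpower T eps) by (apply Rpower_ge_1; lra).
  assert (Hln : ln (1 + 2 * V) <= (m + 2) * (2 / eps) * Rpower T (eps / 2)).
  { apply Rle_trans with ((m + 2) * ln T).
    - apply Rle_trans with (ln (Rpower T (m + 2))).
      + apply ln_le; [lra |]. rewrite Rpower_plus. fold V.
        replace (Rpower T 2) with (T * T).
        * assert (4 <= T * T) by nra.
          assert (V * 4 <= V * (T * T)) by (apply Rmult_le_compat_l; lra). lra.
        * replace 2 with (1 + 1) by ring. rewrite Rpower_plus, Rpower_1; lra.
      + right. unfold Rpower. rewrite ln_exp. auto.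
    - rewrite Rmult_assoc. apply Rmult_le_compat_l; [unfold m; lra |].
      eapply Rle_trans. apply (ln_le_Rpower T (eps / 2)); lra. right. field. lra. }
  assert (L0 : 0 <= local_const).
  { unfold local_const. apply Rmult_le_pos; [|lra].
    apply Rmult_le_pos; left; apply exp_pos. }
  assert (T0 : 0 <= tail_const).
  { unfold tail_const. apply Rmult_le_pos; [|left; apply exp_pos]. apply Rdiv_le_0_compat; lra. }
  assert (P1 : 32 * b * ln (1 + 2 * V) <=
    32 * (2 * C1 + 2) * ((m + 2) * (2 / eps)) * Rpower T eps).
  { assert (b <= (2 * C1 + 2) * Rpower T (eps / 2)) by (unfold b; nra).
    assert (0 <= (m + 2) * (2 / eps) * Rpower T (eps / 2)).
    { apply Rmult_le_pos; [|lra]. apply Rmult_le_pos; [unfold m; lra | apply Rdiv_le_0_compat; lra]. }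
    apply Rle_trans with (32 * ((2 * C1 + 2) * Rpower T (eps / 2))
      * ((m + 2) * (2 / eps) * Rpower T (eps / 2))).
    - apply Rle_trans with (32 * b * ((m + 2) * (2 / eps) * Rpower T (eps / 2))).
      + apply Rmult_le_compat_l; lra.
      + apply Rmult_le_compat_r; lra.
    - rewrite R2. right. ring. }
  assert (P2 : 32 / V * (tail_const * (2 + Rabs t / theta)) <= 32 * (tail_const * (2 + / theta))).
  { replace (32 / V * (tail_const * (2 + Rabs t / theta))) with
      (32 * (tail_const * ((2 + Rabs t / theta) / V))) by (field; lra).
    apply Rmult_le_compat_l; [lra |]. apply Rmult_le_compat_l; auto.
    apply Rmult_le_reg_r with (V * theta). nra.
    replace ((2 + Rabs t / theta) / V * (V * theta)) with (2 * theta + Rabs t) by (field; lra).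
    replace ((2 + / theta) * (V * theta)) with (2 * (V * theta) + V) by (field; lra).
    unfold T in *. nra. }
  assert (Q : Rabs (damped (phase t phi) y) <= (32 * (2 * C1 + 2) * ((m + 2) * (2 / eps))
     + 32 * (tail_const * (2 + / theta)) + 34 * local_const) * Rpower T eps).
  { assert (0 <= tail_const * (2 + / theta)).
    { apply Rmult_le_pos; auto. assert (0 < / theta) by (apply Rinv_0_lt_compat; lra). lra. }
    nra. }
  unfold damped in Q. rewrite Rabs_mult, (Rabs_pos_eq (exp _)) in Q by (left; apply exp_pos).
  apply Rmult_le_compat_r with (r := exp (y / 2)) in Q; [|left; apply exp_pos].
  assert (R1 : exp (- y / 2) * exp (y / 2) = 1)
    by (rewrite <- exp_plus, <- exp_0; f_equal; field).
  rewrite Rmult_assoc, R1, Rmult_1_r in Q. exact Q.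
Qed.

End WeightedSums.

(** * The identity theorem on a horizontal line *)

Notation Cpseries := (is_pseries (K := C_AbsRing) (V := C_NormedModule)).

Lemma is_series_C_unique (f : nat -> C) (l m : C) :
  is_series (K := C_AbsRing) (V := C_NormedModule) f l ->
  is_series (K := C_AbsRing) (V := C_NormedModule) f m -> l = m.
Proof.
  intros H1 H2.
  apply (filterlim_locally_unique (K := C_AbsRing) (V := C_NormedModule) (F := eventually)
    (sum_n f)); auto.
Qed.

(** A term is the difference of two consecutive partial sums, both within [1] of the limit from some
    index on; the finitely many earlier terms are bounded separately. *)
Lemma Cpseries_bounded (c : nat -> C) (x : R) (l : C) : Cpseries c (RtoC x) l -> 0 < x ->
  exists M, 0 <= M /\ forall k, Cmod (c k) * x ^ k <= M.
Proof.
  intros H Hx. apply is_series_C_spec with (e := 1) in H; [|lra]. destruct H as [N HN].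
  set (term := fun k => scal (V := C_NormedModule) (pow_n (K := C_Ring) (RtoC x) k) (c k)) in *.
  assert (T : forall k, Cmod (term k : C) = Cmod (c k) * x ^ k).
  { intros k. unfold term. change (Cmod (RtoC x ^ k * c k)%C = Cmod (c k) * x ^ k).
    rewrite Cmod_mult, Cmod_pow, Cmod_R, Rabs_pos_eq by lra. ring. }
  assert (F : exists M0, 0 <= M0 /\ forall k, (k <= N)%nat -> Cmod (term k : C) <= M0).
  { clear. induction N as [|N [M0 [P0 H0]]].
    - exists (Cmod (term O : C)). split; [apply Cmod_ge_0 |].
      intros k Hk. replace k with O by lia. apply Rle_refl.
    - exists (M0 + Cmod (term (S N) : C)). pose proof (Cmod_ge_0 (term (S N) : C)). split; [lra |].
      intros k Hk. destruct (Nat.eq_dec k (S N)) as [-> | Hne]; [lra |].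
      specialize (H0 k ltac:(lia)). lra. }
  destruct F as [M0 [P0 H0]]. exists (M0 + 2). split; [lra |]. intros k. rewrite <- T.
  destruct (Nat.le_gt_cases k N) as [Hk | Hk]; [specialize (H0 k Hk); lra |].
  destruct k; [lia |].
  assert (S1 := HN (S k) ltac:(lia)). assert (S2 := HN k ltac:(lia)).
  rewrite sum_Sn in S1.
  set (p := sum_n (G := C_AbelianMonoid) term k) in *.
  change (Cmod (p + term (S k) - l)%C < 1) in S1. change (Cmod (p - l)%C < 1) in S2.
  replace (term (S k) : C) with ((p + term (S k) - l) + - (p - l))%C by ring.
  eapply Rle_trans. apply Cmod_triangle. rewrite Cmod_opp. lra.
Qed.

(** Once the coefficients below [m] vanish, the series is [c m * x ^ m] plus a tail of order
    [x ^ (m + 1)]. Dividing by [x ^ m] and letting [x] decrease to [0] gives [c m = 0]. *)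
Lemma Cpseries_zero_right (c : nat -> C) (d : R) : 0 < d ->
  (forall x, 0 < x < d -> Cpseries c (RtoC x) (RtoC 0)) -> forall k, c k = RtoC 0.
Proof.
  intros Hd H.
  destruct (Cpseries_bounded c (d / 2) _ (H (d / 2) ltac:(lra)) ltac:(lra)) as [M [HM HB]].
  set (x0 := d / 2) in *. assert (Hx0 : 0 < x0) by (unfold x0; lra).
  intros k. induction k as [m IH] using (well_founded_induction Nat.lt_wf_0).
  assert (B : forall x, 0 < x <= x0 / 2 -> Cmod (c m) * x ^ m <= 2 * M * (x / x0) ^ S m).
  { intros x Hx. set (y := x / x0).
    assert (Hy : 0 < y <= 1 / 2).
    { unfold y. split; [apply Rdiv_lt_0_compat; lra |].
      apply Rmult_le_reg_r with x0; auto. replace (x / x0 * x0) with x by (field; lra). lra. }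
    set (term := fun k => scal (V := C_NormedModule) (pow_n (K := C_Ring) (RtoC x) k) (c k)).
    assert (Tb : forall k, Cmod (term k : C) <= M * y ^ k).
    { intros k. change (Cmod (RtoC x ^ k * c k)%C <= M * y ^ k).
      rewrite Cmod_mult, Cmod_pow, Cmod_R, Rabs_pos_eq by lra.
      replace x with (x0 * y) by (unfold y; field; lra). rewrite Rpow_mult_distr.
      specialize (HB k). pose proof (pow_le y k ltac:(lra)). nra. }
    assert (Low : forall N, (N < m)%nat -> sum_n (G := C_AbelianMonoid) term N = RtoC 0).
    { intros N. induction N; intros HN.
      - rewrite sum_O. unfold term. rewrite (IH O) by lia. apply Cmult_0_r.
      - rewrite sum_Sn, IHN by lia. unfold term. rewrite (IH (S N)) by lia.
        change (RtoC 0 + RtoC x ^ S N * RtoC 0 = RtoC 0)%C. ring. }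
    (* A geometric tail in telescoped form: for [y <= 1 / 2], [y ^ k <= 2 (y ^ k - y ^ (k + 1))]. *)
    assert (Up : forall j, Cmod (sum_n (G := C_AbelianMonoid) term (m + j) - term m)%C
       <= 2 * M * (y ^ S m - y ^ S (m + j))).
    { induction j.
      - rewrite Nat.add_0_r. replace (sum_n (G := C_AbelianMonoid) term m) with (term m : C).
        + replace (term m - term m)%C with (RtoC 0) by ring. rewrite Cmod_R, Rabs_R0. lra.
        + destruct m; [rewrite sum_O; auto |]. rewrite sum_Sn, Low by lia.
          symmetry. apply Cplus_0_l.
      - rewrite Nat.add_succ_r, sum_Sn.
        set (p := sum_n (G := C_AbelianMonoid) term (m + j)) in *.
        replace (plus p (term (S (m + j))) - term m)%C with ((p - term m) + term (S (m + j)))%C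
          by (change (plus p (term (S (m + j))) : C) with (p + term (S (m + j)))%C; ring).
        eapply Rle_trans. apply Cmod_triangle. specialize (Tb (S (m + j))).
        assert (0 < y ^ S (m + j)) by (apply pow_lt; lra).
        replace (y ^ S (S (m + j))) with (y * y ^ S (m + j)) by (simpl; ring).
        assert (M * y ^ S (m + j) <= M * (2 * (y ^ S (m + j) - y * y ^ S (m + j))))
          by (apply Rmult_le_compat_l; nra).
        lra. }
    assert (Tm : Cmod (term m : C) = Cmod (c m) * x ^ m).
    { change (Cmod (RtoC x ^ m * c m)%C = Cmod (c m) * x ^ m).
      rewrite Cmod_mult, Cmod_pow, Cmod_R, Rabs_pos_eq by lra. ring. }
    rewrite <- Tm. apply le_epsilon. intros e He.
    assert (Hs := H x ltac:(unfold x0 in *; lra)).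
    apply is_series_C_spec with (e := e) in Hs; auto. destruct Hs as [N HN].
    specialize (HN (m + N)%nat ltac:(lia)). specialize (Up N). fold term in HN.
    set (p := sum_n (G := C_AbelianMonoid) term (m + N)) in *.
    change (Cmod (p - RtoC 0)%C < e) in HN.
    replace (term m : C) with ((p - RtoC 0) + - (p - term m))%C by ring.
    eapply Rle_trans. apply Cmod_triangle. rewrite Cmod_opp.
    assert (0 < y ^ S (m + N)) by (apply pow_lt; lra).
    assert (0 <= M * y ^ S (m + N)) by (apply Rmult_le_pos; lra). lra. }
  assert (Z : Cmod (c m) <= 0).
  { apply le_epsilon. intros e He.
    set (q := 2 * M / x0 ^ S m + 1).
    assert (Hq : 1 <= q).
    { unfold q. assert (0 <= 2 * M / x0 ^ S m) by (apply Rdiv_le_0_compat; [lra | apply pow_lt; auto]).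
      lra. }
    set (x := Rmin (x0 / 2) (e / q)).
    assert (Hx : 0 < x <= x0 / 2).
    { split; [|apply Rmin_l]. apply Rmin_glb_lt; [lra | apply Rdiv_lt_0_compat; lra]. }
    assert (Hxe : x * q <= e).
    { apply Rle_trans with (e / q * q); [apply Rmult_le_compat_r; [lra | apply Rmin_r] |].
      right. field. lra. }
    assert (B' := B x Hx). assert (Hxm : 0 < x ^ m) by (apply pow_lt; lra).
    apply Rmult_le_reg_r with (x ^ m); auto.
    eapply Rle_trans. apply B'.
    replace (2 * M * (x / x0) ^ S m) with (2 * M / x0 ^ S m * x * x ^ m).
    - apply Rmult_le_compat_r; [lra |]. unfold q in Hxe. lra.
    - unfold Rdiv. rewrite Rpow_mult_distr, pow_inv. simpl. ring. }
  apply Cmod_eq_0. pose proof (Cmod_ge_0 (c m)). lra.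
Qed.

(** Agreement on the right of [s] alone determines every Taylor coefficient, hence forces agreement
    on the left too. This is the local step that pushes an identity leftwards. *)
Lemma analytic_eq_left (f g : C -> C) (s : C) (d : R) : 0 < d ->
  analytic_at f s -> analytic_at g s ->
  (forall x, 0 < x < d -> f (s + RtoC x)%C = g (s + RtoC x)%C) ->
  exists r, 0 < r /\ forall x, Rabs x < r -> f (s + RtoC x)%C = g (s + RtoC x)%C.
Proof.
  intros Hd [ca [ra [Hra Ha]]] [cb [rb [Hrb Hb]]] H.
  assert (E : forall x, (s + RtoC x - s)%C = RtoC x) by (intros; ring).
  assert (Ra : forall x, Rabs x < ra -> Cpseries ca (RtoC x) (f (s + RtoC x)%C)).
  { intros x Hx. specialize (Ha (s + RtoC x)%C). rewrite E, Cmod_R in Ha. auto. }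
  assert (Rb : forall x, Rabs x < rb -> Cpseries cb (RtoC x) (g (s + RtoC x)%C)).
  { intros x Hx. specialize (Hb (s + RtoC x)%C). rewrite E, Cmod_R in Hb. auto. }
  set (r := Rmin ra rb). assert (Hr : 0 < r) by (apply Rmin_glb_lt; auto).
  assert (Hr1 : r <= ra) by apply Rmin_l. assert (Hr2 : r <= rb) by apply Rmin_r.
  assert (Z : forall k, (ca k - cb k)%C = RtoC 0).
  { apply (Cpseries_zero_right (fun k => ca k - cb k)%C (Rmin r d)).
    - apply Rmin_glb_lt; auto.
    - intros x Hx.
      assert (x < r) by (eapply Rlt_le_trans; [apply Hx | apply Rmin_l]).
      assert (x < d) by (eapply Rlt_le_trans; [apply Hx | apply Rmin_r]).
      assert (Hxa : Rabs x < r) by (rewrite Rabs_pos_eq; lra).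
      replace (RtoC 0) with (minus (f (s + RtoC x)%C : C_NormedModule) (g (s + RtoC x)%C)).
      + apply (is_pseries_minus (K := C_AbsRing) (V := C_NormedModule) ca cb);
          [apply Ra | apply Rb]; lra.
      + rewrite H by lra. exact (minus_eq_zero (G := C_AbelianGroup) _). }
  exists r. split; auto. intros x Hx.
  apply (is_series_C_unique (fun k => scal (V := C_NormedModule) (pow_n (K := C_Ring) (RtoC x) k) (ca k))).
  - apply (Ra x). lra.
  - assert (X := Rb x ltac:(lra)). unfold is_pseries in X.
    eapply is_series_ext; [|exact X]. intros k. simpl.
    replace (ca k) with (cb k); auto.
    replace (cb k) with (ca k - (ca k - cb k))%C by ring. rewrite Z. ring.
Qed.

(** A supremum argument: [U] collects the distances by which agreement extends to the left of [b].
    If [x] were never reached, the supremum would be attained and [analytic_eq_left] would exceed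
    it. One horizontal line at a time suffices, so no connectedness argument in the plane is
    involved. *)
Lemma analytic_identity_line (f g : C -> C) (theta b tau : R) :
  (forall x, theta < x -> analytic_at f (x, tau)) ->
  (forall x, theta < x -> analytic_at g (x, tau)) ->
  (forall x, b < x -> f (x, tau) = g (x, tau)) ->
  forall x, theta < x -> f (x, tau) = g (x, tau).
Proof.
  intros Hf Hg Hb x Hx.
  destruct (Rlt_dec b x) as [|Hbx]; auto.
  set (U := fun v => 0 <= v /\ forall y, b - v < y -> f (y, tau) = g (y, tau)).
  assert (U0 : U 0).
  { split; [lra |]. intros y Hy. apply Hb. lra. }
  destruct (Classical_Prop.classic (exists v, U v /\ b - v < x)) as [[v [Hv1 Hv2]] | N].
  { apply Hv1; auto. }
  exfalso.
  assert (Bd : bound U).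
  { exists (b - x). intros v Hv. destruct (Rle_dec v (b - x)); auto.
    exfalso. apply N. exists v. split; auto. lra. }
  destruct (completeness U Bd (ex_intro _ 0 U0)) as [l [L1 L2]].
  assert (Hl0 : 0 <= l) by (apply L1; auto).
  assert (Hlx : l <= b - x).
  { apply L2. intros v Hv. destruct (Rle_dec v (b - x)); auto.
    exfalso. apply N. exists v. split; auto. lra. }
  assert (Ul : forall y, b - l < y -> f (y, tau) = g (y, tau)).
  { intros y Hy. destruct (Classical_Prop.classic (exists v, U v /\ b - v < y)) as [[v [Hv1 Hv2]] | N2].
    - apply Hv1; auto.
    - exfalso. assert (l <= b - y); [|lra]. apply L2. intros v Hv.
      destruct (Rle_dec v (b - y)); auto. exfalso. apply N2. exists v. split; auto. lra. }
  assert (P : forall y, (((b - l)%R, tau) + RtoC y)%C = (b - l + y, tau))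
    by (intros; apply injective_projections; simpl; ring).
  destruct (analytic_eq_left f g (b - l, tau) 1 Rlt_0_1) as [r [Hr Er]].
  - apply Hf. lra.
  - apply Hg. lra.
  - intros y Hy. rewrite P. apply Ul. lra.
  - assert (U (l + r / 2)).
    { split; [lra |]. intros y Hy. destruct (Rlt_dec (b - l) y); auto.
      replace (y, tau) with (((b - l)%R, tau) + RtoC (y - (b - l))%R)%C.
      - apply Er. rewrite Rabs_left1; lra.
      - rewrite P. f_equal. ring. }
    specialize (L1 _ H). lra.
Qed.

(** * The counting function and the zeta function *)

Lemma fold_right_Cplus_perm (l m : list C) : Permutation l m ->
  fold_right Cplus (RtoC 0) l = fold_right Cplus (RtoC 0) m.
Proof.
  induction 1; simpl; auto.
  - rewrite IHPermutation; auto.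
  - rewrite !Cplus_assoc. f_equal. apply Cplus_comm.
  - congruence.
Qed.

Lemma fold_right_Cplus_seq (f : nat -> C) (k : nat) :
  fold_right Cplus (RtoC 0) (map f (seq 0 k)) =
  (rsum (fun j => Re (f j)) k, rsum (fun j => Im (f j)) k).
Proof.
  induction k; auto. rewrite seq_S, map_app, fold_right_app. simpl.
  assert (E : forall (l : list C) z, fold_right Cplus z l = (fold_right Cplus (RtoC 0) l + z)%C).
  { induction l; intros z; simpl; [ring |]. rewrite IHl. ring. }
  rewrite E, IHk. apply injective_projections; unfold Re, Im; simpl; ring.
Qed.

Lemma sum_n_rsum (f : nat -> C) (k : nat) : sum_n (G := C_AbelianMonoid) f k =
  (rsum (fun j => Re (f j)) (S k), rsum (fun j => Im (f j)) (S k)).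
Proof.
  induction k.
  - rewrite sum_O. apply injective_projections; unfold Re, Im; simpl; ring.
  - rewrite sum_Sn, IHk. auto.
Qed.

Section Counting.

Variable n : nat -> R.
Hypothesis n_nondecr : forall j, n j <= n (S j).
Hypothesis n_finite : forall x, exists l, enumerates_le n x l.

Lemma nondecr_le (i j : nat) : (i <= j)%nat -> n i <= n j.
Proof. induction 1; [lra | eapply Rle_trans; eauto]. Qed.

(** The list chosen by [epsilon] has no specified order. By monotonicity each index brings all
    smaller ones with it, so an index in the list is below its length, and the list is an initial
    segment up to order. *)
Lemma indices_le_perm (x : R) : Permutation (indices_le n x) (seq 0 (counting n x)).
Proof.
  assert (H : enumerates_le n x (indices_le n x)) 
    by exact (epsilon_spec (inhabits nil) (enumerates_le n x) (n_finite x)).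
  unfold counting. set (l := indices_le n x) in *. destruct H as [ND H].
  assert (I : incl l (seq 0 (length l))).
  { intros j Hj. apply in_seq. split; [lia |]. simpl.
    assert (L : (length (seq 0 (S j)) <= length l)%nat).
    { apply NoDup_incl_length; [apply seq_NoDup |]. intros i Hi. apply in_seq in Hi.
      apply H. apply Rle_trans with (n j); [apply nondecr_le; lia | apply H; auto]. }
    rewrite length_seq in L. lia. }
  apply NoDup_Permutation; auto using seq_NoDup.
  intros j. split; [apply I |].
  apply (NoDup_length_incl ND); auto. rewrite length_seq. auto.
Qed.

Lemma counting_spec (j : nat) (x : R) : (j < counting n x)%nat <-> n j <= x.
Proof.
  assert (H : enumerates_le n x (indices_le n x)) 
    by exact (epsilon_spec (inhabits nil) (enumerates_le n x) (n_finite x)).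
  rewrite <- (proj2 H j). assert (P := indices_le_perm x). split; intros Hj.
  - apply Permutation_in with (1 := Permutation_sym P). apply in_seq. lia.
  - apply Permutation_in with (1 := P) in Hj. apply in_seq in Hj. lia.
Qed.

Lemma sum_le_rsum (x : R) (f : R -> C) : sum_le n x f =
  (rsum (fun j => Re (f (n j))) (counting n x), rsum (fun j => Im (f (n j))) (counting n x)).
Proof.
  unfold sum_le.
  rewrite (fold_right_Cplus_perm _ _ (Permutation_map (fun j => f (n j)) (indices_le_perm x))).
  apply fold_right_Cplus_seq.
Qed.

End Counting.

(** * Passage from [x] to [ln x] *)

Lemma Rcpow_Cexp_ray (x : R) (s : C) : Rcpow x (- s)%C = Cexp_ray s (ln x).
Proof. unfold Rcpow, Cexp_ray. f_equal. ring. Qed.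

Lemma Cexp_ray_imag (t u : R) : Cexp_ray (Ci * RtoC t)%C u = (phase t 0 u, phase t (PI / 2) u).
Proof.
  unfold Cexp_ray, Cexp, phase. rewrite Rplus_0_r, cos_plus, cos_PI2, sin_PI2.
  unfold Re, Im; simpl.
  replace (u * - (0 * t - 1 * 0) - 0 * - (0 * 0 + 1 * t)) with 0 by ring.
  replace (u * - (0 * 0 + 1 * t) + 0 * - (0 * t - 1 * 0)) with (- (t * u)) by ring.
  rewrite exp_0, cos_neg, sin_neg. apply injective_projections; simpl; ring.
Qed.

Lemma is_RInt_phase_ln (A t phi x y : R) : 0 < x <= y ->
  is_RInt (fun u => A * phase t phi (ln u)) x y
    (A * (wint (phase t phi) (ln y) - wint (phase t phi) (ln x))).
Proof.
  intros Hxy. rewrite Rmult_minus_distr_l.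
  apply (is_RInt_derive (V := R_CompleteNormedModule) (fun u => A * wint (phase t phi) (ln u))
    (fun u => A * phase t phi (ln u))); rewrite Rmin_left, Rmax_right by lra; intros u Hu.
  - apply is_derive_Rmult.
    replace (phase t phi (ln u)) with (/ u * (exp (ln u) * phase t phi (ln u)))
      by (rewrite exp_ln by lra; field; lra).
    apply (is_derive_comp (K := R_AbsRing) (V := R_NormedModule) (wint (phase t phi)) ln).
    + apply wint_derive, continuous_phase.
    + auto_derive; [lra | field; lra].
  - apply (ex_derive_continuous (K := R_AbsRing) (V := R_NormedModule)).
    unfold phase. auto_derive. lra.
Qed.

Lemma LH_integral (A t x y : R) : 0 < x <= y ->
  RInt (V := C_R_CompleteNormedModule)
    (fun u => (RtoC A * Rcpow u (- (Ci * RtoC t)))%C) x y =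
  (A * (wint (phase t 0) (ln y) - wint (phase t 0) (ln x)),
   A * (wint (phase t (PI / 2)) (ln y) - wint (phase t (PI / 2)) (ln x))).
Proof.
  intros Hxy. apply (is_RInt_unique (V := C_R_CompleteNormedModule)).
  apply (is_RInt_fct_extend_pair (U := R_NormedModule) (V := R_NormedModule)
    (fun u => (RtoC A * Rcpow u (- (Ci * RtoC t)))%C)).
  - apply is_RInt_ext with (fun u => A * phase t 0 (ln u)); [|apply is_RInt_phase_ln; auto].
    intros u _. rewrite Rcpow_Cexp_ray, Cexp_ray_imag. simpl. eqR. ring.
  - apply is_RInt_ext with (fun u => A * phase t (PI / 2) (ln u)); [|apply is_RInt_phase_ln; auto].
    intros u _. rewrite Rcpow_Cexp_ray, Cexp_ray_imag. simpl. eqR. ring.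
Qed.

(** The elementary integral of [exp ((1 - s) r)] over [[0, Y]]. Its constant part is the polar term;
    the other part tends to [0] when [Re s > 1]. *)
Lemma wint_Cexp_ray (s : C) (Y : R) : s <> RtoC 1 ->
  (wint (fun u => Re (Cexp_ray s u)) Y, wint (fun u => Im (Cexp_ray s u)) Y) =
  (RtoC 1 / (s - RtoC 1) - RtoC 1 / (s - RtoC 1) * Cexp (RtoC Y * (RtoC 1 - s)))%C.
Proof.
  intros Hs. set (w := (RtoC 1 - s)%C).
  assert (Hw : w <> RtoC 0).
  { intros E. apply Hs. replace s with (RtoC 1 - w)%C by (unfold w; ring). rewrite E. ring. }
  assert (Hw' : (s - RtoC 1 <> RtoC 0)%C).
  { replace (s - RtoC 1)%C with (- w)%C by (unfold w; ring). intros E. apply Hw.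
    replace w with (- - w)%C by ring. rewrite E. ring. }
  set (F := fun u => (/ w * Cexp (RtoC u * w))%C).
  assert (E : forall u, (/ w * (w * Cexp (RtoC u * w)))%C = (RtoC (exp u) * Cexp_ray s u)%C).
  { intros u. rewrite Cmult_assoc, Cinv_l, Cmult_1_l by auto.
    replace (RtoC u * w)%C with (RtoC u + RtoC u * - s)%C by (unfold w; ring).
    rewrite Cexp_plus. unfold Cexp_ray. f_equal. unfold Cexp, Re, Im; simpl.
    rewrite cos_0, sin_0. apply injective_projections; simpl; ring. }
  assert (D : forall u, is_Cderive F u (RtoC (exp u) * Cexp_ray s u)%C).
  { intros u. rewrite <- E. apply is_Cderive_scal, is_Cderive_Cexp_ray. }
  destruct (Ccontinuous_Cexp_ray s) as [C1 C2].
  assert (E1 : wint (fun u => Re (Cexp_ray s u)) Y = Re (F Y) - Re (F 0)).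
  { apply (RInt_antiderivative (fun u => Re (F u))); [|apply continuous_exp_mult; auto].
    intros u. replace (exp u * Re (Cexp_ray s u)) with (Re (RtoC (exp u) * Cexp_ray s u)%C)
      by (unfold Re; simpl; ring). apply D. }
  assert (E2 : wint (fun u => Im (Cexp_ray s u)) Y = Im (F Y) - Im (F 0)).
  { apply (RInt_antiderivative (fun u => Im (F u))); [|apply continuous_exp_mult; auto].
    intros u. replace (exp u * Im (Cexp_ray s u)) with (Im (RtoC (exp u) * Cexp_ray s u)%C)
      by (unfold Im; simpl; ring). apply D. }
  rewrite E1, E2. transitivity (F Y - F 0)%C; [auto |].
  match goal with |- @eq _ ?x ?y => change (@eq C x y) end.
  unfold F. replace (RtoC 0 * w)%C with (RtoC 0) by ring.
  replace (Cexp (RtoC 0)) with (RtoC 1).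
  - replace (/ w)%C with (- (/ (s - RtoC 1)))%C; [unfold Cdiv; ring |].
    unfold w in *. field. split; auto.
  - unfold Cexp, Re, Im; simpl. rewrite exp_0, cos_0, sin_0.
    apply injective_projections; simpl; ring.
Qed.

(** * The continuation of zeta attached to the sequence *)

Section Continuation.

Variables (n : nat -> R) (A theta : R).
Hypothesis n_pos : forall j, 0 < n j.
Hypothesis n_nondecr : forall j, n j <= n (S j).
Hypothesis A_pos : 0 < A.
Hypothesis theta_range : 0 <= theta < 1 / 2.
Hypothesis n_count : counting_asymptotic n A theta.

Definition log_seq (j : nat) : R := ln (n j).
Definition log_count (u : R) : nat := counting n (exp u).
(** The unit of margin keeps [y - 1] in range for every [y >= log_seq 0]. *)
Definition base : R := Rmin (log_seq 0) 0 - 1.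
Definition log_error (c : R -> R) (u : R) : R := werror log_seq log_count A c u.
Definition zeta_regular (s : C) : C := regular_part log_seq log_count A base s.

Lemma log_count_spec (j : nat) (u : R) : (j < log_count u)%nat <-> log_seq j <= u.
Proof.
  unfold log_count, log_seq. rewrite (counting_spec n n_nondecr (proj1 n_count)). split; intros H.
  - rewrite <- (ln_exp u). apply ln_le; auto.
  - rewrite <- (exp_ln (n j)) by auto. apply exp_le_compat; auto.
Qed.

Lemma log_seq_le (i j : nat) : (i <= j)%nat -> log_seq i <= log_seq j.
Proof. intros H. apply ln_le; auto. apply nondecr_le; auto. Qed.

Lemma base_neg : base <= -1.
Proof. unfold base. pose proof (Rmin_r (log_seq 0) 0). lra. Qed.

Lemma base_le_log_seq (j : nat) : base + 1 <= log_seq j.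
Proof.
  unfold base. pose proof (Rmin_l (log_seq 0) 0). pose proof (log_seq_le 0 j ltac:(lia)). lra.
Qed.

(** Extends the asymptotics, given for large [x] only, down to [base] by enlarging the constant, and
    allows the exponent to be raised; the converse direction uses this to have a positive
    exponent. *)
Lemma log_count_asym (theta' : R) : theta <= theta' -> exists K, 0 <= K /\
  forall u, base <= u ->
    Rabs (INR (log_count u) - A * (exp (Rmax u 0) - 1)) <= K * exp (theta' * u).
Proof.
  intros Hth. destruct n_count as [Hfin [K0 [x0 [Hx0 H]]]].
  set (N0 := INR (counting n x0)). assert (HN0 : 0 <= N0) by apply pos_INR.
  (* [A] bounds the gap between [A * x] and the shifted main term; [N0] and [A * (x0 + 1)] bound the
     counting function and the main term below [x0]. *)
  set (D := A + N0 + A * (x0 + 1)).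
  assert (HD : 0 <= D) by (unfold D; nra).
  exists (Rabs K0 * exp ((theta - theta') * base) + D * exp (- theta' * base)). split.
  { apply Rplus_le_le_0_compat; apply Rmult_le_pos; auto using Rabs_pos; left; apply exp_pos. }
  intros u Hu.
  assert (E1 : Rabs K0 * exp (theta * u) <= Rabs K0 * exp ((theta - theta') * base) * exp (theta' * u)).
  { rewrite Rmult_assoc, <- exp_plus. apply Rmult_le_compat_l; [apply Rabs_pos |].
    apply exp_le_compat. nra. }
  assert (E2 : D <= D * exp (- theta' * base) * exp (theta' * u)).
  { rewrite Rmult_assoc, <- exp_plus. rewrite <- (Rmult_1_r D) at 1. apply Rmult_le_compat_l; auto.
    rewrite <- exp_0. apply exp_le_compat. nra. }
  rewrite Rmult_plus_distr_r.
  apply Rle_trans with (Rabs K0 * exp (theta * u) + D); [|lra].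
  assert (Hexp : 0 < exp u) by apply exp_pos.
  unfold log_count. destruct (Rle_dec x0 (exp u)) as [Hx | Hx].
  - assert (X := H (exp u) Hx). unfold Rpower in X. rewrite ln_exp in X.
    assert (K0 * exp (theta * u) <= Rabs K0 * exp (theta * u))
      by (apply Rmult_le_compat_r; [left; apply exp_pos | apply Rle_abs]).
    assert (Y : Rabs (A * exp u - A * (exp (Rmax u 0) - 1)) <= A).
    { unfold Rmax. destruct Rle_dec as [Hu0 | Hu0].
      - rewrite exp_0. replace (A * exp u - A * (1 - 1)) with (A * exp u) by ring.
        rewrite Rabs_pos_eq by nra.
        assert (exp u <= 1) by (rewrite <- exp_0; apply exp_le_compat; auto). nra.
      - replace (A * exp u - A * (exp u - 1)) with A by ring. rewrite Rabs_pos_eq; lra. }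
    assert (0 <= A * (x0 + 1)) by nra.
    apply Rabs_le_between in X, Y. apply Rabs_le_between. unfold D. lra.
  - assert (C1 : INR (counting n (exp u)) <= N0).
    { apply le_INR. destruct (Nat.le_gt_cases (counting n (exp u)) (counting n x0)) as [|L]; auto.
      apply (counting_spec n n_nondecr Hfin) in L.
      assert (L' : n (counting n x0) <= x0) by lra.
      apply (counting_spec n n_nondecr Hfin) in L'. lia. }
    pose proof (pos_INR (counting n (exp u))).
    assert (1 <= exp (Rmax u 0) <= x0 + 1).
    { unfold Rmax. destruct Rle_dec; [rewrite exp_0; lra |].
      pose proof (exp_ineq1_le u). lra. }
    assert (0 <= A * (exp (Rmax u 0) - 1) <= A * (x0 + 1)) by nra.
    assert (0 <= Rabs K0 * exp (theta * u))
      by (apply Rmult_le_pos; [apply Rabs_pos | left; apply exp_pos]).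
    apply Rabs_le. unfold D. lra.
Qed.

Lemma log_seq_unbounded (Y : R) : exists N, forall k, (N <= k)%nat -> Y < log_seq k.
Proof.
  exists (log_count Y). intros k Hk. destruct (Rlt_dec Y (log_seq k)) as [|H]; auto.
  assert (L : (k < log_count Y)%nat) by (apply log_count_spec; lra). lia.
Qed.

Lemma zeta_regular_analytic (s : C) : theta < Re s -> analytic_at zeta_regular s.
Proof.
  destruct (log_count_asym theta (Rle_refl _)) as [K [HK HA]].
  apply (regular_part_analytic log_seq log_count A K theta base);
    auto using log_count_spec, base_neg, base_le_log_seq.
Qed.

Lemma Re_ne_one (s : C) : Re s <> 1 -> s <> RtoC 1.
Proof. intros H E. apply H. rewrite E. auto. Qed.

(** The series is cut by index and the error term by size. They differ by the later terms equal in
    value to [n k], since the sequence may repeat values; for [Re s > 1] the bound tends to [0]. *)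
Lemma rsum_le_end (f : nat -> R) (s : C) (k : nat) : 0 <= Re s ->
  (forall j, Rabs (f j) <= exp (- Re s * log_seq j)) ->
  Rabs (rsum f (log_count (log_seq k)) - rsum f (S k)) <=
    exp (- Re s * log_seq k) * INR (log_count (log_seq k)).
Proof.
  intros Hs Hf.
  assert (Hk : (S k <= log_count (log_seq k))%nat) by (apply log_count_spec; lra).
  eapply Rle_trans.
  - apply (rsum_diff_le f (exp (- Re s * log_seq k)) _ _ Hk).
    intros j Hj. eapply Rle_trans; [apply Hf |]. apply exp_le_compat.
    pose proof (log_seq_le k j ltac:(lia)). nra.
  - apply Rmult_le_compat_l; [left; apply exp_pos |]. pose proof (pos_INR (S k)). lra.
Qed.

Lemma dirichlet_series (s : C) : 1 < Re s ->
  is_series (K := C_AbsRing) (V := C_NormedModule) (fun j => Rcpow (n j) (- s)%C)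
    (RtoC A / (s - RtoC 1) + zeta_regular s)%C.
Proof.
  intros Hs. set (sig := Re s) in *.
  destruct (log_count_asym theta (Rle_refl _)) as [K [HK HA]].
  assert (Hs1 : s <> RtoC 1) by (apply Re_ne_one; fold sig; lra).
  set (w := (RtoC 1 / (s - RtoC 1))%C).
  set (C1 := K * (1 + Cmod s / (sig - theta))).
  apply is_series_C_spec. intros e He.
  (* Four errors of [e / 8] per component: the distance to the regular part, the decaying part of
     the integral, and the two parts of the bound for repeated values. *)
  destruct (exp_decay_lt C1 (sig - theta) (e / 8) ltac:(lra) ltac:(lra)) as [Y1 [P1 D1]].
  destruct (exp_decay_lt (A * Cmod w) (sig - 1) (e / 8) ltac:(lra) ltac:(lra)) as [Y2 [P2 D2]].
  destruct (exp_decay_lt A (sig - 1) (e / 8) ltac:(lra) ltac:(lra)) as [Y3 [P3 D3]].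
  destruct (exp_decay_lt K (sig - theta) (e / 8) ltac:(lra) ltac:(lra)) as [Y4 [P4 D4]].
  destruct (log_seq_unbounded (Y1 + Y2 + Y3 + Y4)) as [N HN].
  exists N. intros k Hk. specialize (HN k Hk). set (Y := log_seq k) in *.
  specialize (D1 Y ltac:(lra)). specialize (D2 Y ltac:(lra)).
  specialize (D3 Y ltac:(lra)). specialize (D4 Y ltac:(lra)).
  destruct (werror_regular_part log_seq log_count A K theta base log_count_spec HK base_neg
    base_le_log_seq HA s Y ltac:(fold sig; lra) ltac:(lra)) as [R1 R2].
  fold sig in R1, R2. fold C1 in R1, R2.
  assert (W := wint_Cexp_ray s Y Hs1). fold w in W.
  assert (Wb : Cmod (w * Cexp (RtoC Y * (RtoC 1 - s)))%C = Cmod w * exp (- (sig - 1) * Y)).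
  { rewrite Cmod_mult, Cmod_Cexp. f_equal. f_equal. unfold sig, Re; simpl. ring. }
  set (v := (w * Cexp (RtoC Y * (RtoC 1 - s)))%C) in *.
  unfold werror in R1, R2. rewrite Rmax_left in R1, R2 by lra.
  assert (W1 : wint (fun u => Re (Cexp_ray s u)) Y = Re (w - v)%C) by exact (f_equal Re W).
  assert (W2 : wint (fun u => Im (Cexp_ray s u)) Y = Im (w - v)%C) by exact (f_equal Im W).
  rewrite W1 in R1. rewrite W2 in R2.
  assert (Cnt : exp (- sig * Y) * INR (log_count Y) <= A * exp (- (sig - 1) * Y)
     + K * exp (- (sig - theta) * Y)).
  { assert (Q := HA Y ltac:(pose proof base_neg; lra)). rewrite Rmax_left in Q by lra.
    apply Rabs_le_between in Q.
    replace (A * exp (- (sig - 1) * Y) + K * exp (- (sig - theta) * Y)) with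
      (exp (- sig * Y) * (A * exp Y + K * exp (theta * Y))).
    - apply Rmult_le_compat_l; [left; apply exp_pos | lra].
    - replace (exp (- (sig - 1) * Y)) with (exp (- sig * Y) * exp Y)
        by (rewrite <- exp_plus; f_equal; ring).
      replace (exp (- (sig - theta) * Y)) with (exp (- sig * Y) * exp (theta * Y))
        by (rewrite <- exp_plus; f_equal; ring). ring. }
  assert (T1 := rsum_le_end (fun j => Re (Cexp_ray s (log_seq j))) s k ltac:(fold sig; lra)
    ltac:(intros; rewrite <- Cmod_Cexp_ray; apply Rabs_Re_le)).
  assert (T2 := rsum_le_end (fun j => Im (Cexp_ray s (log_seq j))) s k ltac:(fold sig; lra)
    ltac:(intros; rewrite <- Cmod_Cexp_ray; apply Rabs_Im_le)).
  fold sig Y in T1, T2.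
  rewrite sum_n_rsum.
  assert (Ex : forall g : C -> R, rsum (fun j => g (Rcpow (n j) (- s)%C)) (S k)
     = rsum (fun j => g (Cexp_ray s (log_seq j))) (S k))
    by (intros; apply rsum_ext; intros; rewrite Rcpow_Cexp_ray; auto).
  rewrite (Ex Re), (Ex Im).
  replace (RtoC A / (s - RtoC 1))%C with (RtoC A * w)%C by (unfold w, Cdiv; ring).
  pose proof (Rabs_Re_le v) as V1. pose proof (Rabs_Im_le v) as V2. rewrite Wb in V1, V2.
  assert (Re (w - v)%C = Re w - Re v) as X1 by auto.
  assert (Im (w - v)%C = Im w - Im v) as X2 by auto.
  rewrite X1 in R1. rewrite X2 in R2.
  set (s1 := rsum (fun j => Re (Cexp_ray s (log_seq j))) (S k)) in *.
  set (s2 := rsum (fun j => Im (Cexp_ray s (log_seq j))) (S k)) in *.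
  fold (zeta_regular s) in R1, R2.
  eapply Rle_lt_trans. apply Cmod_le_Rabs.
  replace (Re ((s1, s2) - (RtoC A * w + zeta_regular s))%C) with (s1 - (A * Re w + Re (zeta_regular s)))
    by (unfold Re; simpl; ring).
  replace (Im ((s1, s2) - (RtoC A * w + zeta_regular s))%C) with (s2 - (A * Im w + Im (zeta_regular s)))
    by (unfold Im; simpl; ring).
  assert (AV : forall z, Rabs z <= Cmod w * exp (- (sig - 1) * Y) -> - (e / 8) < A * z < e / 8).
  { intros z Hz. apply Rabs_le_between in Hz.
    assert (A * z <= A * (Cmod w * exp (- (sig - 1) * Y))) by (apply Rmult_le_compat_l; lra).
    assert (A * - (Cmod w * exp (- (sig - 1) * Y)) <= A * z) by (apply Rmult_le_compat_l; lra).
    lra. }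
  apply AV in V1, V2. apply Rabs_le_between in R1, R2, T1, T2.
  assert (Rabs (s1 - (A * Re w + Re (zeta_regular s))) < e / 2) by (apply Rabs_def1; lra).
  assert (Rabs (s2 - (A * Im w + Im (zeta_regular s))) < e / 2) by (apply Rabs_def1; lra).
  lra.
Qed.

Lemma is_zeta_continuation :
  is_zeta n A theta (fun s => RtoC A / (s - RtoC 1) + zeta_regular s)%C.
Proof.
  split; [apply dirichlet_series |].
  exists zeta_regular. split; [apply zeta_regular_analytic |]. intros s _ _. ring.
Qed.

(** For [Re s > 1] both analytic parts are the Dirichlet series minus the polar term, and the
    identity theorem carries this to [1/2]. As the pole is subtracted beforehand, the line [tau = 0]
    through [s = 1] needs no separate treatment. *)
Lemma zeta_critical_line (zeta : C -> C) (tau : R) : is_zeta n A theta zeta ->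
  zeta (1 / 2, tau) = (RtoC A / (((1 / 2)%R, tau) - RtoC 1) + zeta_regular ((1 / 2)%R, tau))%C.
Proof.
  intros [Hser [G [HG HGz]]].
  assert (E : G (1 / 2, tau) = zeta_regular (1 / 2, tau)).
  { apply (analytic_identity_line G zeta_regular theta 1 tau); try lra.
    - intros x Hx. apply HG. auto.
    - intros x Hx. apply zeta_regular_analytic. auto.
    - intros x Hx. rewrite <- HGz; [|simpl; lra | apply Re_ne_one; simpl; lra].
      rewrite (is_series_C_unique _ _ _ (Hser (x, tau) Hx) (dirichlet_series (x, tau) Hx)). ring. }
  rewrite <- E, <- HGz; [ring | simpl; lra | apply Re_ne_one; simpl; lra].
Qed.

(** * The two implications for the sequence *)

Definition boundary_const : R := A * exp (Rabs (log_seq 0)).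

(** The integral in [LH] starts at [n_1], that of [werror] at [1] and only for [y >= 0]. The
    discrepancy lies between [1] and [n_1], or below [1], and [exp (Rabs (log_seq 0))] is the larger
    of [n_1] and [1 / n_1]. *)
Lemma wint_boundary (c : R -> R) (y : R) : (forall u, continuous c u) ->
  (forall u, Rabs (c u) <= 1) -> log_seq 0 <= y ->
  Rabs (A * wint c (Rmax y 0) - A * (wint c y - wint c (log_seq 0))) <= boundary_const.
Proof.
  intros Hc Hb Hy. unfold boundary_const. set (l := log_seq 0) in *.
  rewrite <- Rmult_minus_distr_l, Rabs_mult, (Rabs_pos_eq A) by lra.
  apply Rmult_le_compat_l; [lra |].
  assert (E0 : 1 <= exp (Rabs l)).
  { rewrite <- exp_0. apply exp_le_compat, Rabs_pos. }
  destruct (Rle_dec 0 y) as [H0 | H0].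
  - rewrite Rmax_left by lra.
    replace (wint c y - (wint c y - wint c l)) with (wint c l - wint c 0)
      by (rewrite wint_zero; ring).
    destruct (Rle_dec 0 l).
    + eapply Rle_trans. apply wint_diff; auto. rewrite exp_0, (Rabs_pos_eq l); lra.
    + rewrite Rabs_minus_sym. eapply Rle_trans. apply wint_diff; auto; lra.
      rewrite exp_0. pose proof (exp_pos l). lra.
  - rewrite Rmax_right by lra. rewrite wint_zero.
    replace (0 - (wint c y - wint c l)) with (- (wint c y - wint c l)) by ring.
    rewrite Rabs_Ropp. eapply Rle_trans. apply wint_diff; auto.
    assert (exp y <= 1) by (rewrite <- exp_0; apply exp_le_compat; lra).
    pose proof (exp_pos l). lra.
Qed.

Definition LH_error (t x : R) : C :=
  (sum_le n x (fun u => Rcpow u (- (Ci * RtoC t))%C)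
   - RInt (V := C_R_CompleteNormedModule)
       (fun u => (RtoC A * Rcpow u (- (Ci * RtoC t)))%C) (n 0%nat) x)%C.

Lemma LH_error_log (t x : R) : n 0%nat <= x ->
  Rabs (Re (LH_error t x) - log_error (phase t 0) (ln x)) <= boundary_const /\
  Rabs (Im (LH_error t x) - log_error (phase t (PI / 2)) (ln x)) <= boundary_const.
Proof.
  intros Hx. assert (Hx0 : 0 < x) by (eapply Rlt_le_trans; [apply (n_pos 0) | auto]).
  unfold LH_error. rewrite (sum_le_rsum n n_nondecr (proj1 n_count)), LH_integral
    by (split; auto).
  assert (Ex : forall g : C -> R,
    rsum (fun j => g (Rcpow (n j) (- (Ci * RtoC t))%C)) (counting n x)
    = rsum (fun j => g (phase t 0 (log_seq j), phase t (PI / 2) (log_seq j))) (counting n x))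
    by (intros; apply rsum_ext; intros; rewrite Rcpow_Cexp_ray, Cexp_ray_imag; auto).
  rewrite (Ex Re), (Ex Im). unfold log_error, werror, log_count. rewrite exp_ln by auto.
  assert (Hl : log_seq 0 <= ln x) by (apply ln_le; auto).
  split.
  - assert (B := wint_boundary (phase t 0) (ln x) (continuous_phase t 0) (Rabs_phase_le t 0) Hl).
    unfold Re. simpl fst.
    match goal with |- Rabs ?z <= _ => match type of B with Rabs ?z' <= _ =>
      replace z with z' by (unfold log_seq; ring) end end. exact B.
  - assert (B := wint_boundary (phase t (PI / 2)) (ln x) (continuous_phase t (PI / 2))
      (Rabs_phase_le t (PI / 2)) Hl).
    unfold Im. simpl snd.
    match goal with |- Rabs ?z <= _ => match type of B with Rabs ?z' <= _ =>
      replace z with z' by (unfold log_seq; ring) end end. exact B.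
Qed.

Lemma boundary_const_pos : 0 <= boundary_const.
Proof. apply Rmult_le_pos; [lra | left; apply exp_pos]. Qed.

Lemma polar_term_le (tau : R) : Cmod (RtoC A / (((1 / 2)%R, tau) - RtoC 1))%C <= 2 * A.
Proof.
  assert (Hne : (((1 / 2)%R, tau) - RtoC 1)%C <> RtoC 0).
  { intros E. apply (f_equal Re) in E. unfold Re in E; simpl in E. lra. }
  rewrite Cmod_div by auto. rewrite Cmod_R, Rabs_pos_eq by lra.
  pose proof (Rabs_Re_le (((1 / 2)%R, tau) - RtoC 1)%C) as H.
  replace (Re (((1 / 2)%R, tau) - RtoC 1)%C) with (- (1 / 2)) in H by (unfold Re; simpl; field).
  rewrite Rabs_Ropp, Rabs_pos_eq in H by lra.
  set (m := Cmod (((1 / 2)%R, tau) - RtoC 1)%C) in *.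
  apply Rmult_le_reg_r with m; [lra |]. replace (A / m * m) with A by (field; lra). nra.
Qed.

Lemma LH_implies_lindelof (zeta : C -> C) : is_zeta n A theta zeta ->
  LH n A -> lindelof_bound zeta.
Proof.
  intros Hz HL eps Heps.
  destruct (log_count_asym theta (Rle_refl _)) as [K [HK HA]].
  destruct (regular_part_lindelof log_seq log_count A K theta base log_count_spec HK
    ltac:(lra) base_neg base_le_log_seq HA ltac:(lra)) with (eps := eps) as [C0 HC0]; auto.
  - clear eps Heps. intros eps B Heps HB.
    destruct (HL eps B Heps HB) as [K1 HK1].
    (* [q] serves [base <= u < log_seq 0], that is [x < n_1], a range outside [LH]; the trivial
       bound is of size [exp (u / 2)] there because [u] is bounded above. *)
    set (q := exp (- base) * (2 * A * exp (Rabs (log_seq 0)) + 2 * K)).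
    assert (Hq : 0 <= q).
    { apply Rmult_le_pos; [left; apply exp_pos |]. pose proof (exp_pos (Rabs (log_seq 0))). nra. }
    exists (Rabs K1 * sqrt A + boundary_const * exp (- base / 2) + q).
    intros t phi u Ht Hphi Hu.
    assert (HP : 1 <= Rpower (Rabs t) eps) by (apply Rpower_ge_1; lra).
    assert (Hbc := boundary_const_pos).
    assert (HKA : 0 <= Rabs K1 * sqrt A) by (apply Rmult_le_pos; [apply Rabs_pos | apply sqrt_pos]).
    assert (Hbe : boundary_const <= boundary_const * exp (- base / 2) * exp (u / 2)).
    { rewrite Rmult_assoc, <- exp_plus. rewrite <- (Rmult_1_r boundary_const) at 1.
      apply Rmult_le_compat_l; auto. rewrite <- exp_0. apply exp_le_compat. lra. }
    assert (Hbe0 : 0 <= boundary_const * exp (- base / 2))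
      by (apply Rmult_le_pos; auto; left; apply exp_pos).
    pose proof (exp_pos (u / 2)) as Hu2.
    destruct (Rle_dec (log_seq 0) u) as [Hl | Hl].
    + assert (Hn0 : n 0%nat <= exp u).
      { rewrite <- (exp_ln (n 0%nat)) by auto. apply exp_le_compat. auto. }
      assert (HB2 : exp u <= Rpower (Rabs t) B).
      { unfold Rpower. apply exp_le_compat. lra. }
      assert (Ht0 : t <> 0) by (intros ->; rewrite Rabs_R0 in Ht; lra).
      assert (Z := HK1 t (exp u) Ht0 (conj Hn0 HB2)).
      fold (LH_error t (exp u)) in Z.
      destruct (LH_error_log t (exp u) Hn0) as [E1 E2]. rewrite ln_exp in E1, E2.
      assert (Z2 : Cmod (LH_error t (exp u)) <= Rabs K1 * sqrt A * exp (u / 2) * Rpower (Rabs t) eps).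
      { eapply Rle_trans. apply Z.
        replace (sqrt (A * exp u)) with (sqrt A * exp (u / 2)).
        - rewrite <- !Rmult_assoc. apply Rmult_le_compat_r; [lra |].
          apply Rmult_le_compat_r; [lra |].
          apply Rmult_le_compat_r; [apply sqrt_pos | apply Rle_abs].
        - rewrite sqrt_mult by (try lra; left; apply exp_pos). f_equal.
          symmetry. apply sqrt_lem_1; [left; apply exp_pos | lra |].
          rewrite <- exp_plus. f_equal. field. }
      assert (Fin : forall r, Rabs r <= Rabs K1 * sqrt A * exp (u / 2) * Rpower (Rabs t) eps
          + boundary_const ->
        Rabs r <= (Rabs K1 * sqrt A + boundary_const * exp (- base / 2) + q)
          * Rpower (Rabs t) eps * exp (u / 2)).
      { intros r Hr.
        assert (boundary_const * exp (- base / 2) * exp (u / 2) * 1 <=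
          boundary_const * exp (- base / 2) * exp (u / 2) * Rpower (Rabs t) eps)
          by (apply Rmult_le_compat_l; [apply Rmult_le_pos |]; lra).
        assert (0 <= q * Rpower (Rabs t) eps * exp (u / 2))
          by (apply Rmult_le_pos; [apply Rmult_le_pos |]; lra).
        lra. }
      apply Fin. fold (log_error (phase t phi) u).
      pose proof (Rabs_Re_le (LH_error t (exp u))) as F1.
      pose proof (Rabs_Im_le (LH_error t (exp u))) as F2.
      apply Rabs_le_between in E1, E2, F1, F2.
      destruct Hphi as [-> | ->]; apply Rabs_le; lra.
    + assert (W := werror_trivial log_seq log_count A K theta base log_count_spec A_pos HK
        ltac:(lra) base_neg base_le_log_seq HA (phase t phi) u ltac:(lra)
        (continuous_phase t phi) (Rabs_phase_le t phi) ltac:(lra)).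
      eapply Rle_trans. apply W.
      apply Rle_trans with (q * exp (u / 2)).
      * unfold q. rewrite (Rmult_assoc (exp (- base))). apply Rmult_le_compat_l; [left; apply exp_pos |].
        replace (exp u) with (exp (u / 2) * exp (u / 2)) by (rewrite <- exp_plus; f_equal; field).
        assert (exp (u / 2) <= exp (Rabs (log_seq 0))).
        { apply exp_le_compat. pose proof (Rle_abs (log_seq 0)). pose proof (Rabs_pos (log_seq 0)). lra. }
        assert (A * exp (u / 2) * exp (u / 2) <= A * exp (u / 2) * exp (Rabs (log_seq 0)))
          by (apply Rmult_le_compat_l; [nra | auto]).
        lra.
      * apply Rmult_le_compat_r; [lra |].
        assert (q * 1 <= q * Rpower (Rabs t) eps) by (apply Rmult_le_compat_l; lra).
        assert (0 <= (Rabs K1 * sqrt A + boundary_const * exp (- base / 2)) * Rpower (Rabs t) eps)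
          by (apply Rmult_le_pos; lra).
        lra.
  - exists (C0 + 2 * A), 1. split; [lra |]. intros tau Htau.
    rewrite (zeta_critical_line zeta tau Hz).
    eapply Rle_trans. apply Cmod_triangle.
    pose proof (polar_term_le tau). specialize (HC0 tau Htau). fold (zeta_regular (1 / 2, tau)) in HC0.
    assert (1 <= Rpower (Rabs tau) eps) by (apply Rpower_ge_1; lra). nra.
Qed.

(** The averaging uses all frequencies up to [V], small ones included. Below the threshold [T] the
    Lindelof bound is replaced by the linear bound, and [1 + |tau|] keeps the power at least [1]. *)
Lemma zeta_regular_lindelof (zeta : C -> C) : is_zeta n A theta zeta -> lindelof_bound zeta ->
  forall eps, 0 < eps -> exists C0, forall tau,
    Cmod (zeta_regular (1 / 2, tau)) <= C0 * Rpower (1 + Rabs tau) eps.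
Proof.
  intros Hz HL eps Heps. destruct (HL eps Heps) as [K1 [T [HT HK1]]].
  destruct (log_count_asym theta (Rle_refl _)) as [K [HK HA]].
  set (d := 1 / 2 - theta). assert (Hd : 0 < d) by (unfold d; lra).
  set (q := 2 * (K / d * exp (- d * base))).
  assert (Hq : 0 <= q).
  { unfold q. apply Rmult_le_pos; [lra |]. apply Rmult_le_pos; [|left; apply exp_pos].
    apply Rdiv_le_0_compat; lra. }
  exists (Rabs K1 + 2 * A + (1 / 2 + T) * q). intros tau.
  pose proof (Rabs_pos tau). pose proof (Rabs_pos K1).
  assert (HP : 1 <= Rpower (1 + Rabs tau) eps) by (apply Rpower_ge_1; lra).
  assert (HTq : 0 <= (1 / 2 + T) * q) by (apply Rmult_le_pos; lra).
  destruct (Rle_dec T (Rabs tau)) as [Ht | Ht].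
  - specialize (HK1 tau Ht). rewrite (zeta_critical_line zeta tau Hz) in HK1.
    pose proof (polar_term_le tau) as HPt.
    set (z := (RtoC A / (((1 / 2)%R, tau) - RtoC 1))%C) in *.
    replace (zeta_regular (1 / 2, tau)) with ((z + zeta_regular ((1 / 2)%R, tau)) + - z)%C by ring.
    eapply Rle_trans. apply Cmod_triangle. rewrite Cmod_opp.
    assert (Rpower (Rabs tau) eps <= Rpower (1 + Rabs tau) eps) by (apply Rle_Rpower_l; lra).
    assert (0 < Rpower (Rabs tau) eps) by apply exp_pos.
    assert (K1 * Rpower (Rabs tau) eps <= Rabs K1 * Rpower (1 + Rabs tau) eps).
    { apply Rle_trans with (Rabs K1 * Rpower (Rabs tau) eps).
      - apply Rmult_le_compat_r; [lra | apply Rle_abs].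
      - apply Rmult_le_compat_l; lra. }
    nra.
  - eapply Rle_trans.
    + apply (Cmod_regular_part_le log_seq log_count A K theta base log_count_spec HK base_neg
        base_le_log_seq HA tau ltac:(lra)).
    + fold d q.
      assert ((1 / 2 + Rabs tau) * q <= (1 / 2 + T) * q) by (apply Rmult_le_compat_r; lra). nra.
Qed.

Lemma lindelof_implies_LH (zeta : C -> C) : is_zeta n A theta zeta ->
  lindelof_bound zeta -> LH n A.
Proof.
  intros Hz HL eps B Heps HB.
  (* The growth bound for phases divides by the exponent, which must therefore be positive; any
     value in [(0, 1/2)] not below [theta] would serve. *)
  set (th := Rmax theta (1 / 4)).
  assert (Hth : theta <= th) by apply Rmax_l.
  assert (Hth2 : 0 < th < 1 / 2).
  { split; [eapply Rlt_le_trans; [|apply Rmax_r]; lra | apply Rmax_lub_lt; lra]. }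
  destruct (log_count_asym th Hth) as [K [HK HA]].
  destruct (werror_phase_lindelof log_seq log_count A K th base log_count_spec A_pos HK ltac:(lra)
    base_neg base_le_log_seq HA Hth2 (zeta_regular_lindelof zeta Hz HL) eps B Heps HB) as [C0 HC0].
  set (n0 := n 0%nat). assert (Hn0 : 0 < n0) by apply n_pos.
  (* [LH] asks for a power of [|t|] itself, also for small [t]. But [n_1 <= x <= |t| ^ B] forces
     [|t| >= n_1 ^ (1 / B)], whence [2 + |t| <= k |t|]. *)
  set (k := 1 + 2 * / Rpower n0 (/ B)).
  assert (Hnp : 0 < Rpower n0 (/ B)) by apply exp_pos.
  assert (Hnv : 0 < / Rpower n0 (/ B)) by (apply Rinv_0_lt_compat; auto).
  assert (Hk : 1 <= k) by (unfold k; lra).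
  set (C1 := Rabs C0 + boundary_const * exp (- base / 2)).
  assert (Hbc := boundary_const_pos).
  assert (Hbe0 : 0 <= boundary_const * exp (- base / 2))
    by (apply Rmult_le_pos; auto; left; apply exp_pos).
  assert (HC1 : 0 <= C1) by (unfold C1; pose proof (Rabs_pos C0); lra).
  assert (HsA : 0 < sqrt A) by (apply sqrt_lt_R0; auto).
  (* The [2] adds the real and imaginary parts, [Rpower k eps] replaces [2 + |t|] by [|t|], and
     [sqrt A] matches the normalisation by [sqrt (A * x)]. *)
  exists (2 * C1 * Rpower k eps / sqrt A).
  intros t x Ht Hx. fold n0 in Hx.
  assert (Hx0 : 0 < x) by lra.
  assert (Ht0 : 0 < Rabs t) by (apply Rabs_pos_lt; auto).
  set (y := ln x). assert (Hxy : exp y = x) by (apply exp_ln; auto).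
  assert (Hly : log_seq 0 <= y) by (apply ln_le; [auto | apply Hx]).
  assert (Hby : base + 1 <= y) by (pose proof (base_le_log_seq 0); lra).
  assert (HT : 2 + Rabs t <= k * Rabs t).
  { assert (Rpower n0 (/ B) <= Rabs t).
    { apply Rle_trans with (Rpower (Rpower (Rabs t) B) (/ B)).
      - apply Rle_Rpower_l; [left; apply Rinv_0_lt_compat; auto |]. lra.
      - rewrite Rpower_mult, Rinv_r, Rpower_1; lra. }
    assert (1 <= / Rpower n0 (/ B) * Rabs t).
    { apply Rmult_le_reg_l with (Rpower n0 (/ B)); auto.
      rewrite <- Rmult_assoc, Rinv_r by lra. lra. }
    unfold k. lra. }
  assert (HTB : exp y <= Rpower (2 + Rabs t) B).
  { rewrite Hxy. eapply Rle_trans. apply Hx. apply Rle_Rpower_l; lra. }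
  assert (HP : 1 <= Rpower (2 + Rabs t) eps) by (apply Rpower_ge_1; lra).
  assert (HPk : Rpower (2 + Rabs t) eps <= Rpower k eps * Rpower (Rabs t) eps).
  { rewrite Rpower_mult_distr by lra. apply Rle_Rpower_l; lra. }
  pose proof (exp_pos (y / 2)) as Hy2.
  assert (Hbe : boundary_const <= boundary_const * exp (- base / 2) * exp (y / 2)).
  { rewrite Rmult_assoc, <- exp_plus. rewrite <- (Rmult_1_r boundary_const) at 1.
    apply Rmult_le_compat_l; auto. rewrite <- exp_0. apply exp_le_compat. lra. }
  destruct (LH_error_log t x ltac:(apply Hx)) as [E1 E2]. fold y in E1, E2.
  assert (Fin : forall phi r, Rabs (r - log_error (phase t phi) y) <= boundary_const ->
    Rabs r <= C1 * Rpower (2 + Rabs t) eps * exp (y / 2)).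
  { intros phi r Hr. assert (Q := HC0 t phi y Hby HTB). fold (log_error (phase t phi) y) in Q.
    assert (C0 * Rpower (2 + Rabs t) eps * exp (y / 2) <=
      Rabs C0 * Rpower (2 + Rabs t) eps * exp (y / 2)).
    { apply Rmult_le_compat_r; [lra |]. apply Rmult_le_compat_r; [lra | apply Rle_abs]. }
    assert (boundary_const * exp (- base / 2) * exp (y / 2) * 1 <=
      boundary_const * exp (- base / 2) * exp (y / 2) * Rpower (2 + Rabs t) eps)
      by (apply Rmult_le_compat_l; [apply Rmult_le_pos |]; lra).
    unfold C1. apply Rabs_le_between in Hr, Q. apply Rabs_le. lra. }
  assert (Z1 := Fin _ _ E1). assert (Z2 := Fin _ _ E2).
  apply Rle_trans with (Rabs (Re (LH_error t x)) + Rabs (Im (LH_error t x)));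
    [apply (Cmod_le_Rabs (LH_error t x)) |].
  assert (Hsq : sqrt (A * x) = sqrt A * exp (y / 2)).
  { rewrite sqrt_mult by lra. f_equal. apply sqrt_lem_1; [lra | lra |].
    rewrite <- Hxy, <- exp_plus. f_equal. field. }
  rewrite Hsq.
  replace (2 * C1 * Rpower k eps / sqrt A * (sqrt A * exp (y / 2) * Rpower (Rabs t) eps))
    with (2 * (C1 * (Rpower k eps * Rpower (Rabs t) eps) * exp (y / 2))) by (field; lra).
  assert (C1 * Rpower (2 + Rabs t) eps * exp (y / 2) <=
    C1 * (Rpower k eps * Rpower (Rabs t) eps) * exp (y / 2)).
  { apply Rmult_le_compat_r; [lra |]. apply Rmult_le_compat_l; auto. }
  lra.
Qed.

End Continuation.

Theorem theorem5p1 (n : nat -> R) (A theta : R)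
  (n_pos : forall j, 0 < n j)
  (n_nondecr : forall j, n j <= n (S j))
  (A_pos : 0 < A)
  (theta_range : 0 <= theta < 1 / 2)
  (n_count : counting_asymptotic n A theta) :
  (exists zeta : C -> C, is_zeta n A theta zeta) /\
  (forall zeta : C -> C, is_zeta n A theta zeta ->
     (LH n A <-> lindelof_bound zeta)).
Proof.
  split.
  - eexists. apply is_zeta_continuation; auto.
  - intros zeta Hz. split.
    + apply (LH_implies_lindelof n A theta); auto.
    + apply (lindelof_implies_LH n A theta n_pos n_nondecr A_pos theta_range n_count zeta Hz).
Qed.
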